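(* For every $A\in\Xi(\infty,r)$ one has, in $\widehat{\boldsymbol{\mathcal K}}(\infty,r)$ (indeed in $\mathbf V(\infty,r)$), $$\mathtt m^{(A)}=[A]+\sum_{B\in\Xi(\infty,r),\ B\prec A}f_{B,A}[B]$$ with a finite sum and coefficients $f_{B,A}\in\mathbb Z[v,v^{-1}]$. Hence the elements $\mathtt m^{(A)}$, $A\in\Xi(\infty,r)$, form a $\mathbb Z[v,v^{-1}]$-basis of $\mathcal K(\infty,r)$, and $\boldsymbol{\mathcal K}(\infty,r)\subseteq\mathbf V(\infty,r)$.
   Context: $v$ indeterminate, $\mathcal Z=\mathbb Z[v,v^{-1}]$, $[t]=\frac{v^t-v^{-t}}{v-v^{-1}}$, $[m]^!=[1]\cdots[m]$, $x^{(m)}=x^m/[m]^!$; for invertible $K$, $\left[{K;0\atop t}\right]=\prod_{s=1}^t\frac{Kv^{-s+1}-K^{-1}v^{s-1}}{v^s-v^{-s}}$. Matrices are $\mathbb Z\times\mathbb Z$ of finite support; $E_{i,j}$ matrix units; $\Xi(\infty,r)$ nonnegative integer matrices with entry sum $\sigma(A)=r$; $\Xi^\pm(\infty)$ nonnegative integer matrices with zero diagonal; $A^+$, $A^-$ strictly upper / lower triangular parts; $ro(A)$, $co(A)$ row / column sum sequences; $\mathbb Z^\infty$, $\mathbb N^\infty$ finitely supported integer / nonnegative sequences indexed by $\mathbb Z$, $\varepsilon_i$ unit sequences, $\Lambda(\infty,r)=\{\lambda\in\mathbb N^\infty:\sum\lambda_i=r\}$. $\sigma_i(A)=a_{ii}+\sum_{j<i}(a_{ij}+a_{ji})$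 and ${\boldsymbol\sigma}(A)=(\sigma_i(A))_i\in\Lambda(\infty,r)$ for $A\in\Xi(\infty,r)$. For $i\ne j$, $\sigma_{i,j}(A)=\sum_{s\le i,t\ge j}a_{st}$ if $i<j$ and $\sum_{s\ge i,t\le j}a_{st}$ if $i>j$; $B\prec A$ means $\sigma_{i,j}(B)\le\sigma_{i,j}(A)$ for all $i\ne j$ with strict inequality for some. $\mathcal K(\infty,r)$: for a finite field with $q$ elements and an $r$-dimensional space $V$, a $\mathbb Z$-step flag is $(V_i)_{i\in\mathbb Z}$, $V_i\subseteq V_{i+1}$, $V_i=0$ for $i\ll0$, $\bigcup V_i=V$; $GL(V)$-orbits $\mathcal O_A$ on pairs of flags correspond to $A\in\Xi(\infty,r)$ via $a_{ij}=\dim(V_{i-1}+V_i\cap V'_j)-\dim(V_{i-1}+V_i\cap V'_{j-1})$; for $(f_1,f_2)\in\mathcal O_C$ the number of $f$ with $(f_1,f)\in\mathcal O_A$, $(f,f_2)\in\mathcal O_B$ is $g_{A,B,C}|_{v^2=q}$ for some $g_{A,B,C}\in\mathbb Z[v^2]$. $\mathcal K(\infty,r)$ is the free $\mathcal Z$-module on $\{e_A\}$ with $e_Ae_B=\sum_Cg_{A,B,C}e_C$; $[A]=v^{-d_A}e_A$, $d_A=\sum_{i\ge k,j<l}a_{ij}a_{kl}$; $\boldsymbol{\mathcal K}(\infty,r)=\mathcal K(\infty,r)\otimes\mathbb Q(v)$. $\widehat{\boldsymbol{\mathcal K}}(\infty,r)$ is the algebra of formal sums $\sum_A\beta_A[A]$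 ($\beta_A\in\mathbb Q(v)$) such that for each $\lambda$ only finitely many $A$ with $\beta_A\ne0$ have $ro(A)=\lambda$ and only finitely many have $co(A)=\lambda$, with product extended bilinearly; it contains $\mathcal K(\infty,r)$. For $A\in\Xi^\pm(\infty)$, $\mathbf j\in\mathbb Z^\infty$: $A(\mathbf j,r)=\sum_{\lambda\in\mathbb N^\infty,\sigma(A)+\sigma(\lambda)=r}v^{\sum\lambda_ij_i}[A+\operatorname{diag}(\lambda)]$; $\mathbf V(\infty,r)$ is the $\mathbb Q(v)$-span of these (a subalgebra). Let $\mathtt e_i=E_{i,i+1}(\mathbf 0,r)$, $\mathtt f_i=E_{i+1,i}(\mathbf 0,r)$, $\mathtt k_i=0(\varepsilon_i,r)$. For $A\in\Xi^\pm(\infty)$ supported in $[m,n]\times[m,n]$: $\mathtt e^{(A^+)}=M_nM_{n-1}\cdots M_{m+1}$, $M_j=\mathtt e_{j-1}^{(a_{j-1,j})}(\mathtt e_{j-2}^{(a_{j-2,j})}\mathtt e_{j-1}^{(a_{j-2,j})})\cdots(\mathtt e_m^{(a_{m,j})}\mathtt e_{m+1}^{(a_{m,j})}\cdots\mathtt e_{j-1}^{(a_{m,j})})$, and $\mathtt f^{(A^-)}=M'_{m+1}\cdots M'_n$, $M'_j=(\mathtt f_{j-1}^{(a_{j,m})}\cdots\mathtt f_m^{(a_{j,m})})\cdots(\mathtt f_{j-1}^{(a_{j,j-2})}\mathtt f_{j-2}^{(a_{j,j-2})})\mathtt f_{j-1}^{(a_{j,j-1})}$ (independent of $m,n$); for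 general $A$ these use the off-diagonal part of $A$. For $\nu\in\Lambda(\infty,r)$, $\mathtt k_\nu=\prod_{i\in\mathbb Z}\left[{\mathtt k_i;0\atop\nu_i}\right]$. For $A\in\Xi(\infty,r)$, $\mathtt m^{(A)}=\mathtt e^{(A^+)}\mathtt k_{{\boldsymbol\sigma}(A)}\mathtt f^{(A^-)}$. *)

(* Defs.v *)
From HB Require Import structures.
From mathcomp Require Import all_boot all_order all_algebra.
From mathcomp Require Import finmap fraction.
From mathcomp Require Import boolp classical_sets cardinality fsbigop.
From Stdlib Require Import ClassicalEpsilon.
Set Implicit Arguments. Unset Strict Implicit. Unset Printing Implicit Defensive.
Import Order.TTheory GRing.Theory Num.Theory.
Local Open Scope ring_scope.

Definition mat := {fsfun (int * int) -> nat with 0%N}.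
Definition nvec := {fsfun int -> nat with 0%N}.
Definition zvec := {fsfun int -> int with 0}.

Definition mat0 : mat := [fsfun p in fset0 => 0%N | 0%N].
Definition zvec0 : zvec := [fsfun k in fset0 => 0 | 0].
Definition epsv (i : int) : zvec := [fsfun k in [fset i]%fset => 1 | 0].
Definition Emat (i j : int) : mat := [fsfun p in [fset (i, j)]%fset => 1%N | 0%N].
Definition madd (A B : mat) : mat :=
  [fsfun p in (finsupp A `|` finsupp B)%fset => (A p + B p)%N | 0%N].
Definition diagm (l : nvec) : mat :=
  [fsfun p in [fset (i, i) | i in finsupp l]%fset =>
     (if p.1 == p.2 then l p.1 else 0%N) | 0%N].

Definition sig (A : mat) : nat := (\sum_(p <- finsupp A) A p)%N.
Definition ro (A : mat) (i : int) : nat := (\sum_(p <- finsupp A | p.1 == i) A p)%N.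
Definition co (A : mat) (j : int) : nat := (\sum_(p <- finsupp A | p.2 == j) A p)%N.
Definition sigl (l : nvec) : nat := (\sum_(i <- finsupp l) l i)%N.
Definition isPM (A : mat) : Prop := forall i, A (i, i) = 0%N.
Definition sigi (A : mat) (i : int) : nat :=
  (A (i, i) + \sum_(p <- finsupp A | (p.1 == i) && (p.2 < i)%R) A p
            + \sum_(p <- finsupp A | (p.2 == i) && (p.1 < i)%R) A p)%N.
Definition sigij (A : mat) (i j : int) : nat :=
  if i < j then (\sum_(p <- finsupp A | (p.1 <= i)%R && (j <= p.2)%R) A p)%N
  else (\sum_(p <- finsupp A | (i <= p.1)%R && (p.2 <= j)%R) A p)%N.
Definition prec (B A : mat) : Prop :=
  (forall i j, i != j -> (sigij B i j <= sigij A i j)%N) /\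
  (exists i j, i != j /\ (sigij B i j < sigij A i j)%N).
Definition dA (A : mat) : nat :=
  (\sum_(p <- finsupp A) \sum_(q <- finsupp A | (q.1 <= p.1)%R && (p.2 < q.2)%R)
     A p * A q)%N.

Definition Qv := {fraction {poly rat}}.
Definition v : Qv := tofrac 'X.
Definition laurent (x : Qv) : Prop :=
  exists (p : {poly int}) (k : nat), x = tofrac (map_poly intr p) / v ^+ k.
Definition qint (t : nat) : Qv := (v ^+ t - v ^- t) / (v - v^-1).
Definition qfact (m : nat) : Qv := \prod_(1 <= t < m.+1) qint t.

Section Flags.
Variables (F : finFieldType) (n : nat).
Definition flagT := int -> {vspace 'rV[F]_n}.
Definition is_flag (f : flagT) : Prop :=
  (forall i, (f i <= f (i + 1)%R)%VS) /\
  (exists N : int, forall i, i <= N -> f i = 0%VS) /\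
  (forall x : 'rV[F]_n, exists i, x \in f i).
Definition orbit_mat (f1 f2 : flagT) (A : mat) : Prop :=
  forall i j, A (i, j) =
    (\dim (f1 (i - 1)%R + (f1 i :&: f2 j)) - \dim (f1 (i - 1)%R + (f1 i :&: f2 (j - 1)%R)))%N.
Definition count_is (P : flagT -> Prop) (k : nat) : Prop :=
  exists g : 'I_k -> flagT,
    (forall t, P (g t)) /\ (forall s t, g s =1 g t -> s = t) /\
    (forall f, P f -> exists t, f =1 g t).
End Flags.

(* P in Z[x] with g_{A,B,C} = P(v^2): for every finite field with q elements and
   every (f1,f2) in O_C, #{f | (f1,f) in O_A, (f,f2) in O_B} = P(q) *)
Definition gpoly_spec (A B C : mat) (P : {poly int}) : Prop :=
  forall (F : finFieldType) (f1 f2 : flagT F (sig C)),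
    is_flag f1 -> is_flag f2 -> orbit_mat f1 f2 C ->
    exists k, count_is (fun f => is_flag f /\ orbit_mat f1 f A /\ orbit_mat f f2 B) k
              /\ k%:Z = P.[(#|F|)%:Z].
Definition gpoly (A B C : mat) : {poly int} :=
  epsilon (inhabits 0) (gpoly_spec A B C).
Definition gQ (A B C : mat) : Qv :=
  tofrac ((map_poly intr (gpoly A B C) : {poly rat}) \Po 'X^2).

(* ---------- formal sums  sum_A beta_A [A]  (coefficients w.r.t. [A]) ---------- *)
Definition elt := mat -> Qv.
Definition basisv (A : mat) : elt := fun B => (B == A)%:R.
Definition eadd (x y : elt) : elt := fun C => x C + y C.
Definition escal (c : Qv) (x : elt) : elt := fun C => c * x C.
(* product: [A][B] = v^{-d_A-d_B} e_A e_B = sum_C v^{d_C-d_A-d_B} g_{A,B,C} [C],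
   extended bilinearly (only (A,B) with ro A = ro C, co A = ro B, co B = co C
   can contribute, since g_{A,B,C} = 0 otherwise) *)
Definition emul (x y : elt) : elt := fun C =>
  \sum_(p \in (fun p : mat * mat => ro p.1 =1 ro C /\ co p.2 =1 co C /\ co p.1 =1 ro p.2))
     x p.1 * y p.2 * (v ^ ((dA C)%:Z - (dA p.1)%:Z - (dA p.2)%:Z) * gQ p.1 p.2 C).
Definition inHatK (r : nat) (x : elt) : Prop :=
  (forall C, x C != 0 -> sig C = r) /\
  (forall lam : int -> nat,
     finite_set (fun A => x A != 0 /\ ro A =1 lam) /\
     finite_set (fun A => x A != 0 /\ co A =1 lam)).

Definition dotv (l : nvec) (j : zvec) : int := \sum_(i <- finsupp l) (l i)%:Z * j i.
Definition Aj (A : mat) (j : zvec) (r : nat) : elt := fun C =>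
  \sum_(l \in (fun l : nvec => (sig A + sigl l)%N = r))
     v ^ (dotv l j) * (C == madd A (diagm l))%:R.
Definition inV (r : nat) (x : elt) : Prop :=
  exists s : seq (mat * zvec * Qv),
    (forall t, t \in s -> isPM t.1.1) /\
    x =1 foldr (fun t acc => eadd (escal t.2 (Aj t.1.1 t.1.2 r)) acc) (fun _ => 0) s.

(* identity of \hat K(infty,r): sum_{lambda in Lambda(infty,r)} [diag lambda] = 0(0,r) *)
Definition eone (r : nat) : elt := Aj mat0 zvec0 r.
Definition prodl (r : nat) (xs : seq elt) : elt := foldr emul (eone r) xs.
Definition epow (r : nat) (x : elt) (m : nat) : elt := iter m (emul x) (eone r).
Definition dpow (r : nat) (x : elt) (m : nat) : elt := escal (qfact m)^-1 (epow r x m).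
Definition invK (r : nat) (x : elt) : elt :=
  epsilon (inhabits (fun _ => 0))
    (fun y => inHatK r y /\ emul x y = eone r /\ emul y x = eone r).
Definition gauss (r : nat) (K : elt) (t : nat) : elt :=
  prodl r [seq escal (v ^+ s - v ^- s)^-1
                 (eadd (escal (v ^ (1 - s%:Z)) K) (escal (- v ^ (s%:Z - 1)) (invK r K)))
          | s <- iota 1 t].

Definition ee (r : nat) (i : int) : elt := Aj (Emat i (i + 1)) zvec0 r.
Definition ff (r : nat) (i : int) : elt := Aj (Emat (i + 1) i) zvec0 r.
Definition kk (r : nat) (i : int) : elt := Aj mat0 (epsv i) r.

Definition intrange (m n : int) : seq int :=
  if m <= n then [seq m + (k%:Z) | k <- iota 0 (absz (n - m) + 1)] else [::].
Definition lo (A : mat) : int := \big[Num.min/0]_(p <- finsupp A) Num.min p.1 p.2.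
Definition hi (A : mat) : int := \big[Num.max/0]_(p <- finsupp A) Num.max p.1 p.2.

Definition Mj (r : nat) (A : mat) (m j : int) : elt :=
  prodl r [seq prodl r [seq dpow r (ee r k) (A (i, j)) | k <- intrange i (j - 1)]
          | i <- rev (intrange m (j - 1))].
Definition ePlus (r : nat) (A : mat) : elt :=
  prodl r [seq Mj r A (lo A) j | j <- rev (intrange (lo A + 1) (hi A))].
Definition Mj' (r : nat) (A : mat) (m j : int) : elt :=
  prodl r [seq prodl r [seq dpow r (ff r k) (A (j, i)) | k <- rev (intrange i (j - 1))]
          | i <- intrange m (j - 1)].
Definition fMinus (r : nat) (A : mat) : elt :=
  prodl r [seq Mj' r A (lo A) j | j <- intrange (lo A + 1) (hi A)].
(* k_{sigma(A)} = prod_i [k_i;0 \atop sigma_i(A)]; factors with sigma_i(A) = 0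
   (in particular all i outside [lo A, hi A]) equal 1 and are omitted *)
Definition ksig (r : nat) (A : mat) : elt :=
  prodl r [seq gauss r (kk r i) (sigi A i) | i <- intrange (lo A) (hi A)].
Definition mm (r : nat) (A : mat) : elt := emul (emul (ePlus r A) (ksig r A)) (fMinus r A).

Definition KZ (r : nat) (phi : elt) : Prop :=
  finite_set (fun A => phi A != 0) /\ (forall A, phi A != 0 -> sig A = r) /\
  (forall A, laurent (phi A)).
Definition KQ (r : nat) (phi : elt) : Prop :=
  finite_set (fun A => phi A != 0) /\ (forall A, phi A != 0 -> sig A = r).
Definition comb (r : nat) (c : mat -> Qv) : elt := fun C =>
  \sum_(A \in (fun A : mat => True)) c A * mm r A C.

(* Main.v *)
(* The coefficient of e_C in e_A e_B counts flags.  For A = a E_{h,h+1} + diagonal or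
   a E_{h+1,h} + diagonal the flags to count differ from a given one in a single
   component W, constrained by the dimensions of its intersections with the second flag,
   so the count is a product of Gaussian binomials; inducting along the order prec,
   every e_A is e_{S_1} ... e_{S_k} minus lower terms for such S_i, and so all structure
   constants are polynomial in q.  When all a units are moved in the extreme possible
   column, the subspace W is unique, which gives [S][B] = [C] + lower terms with leading
   coefficient 1.  Starting from the diagonal matrix with the column sums of A, the
   factors f_i of the monomial put the entries of A below the diagonal in place one after
   another, those above it follow from the e_i, and every step is such a leading move; in
   between, k_sigma(A) selects the matrices with row sums sigma(A), because the product
   of the [mu_i; sigma_i(A)] vanishes unless mu = sigma(A) when mu and sigma(A) have
   the same total.  The same product of Gaussian binomials, expanded into characters
   of the diagonal, writes every [A] as a combination of the A(j,r). *)
Require Import Defs.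
From HB Require Import structures.
From mathcomp Require Import all_boot all_order all_algebra all_field.
From mathcomp Require Import finmap fraction zify ring.
From Stdlib Require ClassicalEpsilon.
From mathcomp Require Import boolp classical_sets cardinality fsbigop.
Import Order.TTheory GRing.Theory Num.Theory.
Local Open Scope ring_scope.
Set Implicit Arguments.
Unset Strict Implicit.

(** * Counting subspaces over a finite field *)

(** [gpoly] is picked by choice, so nothing is known about the product until polynomial counts have
    been shown to exist; afterwards it is pinned down by its values at primes, every position being
    realised by coordinate flags over F_p. Two obstacles of finiteness shape the rest. Flags and
    matrices are indexed by Z, so counts are taken in a window [-N, N], outside which flags are 0 or
    everything; a position matrix supported there forces both flags into the window. And e_i, f_i,
    k_i run over infinitely many diagonals. For them [loc] says that a bound on the columns of a
    matrix in the support also bounds its rows, which makes every coefficient of a product a finite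
    sum and gives associativity. Because of those infinite diagonals a product of f_i has no leading
    term as a whole, and [tri] compares only matrices with the same row sums; [top] becomes
    available once k_sigma has been applied. Inductions along prec run on the integer [wt], the sum
    of all sigma_{i,j} in the window, which drops strictly along prec. *)

HB.instance Definition _ (F : finFieldType) (vT : vectType F) :=
  CanIsCountable (@VectorInternalTheory.vs2mxK F vT).
HB.instance Definition _ (F : finFieldType) (vT : vectType F) :
  isFinite {vspace vT} := CanIsFinite (@VectorInternalTheory.vs2mxK F vT).

(** Gaussian binomials through the q-Pascal rule, so that they are polynomials by construction. *)
Fixpoint qbin (n m : nat) : {poly int} :=
  match n, m with
  | _, 0 => 1
  | 0, _.+1 => 0
  | n1.+1, m1.+1 => 'X^(m1.+1) * qbin n1 m1.+1 + qbin n1 m1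
  end.

(** At X = q this counts the linearly independent m-tuples in an n-dimensional space over F_q. *)
Definition qfall (n m : nat) : {poly int} := \prod_(i < m) ('X^n - 'X^i).

Lemma qfallS (n m : nat) : qfall n.+1 m.+1 = ('X^(n.+1) - 1) * 'X^m * qfall n m.
Proof.
rewrite /qfall big_ord_recl /= expr0 -mulrA; congr (_ * _).
elim: m => [|m IH]; first by rewrite !big_ord0 expr0 mulr1.
rewrite big_ord_recr /= IH big_ord_recr /= /bump /= add1n.
by rewrite !exprS; ring.
Qed.

Lemma qfall_diag_neq0 (m : nat) : qfall m m != 0.
Proof.
elim: m => [|m IH]; first by rewrite /qfall big_ord0 oner_eq0.
rewrite qfallS !mulf_neq0 // ?monic_neq0 ?monicXn //.
by rewrite monicXnsubC.
Qed.

Lemma qfallE (n m : nat) : qfall n m = qbin n m * qfall m m.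
Proof.
elim: n m => [|n IH] [|m] /=; rewrite ?mul1r ?mul0r //.
- by rewrite /qfall big_ord_recl expr0 subrr mul0r.
- by rewrite /qfall !big_ord0.
rewrite qfallS [in RHS]qfallS IH.
(* Two neighbours in row n, compared by cancelling [qfall m m] from the induction hypotheses at m
   and m + 1. *)
have E : ('X^n - 'X^m) * qbin n m = 'X^m * ('X^(m.+1) - 1) * qbin n m.+1.
  apply: (mulIf (qfall_diag_neq0 m)).
  have := IH m.+1; rewrite qfallS.
  have -> : qfall n m.+1 = qfall n m * ('X^n - 'X^m) by rewrite /qfall big_ord_recr.
  rewrite IH => e.
  transitivity (qbin n m * qfall m m * ('X^n - 'X^m)); first by ring.
  by rewrite e; ring.
transitivity ('X^m * qfall m m * ('X * (('X^n - 'X^m) * qbin n m) +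
   ('X^(m.+1) - 1) * qbin n m)); first by rewrite !exprS; ring.
by rewrite E exprS; ring.
Qed.

Ltac vlia := unfold reverse_coercion in *; simpl Vector.sort in *; simpl Choice.sort in *;
  simpl Equality.sort in *; lia.

Lemma dim_add_line (k : fieldType) (vT : vectType k) (K : {vspace vT}) (x : vT) : \dim (K + <[x]>) = (\dim K + (x \notin K))%N.
Proof.
case: (boolP (x \in K)) => /= xK.
  by rewrite addn0 (addv_idPl _) // -memvE.
rewrite dimv_disjoint_sum ?dim_vline.
  by rewrite (memPnC xK) // mem0v.
apply/eqP; rewrite -subv0; apply/subvP => y /memv_capP[yK /vlineP[c yE]].
rewrite memv0; apply/eqP; subst y; case: (eqVneq c 0) => [->|c0]; first by rewrite scale0r.
by move: yK; rewrite rpredZeq (negPf c0) /= (negPf xK).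
Qed.

Lemma dim_add_span (k : fieldType) (vT : vectType k) (K : {vspace vT}) (s : seq vT) : (\dim (K + <<s>>) <= \dim K + size s)%N.
Proof.
have := (dimv_add_leqif K <<s>>%VS).1; have := dim_span s; lia.
Qed.

Section SubspaceCount.
Variables (F : finFieldType) (n : nat).
Local Notation V := 'rV[F]_n.
Local Notation q := (#|F|%:Z).
Implicit Types (P Z H K U : {vspace V}).

Definition indep_mod (m : nat) K H : {set m.-tuple V} :=
  [set s : m.-tuple V | all (mem H) s && (\dim (K + <<s>>) == \dim K + m)%N].

Lemma indep_modS (m : nat) K H (x : V) (s : m.-tuple V) :
  ([tuple of x :: s] \in indep_mod m.+1 K H) =
  [&& s \in indep_mod m K H, x \in H & x \notin (K + <<s>>)%VS].
Proof.
rewrite !inE /= span_cons [(<[x]> + _)%VS]addvC addvA dim_add_line.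
have := dim_add_span K s; rewrite size_tuple.
by case: (x \in H); case: (all _ _); case: (x \in (K + _)%VS) => //=; vlia.
Qed.

Lemma card_indep_mod (m : nat) K H : (K <= H)%VS ->
  (#|indep_mod m K H|)%:Z = \prod_(i < m) (q ^+ \dim H - q ^+ (\dim K + i)).
Proof.
move=> KH; elim: m => [|m IH].
  rewrite big_ord0 (_ : indep_mod 0 K H = [set [tuple]]) ?cards1 //.
  by apply/setP => s; rewrite !inE tuple0 span_nil addv0 addn0 !eqxx.
rewrite big_ord_recr /= -IH -[in LHS]sum1_card.
rewrite /reverse_coercion.
rewrite (reindex (fun p : V * m.-tuple V => [tuple of p.1 :: p.2])) /=; last first.
  exists (fun t : m.+1.-tuple V => (thead t, [tuple of behead t])).
    by case=> x s _; congr (_, _); apply: val_inj.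
  by move=> t _; rewrite -tuple_eta.
under eq_bigl do rewrite indep_modS.
rewrite -(pair_big_dep xpredT
  (fun x (s : m.-tuple V) => [&& s \in indep_mod m K H, x \in H & x \notin (K + <<s>>)%VS])
  (fun _ _ => 1%N)) /=.
under eq_bigr do under eq_bigl do rewrite andbC.
rewrite (exchange_big_dep (fun s => s \in indep_mod m K H)) /=; last by move=> x s _ /andP[].
have c1 (s : m.-tuple V) : s \in indep_mod m K H ->
    (\sum_(x : V | (x \in H) && (x \notin (K + <<s>>)%VS)) 1)%N =
    (#|F| ^ \dim H - #|F| ^ (\dim K + m))%N /\ (\dim K + m <= \dim H)%N.
  rewrite inE => /andP[/allP sH /eqP <-].
  have sub : (K + <<s>> <= H)%VS by rewrite subv_add KH; apply/span_subvP.
  split; last exact: dimvS.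
  rewrite -(card_vspace H) -(card_vspace (K + <<s>>)) sum1_card.
  rewrite -(cardID (mem (K + <<s>>)%VS) (mem H)).
  rewrite (@eq_card _ [predI mem H & mem (K + <<s>>)%VS] (mem (K + <<s>>)%VS)); last first.
    by move=> x; rewrite !inE; case: (boolP (x \in (K + _)%VS)) => [xK|_]; rewrite ?andbF // (subvP sub _ xK).
  rewrite addKn; apply: eq_card => x; rewrite !inE andbC //.
(* If there is no m-tuple, both sides are 0 by the induction hypothesis; otherwise dim K + m <= dim
   H, and the truncated difference is exact. *)
case: (set_0Vmem (indep_mod m K H)) => [-> | [s0 /c1[_ le]]].
  by rewrite cards0 big1 ?mul0r // => s; rewrite inE.
rewrite (eq_bigr (fun _ => #|F| ^ \dim H - #|F| ^ (\dim K + m))%N); last first.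
  move=> s /[dup] sI /c1[<- _]; apply: eq_bigl => x.
  by rewrite sI andbT.
rewrite sum_nat_const PoszM; congr (_ * _).
by rewrite -!natz natrB ?natrX ?leq_exp2l ?finNzRing_gt1.
Qed.

(** Double counting of the m-tuples of H that are independent modulo P + Z. Each of them spans,
    together with P, exactly one admissible U; inside a given U, independence modulo P + Z is the
    same as independence modulo P, because U meets Z only in P :&: Z. The quotient of the two
    products leaves a Gaussian binomial. *)
Lemma card_subspaces_meet (m : nat) P Z H : (P <= H)%VS -> (Z <= H)%VS ->
  (#|[set U : {vspace V} | [&& (P <= U)%VS, (U <= H)%VS, (U :&: Z == P :&: Z)%VS &
      \dim U == \dim P + m]%N]|)%:Z =
  ('X^((\dim (P + Z) - \dim P) * m) * qbin (\dim H - \dim (P + Z)) m).[q].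
Proof.
move=> PH ZH; set S := [set U | _].
unfold reverse_coercion in *.
set K := (P + Z)%VS; have KH : (K <= H)%VS by rewrite subv_add PH.
have PK : (\dim P <= \dim K)%N by rewrite dimvS // addvSl.
have kh : (\dim K <= \dim H)%N by rewrite dimvS.
have dK : (\dim K + \dim (P :&: Z) = \dim P + \dim Z)%N := dimv_sum_cap P Z.
have part : \sum_(U in S) (#|indep_mod m P U|)%:Z = (#|indep_mod m K H|)%:Z.
  rewrite -[#|indep_mod m K H|]sum1_card.
  rewrite (partition_big (fun s : m.-tuple V => (P + <<s>>)%VS) (mem S)) /=; last first.
    move=> s; rewrite !inE => /andP[/allP sH /eqP ds].
    have sH' : (<<s>> <= H)%VS by apply/span_subvP.
    rewrite addvSl subv_add PH sH' /=.
    have := dim_add_span P s; rewrite size_tuple => d1.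
    have d2 := dimv_sum_cap (P + <<s>>)%VS Z.
    have e : (P + <<s>> + Z = K + <<s>>)%VS by rewrite -!addvA [(<<s>> + Z)%VS]addvC.
    have i : (P :&: Z <= (P + <<s>>) :&: Z)%VS by rewrite capvS // addvSl.
    have d3 := dimvS i.
    rewrite e ds in d2.
    apply/andP; split; last by apply/eqP; vlia.
    by rewrite eq_sym eqEdim i /=; vlia.
  rewrite -[RHS]natz natr_sum; apply: eq_bigr => U.
  rewrite natz !inE => /and4P[PU UH /eqP UZ /eqP dU].
  rewrite sum1dep_card; congr (Posz _); apply: eq_card => s; rewrite !inE.
  have sub_all (T : {vspace V}) : all (mem T) s = (<<s>> <= T)%VS.
    by apply/allP/span_subvP.
  have := dimv_sum_cap U Z; rewrite UZ dU => d2.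
  rewrite !sub_all; apply/idP/idP.
    case/andP=> sU /eqP ds; rewrite (subv_trans sU UH) /=.
    have e : (P + <<s>> = U)%VS.
      by apply/eqP; rewrite eqEdim subv_add PU sU /= ds dU.
    have e1 : (K + <<s>> = U + Z)%VS by rewrite -e -!addvA [(<<s>> + Z)%VS]addvC.
    rewrite e eqxx andbT e1.
    by apply/eqP; vlia.
  case/andP=> /andP[sH /eqP ds] /eqP e.
  have sU : (<<s>> <= U)%VS by rewrite -e addvSr.
  by rewrite sU e dU eqxx.
have big1 (T : {vspace V}) (a k : nat) : \dim T = (a + k)%N ->
    \prod_(i < m) (q ^+ \dim T - q ^+ (a + i)) = q ^+ (a * m) * (qfall k m).[q].
  move=> ->; rewrite /qfall horner_prod exprM.
  have -> : (q ^+ a) ^+ m = \prod_(i < m) q ^+ a by rewrite prodr_const card_ord.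
  by rewrite -big_split; apply: eq_bigr => i _; rewrite !hornerE /= mulrBr -!exprD.
move: part; rewrite (card_indep_mod m KH) (big1 H (\dim K) (\dim H - \dim K)%N); last by vlia.
rewrite (eq_bigr (fun _ => q ^+ (\dim P * m) * (qfall m m).[q])); last first.
  move=> U; rewrite inE => /and4P[PU UH /eqP UZ /eqP dU].
  by rewrite card_indep_mod // (big1 U (\dim P) m).
rewrite sumr_const -[LHS]mulr_natl natz (qfallE (\dim H - \dim K)) hornerM.
have -> : (\dim K * m = (\dim K - \dim P) * m + \dim P * m)%N by rewrite -mulnDl subnK.
rewrite exprD hornerM hornerXn => e.
have q1 : (1 < #|F|)%N := finNzRing_gt1 F.
have q0 : q ^+ (\dim P * m) * (qfall m m).[q] != 0.
  rewrite mulf_neq0 ?expf_neq0 //; first by lia.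
  rewrite /qfall horner_prod; apply/prodf_neq0 => i _; rewrite !hornerE.
  by rewrite subr_eq0 -!natz -!natrX eqr_nat eqn_exp2l //; have := ltn_ord i; lia.
by apply: (mulIf q0); rewrite e; ring.
Qed.

(** Models the one component replaced by an elementary step: L is the component of the first flag
    just below it, and H is the chain that the second flag cuts out in the component just above
    it. *)
Definition subspaces_meeting (H : nat -> {vspace V}) (L : {vspace V}) (w : nat -> nat) (k : nat) :
    {set {vspace V}} :=
  [set U : {vspace V} | [&& (L :&: H k <= U)%VS, (U <= H k)%VS &
     [forall j : 'I_k.+1, \dim (U :&: H j) == w j]]].

(** Every W over U contains P = U + (L :&: H k.+1), and P meets H k exactly in U by the modular law,
    so [card_subspaces_meet] applies with Z = H k. When p > w k.+1 the fibre is empty, whereas the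
    formula with its truncated difference would give 1; hence the test. *)
Lemma card_meets_fiber (k : nat) (H : nat -> {vspace V}) (L U : {vspace V}) (w : nat -> nat)
    (p := (w k + \dim (L :&: H k.+1) - \dim (L :&: H k))%N)
    (z := (p + \dim (H k) - w k)%N) :
  (H k <= H k.+1)%VS -> (forall j, (j <= k)%N -> (H j <= H k)%VS) -> U \in subspaces_meeting H L w k ->
  #|[set W in subspaces_meeting H L w k.+1 | (W :&: H k)%VS == U]|%:Z =
   (if (p <= w k.+1)%N
    then 'X^((z - p) * (w k.+1 - p)) * qbin (\dim (H k.+1) - z) (w k.+1 - p)
    else 0).[q].
Proof.
move=> Hk Hle; rewrite inE => /and3P[LU UH /forallP dU].
have dUk : \dim U = w k by have /eqP := dU ord_max; rewrite /= (capv_idPl UH).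
set L1 := (L :&: H k.+1)%VS; set P := (U + L1)%VS.
have L1k : (L1 :&: H k = L :&: H k)%VS by rewrite /L1 -capvA (capv_idPr Hk).
have PU : (P :&: H k = U)%VS.
  by rewrite /P -vspace_modl // L1k (addv_idPl LU).
have UL1 : (U :&: L1 = L :&: H k)%VS.
  by rewrite -{1}(capv_idPl UH) -capvA [(H k :&: L1)%VS]capvC L1k (capv_idPr LU).
have dP : \dim P = p.
  by have := dimv_sum_cap U L1; rewrite UL1 /p dUk -/P -/L1; vlia.
have PH1 : (P <= H k.+1)%VS by rewrite subv_add (subv_trans UH Hk) capvSr.
have dz : \dim (P + H k)%VS = z.
  by have := dimv_sum_cap P (H k); rewrite PU dP /z dUk; vlia.
case: ifP => pw.
  have E := card_subspaces_meet (w k.+1 - p) PH1 Hk.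
  rewrite -/P dz dP subnKC // in E; rewrite -E; congr (Posz _); apply: eq_card => W.
  rewrite !inE PU; apply/idP/idP.
    case/andP=> /and3P[LW WH /forallP dW] /eqP WU; rewrite WU eqxx WH /=.
    rewrite subv_add -{1}WU capvSl LW /=.
    by have := dW ord_max; rewrite /= (capv_idPl WH).
  case/and4P=> PW WH /eqP WU /eqP dW; rewrite WU eqxx WH andbT /=.
  rewrite (subv_trans (addvSr _ _) PW) /=; apply/forallP => j.
  have [jk|jk] := leqP j k.
    have -> : (W :&: H j = U :&: H j)%VS by rewrite -WU -capvA (capv_idPr (Hle _ jk)).
    exact: (dU (Ordinal (jk : j < k.+1)%N)).
  have -> : (j : nat) = k.+1 by have := ltn_ord j; lia.
  by rewrite (capv_idPl WH) dW.
rewrite horner0 (_ : [set _ in _ | _] = finset.set0) ?cards0 //.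
apply/setP => W; rewrite !inE; apply/negP.
case/andP=> /and3P[LW WH /forallP dW] /eqP WU.
have PW : (P <= W)%VS by rewrite subv_add LW -WU capvSl.
by have /eqP := dW ord_max; rewrite /= (capv_idPl WH) => d; have := dimvS PW; rewrite dP d pw.
Qed.

End SubspaceCount.

(** The map W to W :&: H k splits the count into fibres whose common size depends only on
    dimensions. Therefore one polynomial serves all fields, spaces and chains with the same
    dimensions. *)
Lemma card_meets_poly (k : nat) (h l w : nat -> nat) : h 0%N = 0%N ->
  exists P : {poly int}, forall (F : finFieldType) (n : nat) (H : nat -> {vspace 'rV[F]_n})
    (L : {vspace 'rV[F]_n}),
    (forall j, (j < k)%N -> (H j <= H j.+1)%VS) ->
    (forall j, j <= k -> \dim (H j) = h j /\ \dim (L :&: H j) = l j)%N ->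
    #|subspaces_meeting H L w k|%:Z = P.[#|F|%:Z].
Proof.
move=> h0; elim: k => [|k [P IH]].
  exists (if w 0%N == 0%N then 1 else 0) => F n H L _ d.
  have H0 : H 0%N = 0%VS by apply/eqP; rewrite -dimv_eq0 (d 0%N _).1 // h0.
  rewrite /subspaces_meeting H0 capv0; case: eqP => w0.
    rewrite hornerC (_ : [set _ | _] = [set 0%VS]) ?cards1 //; apply/setP => U.
    rewrite !inE sub0v subv0 /=; apply/andP/idP => [[]//|/eqP->]; split => //.
    by apply/forallP => -[[|j] //] ?; rewrite cap0v dimv0 w0.
  rewrite horner0 (_ : [set _ | _] = finset.set0) ?cards0 //; apply/setP => U.
  rewrite !inE; apply/negP => /and3P[_ _ /forallP/(_ ord0)] /=.
  by rewrite H0 capv0 dimv0 eq_sym => /eqP.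
exists (P * (let p := (w k + l k.+1 - l k)%N in let z := (p + h k - w k)%N in
  if (p <= w k.+1)%N
    then 'X^((z - p) * (w k.+1 - p)) * qbin (h k.+1 - z) (w k.+1 - p)
    else 0)) => F n H L Hs d.
have Hle j : (j <= k)%N -> (H j <= H k)%VS.
  move=> jk; have Hs' i : (i < k)%N -> (H i <= H i.+1)%VS by move=> ?; apply: Hs; lia.
  elim: (k) jk Hs' => [|m IHm]; first by rewrite leqn0 => /eqP->.
  rewrite leq_eqVlt => /predU1P[->//|jm] Hs'.
  by apply: subv_trans (IHm _ _) (Hs' _ _) => // i im; apply: Hs'; lia.
rewrite hornerM -(IH F n H L); first last.
- by move=> j jk; apply: d; lia.
- by move=> j jk; apply: Hs; lia.
rewrite -[#|subspaces_meeting H L w k.+1|]sum1_card.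
rewrite (partition_big (fun W => (W :&: H k)%VS) (mem (subspaces_meeting H L w k))) /=; last first.
  move=> W; rewrite !inE => /and3P[LW WH /forallP dW].
  rewrite capvSr /=; apply/andP; split.
    rewrite subv_cap capvSr andbT (subv_trans _ LW) // capvS //.
    exact: Hs.
  apply/forallP => j; have jk : (j <= k)%N by rewrite -ltnS.
  rewrite -capvA (capv_idPr (Hle _ jk)).
  exact: (dW (widen_ord (leqnSn _) j)).
rewrite -[LHS]natz natr_sum.
rewrite (eq_bigr (fun _ => (let p := (w k + l k.+1 - l k)%N in let z := (p + h k - w k)%N in
  if (p <= w k.+1)%N
    then 'X^((z - p) * (w k.+1 - p)) * qbin (h k.+1 - z) (w k.+1 - p)
    else 0).[#|F|%:Z])); last first.
  move=> U US /=; rewrite natz sum1dep_card card_meets_fiber //; last exact: Hs.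
  by rewrite (d k _).1 ?(d k _).2 ?(d k.+1 _).1 ?(d k.+1 _).2.
by rewrite sumr_const -[LHS]mulr_natl natz.
Qed.

(** * Integer matrices with finite support *)

Definition msum (A : mat) (P : pred (int * int)) : nat := (\sum_(p <- finsupp A | P p) A p)%N.
Definition nsum (t : nvec) (P : pred int) : nat := (\sum_(i <- finsupp t | P i) t i)%N.

Lemma matP (A B : mat) : (forall i j : int, A (i, j) = B (i, j) :> nat) -> A = B.
Proof. by move=> E; apply/fsfunP => -[i j]. Qed.

Lemma sum_finsupp_sub (K : choiceType) (A : {fsfun K -> nat with 0%N}) (s : seq K) (P : pred K) :
  uniq s -> {subset finsupp A <= s} ->
  (\sum_(p <- finsupp A | P p) A p = \sum_(p <- s | P p) A p)%N.
Proof.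
move=> us sub; rewrite [RHS](bigID (mem (finsupp A))) /= [X in (_ + X)%N]big1 ?addn0; last first.
  by move=> p /andP[_ /fsfun_dflt].
rewrite [RHS](eq_bigl (fun p => (p \in finsupp A) && P p)); last by move=> p; rewrite andbC.
rewrite -[RHS]big_filter_cond; apply: perm_big; apply: uniq_perm; rewrite ?filter_uniq ?fset_uniq //.
by move=> p; rewrite mem_filter; case: (boolP (p \in finsupp A)) => //= pA; rewrite (sub _ pA).
Qed.

Lemma msum_sub (A : mat) (s : seq (int * int)) (P : pred (int * int)) :
  uniq s -> {subset finsupp A <= s} -> msum A P = (\sum_(p <- s | P p) A p)%N.
Proof. exact: sum_finsupp_sub. Qed.

Lemma eq_msum (A : mat) (P Q : pred (int * int)) :
  (forall p, A p != 0%N -> P p = Q p) -> msum A P = msum A Q.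
Proof.
move=> E; rewrite /msum big_seq_cond [RHS]big_seq_cond; apply: eq_bigl => p.
by case: (boolP (p \in _)) => //; rewrite mem_finsupp => /E.
Qed.

Lemma msum_cond (A : mat) (P : pred (int * int)) : msum A P = (\sum_(p <- finsupp A) P p * A p)%N.
Proof. by rewrite /msum big_mkcond; apply: eq_bigr => p _; case: (P p); rewrite ?mul1n. Qed.

Lemma msumID (A : mat) (Q P : pred (int * int)) :
  msum A P = (msum A (fun p => P p && Q p) + msum A (fun p => P p && ~~ Q p))%N.
Proof. exact: bigID. Qed.

Lemma leq_msum1 (A : mat) (P : pred (int * int)) p : P p -> (A p <= msum A P)%N.
Proof.
move=> Pp; case: (boolP (p \in finsupp A)) => [pA|/fsfun_dflt -> //].
by rewrite msum_cond (bigD1_seq p) ?fset_uniq //= Pp mul1n leq_addr.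
Qed.

Lemma msum_eq0 (A : mat) (P : pred (int * int)) :
  (forall p, P p -> A p = 0%N) -> msum A P = 0%N.
Proof. by move=> E; rewrite /msum big1 // => p /E. Qed.

Lemma msum_neq0 (A : mat) (P : pred (int * int)) :
  msum A P != 0%N -> exists p, P p /\ A p != 0%N.
Proof.
move=> h; have [//|no] := pselect (exists p, P p /\ A p != 0%N).
case/negP: h; apply/eqP; apply: msum_eq0 => p Pp.
by apply/eqP/negPn/negP => h; apply: no; exists p.
Qed.

Lemma msum_xpred1 (A : mat) p : msum A (fun x => x == p) = A p.
Proof.
rewrite msum_cond; case: (boolP (p \in finsupp A)) => pA.
  by rewrite (bigD1_seq p) ?fset_uniq //= eqxx mul1n big1 ?addn0 // => x /negPf ->.
rewrite big_seq big1 ?(fsfun_dflt pA) // => x xA.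
by case: eqP => // xp; rewrite xp (negPf pA) in xA.
Qed.

Lemma maddE (A B : mat) p : madd A B p = (A p + B p)%N.
Proof.
rewrite fsfunE in_fsetU; case: ifP => // /norP[/fsfun_dflt -> /fsfun_dflt ->] //.
Qed.

Lemma msumD (A B : mat) P : msum (madd A B) P = (msum A P + msum B P)%N.
Proof.
pose s := enum_fset (finsupp A `|` finsupp B)%fset.
rewrite !(@msum_sub _ s) ?fset_uniq //.
- by rewrite -big_split; apply: eq_bigr => p _; rewrite maddE.
- by move=> p pB; rewrite in_fsetU pB orbT.
- by move=> p pA; rewrite in_fsetU pA.
- move=> p; rewrite mem_finsupp maddE in_fsetU !mem_finsupp.
  by case: (A p) => //; case: (B p).
Qed.

Definition emx (a : nat) (i j : int) : mat := [fsfun p in [fset (i, j)]%fset => a | 0%N].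

Lemma emxE (a : nat) i j p : emx a i j p = (a * (p == (i, j)))%N.
Proof. by rewrite fsfunE inE; case: eqP; rewrite ?muln1 ?muln0. Qed.

Lemma msum_emx (a : nat) i j P : msum (emx a i j) P = (a * P (i, j))%N.
Proof.
rewrite (@msum_sub _ [:: (i, j)]) //; last first.
  by move=> p; rewrite mem_finsupp emxE mem_seq1; case: (p == _); rewrite ?muln0.
by rewrite big_cons big_nil; case: (P _); rewrite ?muln1 ?muln0 ?addn0 // emxE eqxx muln1.
Qed.

Definition rowm (h : int) (t : nvec) : mat :=
  [fsfun p in [fset (h, u) | u in finsupp t]%fset => t p.2 | 0%N].

Lemma rowmE h t p : rowm h t p = (t p.2 * (p.1 == h))%N.
Proof.
case: p => i j; rewrite fsfunE /=; case: imfsetP => [[u ut [-> ->]]|no].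
  by rewrite eqxx muln1.
case: eqP => [E|]; rewrite ?muln0 // muln1.
by case: (boolP (j \in finsupp t)) => [jt|/fsfun_dflt //]; case: no; exists j; rewrite ?E.
Qed.

Lemma msum_rowm h t P : msum (rowm h t) P = nsum t (fun u => P (h, u)).
Proof.
rewrite (@msum_sub _ [fset (h, u) | u in finsupp t]%fset) ?fset_uniq //.
  rewrite big_mkcond big_imfset /= -?big_mkcond; last by move=> x y _ _ [].
  by apply: eq_bigr => u _; rewrite rowmE eqxx muln1.
move=> [i j]; rewrite mem_finsupp rowmE /=; case: (i =P h) => [->|]; rewrite ?muln0 // muln1 => tj.
by apply/imfsetP; exists j; rewrite //= mem_finsupp.
Qed.

Lemma diagmE l p : diagm l p = (l p.1 * (p.1 == p.2))%N.
Proof.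
case: p => i j; rewrite fsfunE /=; case: imfsetP => [[u ut [-> ->]]|no].
  by rewrite eqxx muln1.
case: eqP => [E|]; rewrite ?muln0 // muln1.
by case: (boolP (i \in finsupp l)) => [il|/fsfun_dflt //]; case: no; exists i; rewrite -?E.
Qed.

Lemma msum_diagm l P : msum (diagm l) P = nsum l (fun u => P (u, u)).
Proof.
rewrite (@msum_sub _ [fset (u, u) | u in finsupp l]%fset) ?fset_uniq //.
  rewrite big_mkcond big_imfset /= -?big_mkcond; last by move=> x y _ _ [].
  by apply: eq_bigr => u _; rewrite diagmE eqxx muln1.
move=> [i j]; rewrite mem_finsupp diagmE /=; case: (i =P j) => [->|]; rewrite ?muln0 // muln1 => tj.
by apply/imfsetP; exists j; rewrite //= mem_finsupp.
Qed.

Lemma sigE A : sig A = msum A xpredT. Proof. by []. Qed.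
Lemma roE A i : ro A i = msum A (fun p => p.1 == i). Proof. by []. Qed.
Lemma coE A i : co A i = msum A (fun p => p.2 == i). Proof. by []. Qed.

(** The dimension of f_i :&: g_j when A is the position of (f, g); see [orbit_matP]. *)
Definition cumul (A : mat) (i j : int) : nat := msum A (fun p => (p.1 <= i) && (p.2 <= j)).
Definition rowcum (A : mat) (i j : int) : nat := msum A (fun p => (p.1 == i) && (p.2 <= j)).

Lemma cumulS A i j : cumul A i j = (cumul A (i - 1) j + rowcum A i j)%N.
Proof.
rewrite /cumul (msumID _ (fun p => p.1 <= i - 1)); congr (_ + _)%N; apply: eq_msum => -[a b] _ /=; lia.
Qed.

Lemma rowcumS A i j : rowcum A i j = (rowcum A i (j - 1) + A (i, j))%N.
Proof.
rewrite /rowcum (msumID _ (fun p => p.2 <= j - 1)) -msum_xpred1.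
by congr (_ + _)%N; apply: eq_msum => -[a b] _ /=; rewrite ?xpair_eqE; lia.
Qed.

Lemma finsupp_bound (A : mat) : exists N : nat, forall p, A p != 0%N ->
  (`|p.1| <= N)%N /\ (`|p.2| <= N)%N.
Proof.
exists (\max_(p <- finsupp A) maxn `|p.1| `|p.2|)%N => p; rewrite -mem_finsupp => pA.
have := @leq_bigmax_seq _ _ xpredT (fun p : int * int => maxn `|p.1| `|p.2|)%N p pA isT.
by rewrite /= geq_max => /andP[].
Qed.

Lemma int_ind_from (P : int -> Prop) (N : int) :
  (forall i : int, i <= N -> P i) -> (forall i : int, P (i - 1) -> P i) -> forall i : int, P i.
Proof.
move=> P0 PS i; have [/P0 //|Ni] := leP i N.
have -> : i = N + `|i - N|%N by lia.
elim: `|i - N|%N => [|k IH]; first by apply: P0; lia.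
by apply: PS; have -> : N + k.+1 - 1 = N + k by lia.
Qed.

Lemma cumul_inj (A B : mat) : (forall i j : int, cumul A i j = cumul B i j) -> A = B.
Proof.
move=> E; apply: matP => i j.
have Er k : rowcum A i k = rowcum B i k by have := cumulS A i k; have := cumulS B i k; rewrite !E; lia.
have := rowcumS A i j; have := rowcumS B i j; rewrite !Er; lia.
Qed.

Definition pullm (f : int * int -> int * int) (A : mat) : mat :=
  [fsfun p in [fset f p | p in finsupp A]%fset => A (f p) | 0%N].

Lemma pullmE f A p : involutive f -> pullm f A p = A (f p).
Proof.
move=> fK; rewrite fsfunE; case: imfsetP => // no.
by case: (boolP (f p \in finsupp A)) => [fp|/fsfun_dflt //]; case: no; exists (f p); rewrite ?fK.
Qed.

Lemma msum_pullm f A P : involutive f -> msum (pullm f A) P = msum A (fun p => P (f p)).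
Proof.
move=> fK; rewrite (@msum_sub _ [fset f p | p in finsupp A]%fset) ?fset_uniq //.
  rewrite big_mkcond big_imfset /= -?big_mkcond; last by move=> x y _ _; apply: inv_inj.
  by apply: eq_bigr => u _; rewrite pullmE // fK.
move=> p; rewrite mem_finsupp pullmE // => h.
by apply/imfsetP; exists (f p); rewrite ?fK //= mem_finsupp.
Qed.

Definition trm : mat -> mat := pullm (fun p => (p.2, p.1)).
Lemma trmE A (i j : int) : trm A (i, j) = A (j, i).
Proof. by rewrite pullmE // => -[]. Qed.
Lemma msum_trm A P : msum (trm A) P = msum A (fun p => P (p.2, p.1)).
Proof. by rewrite msum_pullm // => -[]. Qed.
Lemma cumul_trm A i j : cumul (trm A) i j = cumul A j i.
Proof. by rewrite /cumul msum_trm; apply: eq_msum => p _ /=; rewrite andbC. Qed.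

(** * Relative position of two flags *)

Section Flags.
Variables (F : finFieldType) (n : nat).
Implicit Types (f g : flagT F n) (A : mat).

Lemma flag_mono f (i j : int) : is_flag f -> i <= j -> (f i <= f j)%VS.
Proof.
case=> fS _ ij; have -> : j = i + `|j - i|%N by lia.
elim: `|j - i|%N => [|k IH]; first by rewrite addr0.
by apply: subv_trans IH _; have -> : i + k.+1%:Z = i + k%:Z + 1 by lia.
Qed.

Lemma flag_top f : is_flag f -> exists M : nat, forall i : int, M%:Z <= i -> f i = fullv.
Proof.
move=> ff; have [_ [_ ft]] := ff.
have [M HM] : exists M : nat, forall x, x \in (vbasis (fullv : {vspace 'rV[F]_n}) : seq _) -> x \in f M.
  elim: (vbasis _ : seq _) => [|x s [M IH]]; first by exists 0%N.
  have [i xi] := ft x; exists (M + `|i|)%N => y.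
  rewrite inE => /predU1P[->|/IH yM]; [move: xi | move: yM]; apply: (subvP (flag_mono ff _)); lia.
exists M => i Mi; apply/eqP; rewrite eqEsubv subvf /=.
apply: subv_trans (flag_mono ff Mi).
by rewrite -{1}(span_basis (vbasisP fullv)); apply/span_subvP.
Qed.

Definition capdim f g (i j : int) : nat := \dim (f i :&: g j).

Lemma posdiff f g (i j : int) : is_flag f -> is_flag g ->
  (\dim (f (i - 1)%R + (f i :&: g j)) + capdim f g (i - 1)%R j =
   \dim (f (i - 1)%R) + capdim f g i j)%N.
Proof.
move=> ff gg; rewrite /capdim.
have fi : (f (i - 1) <= f i)%VS by apply: flag_mono => //; lia.
have := dimv_sum_cap (f (i - 1)) (f i :&: g j).
by rewrite capvA (capv_idPl fi) => ->.
Qed.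

(* dim(f_{i-1} + f_i cap g_j) is nondecreasing in j, so the truncated subtraction is exact. *)
Lemma orbit_matE f g A (i j : int) : is_flag f -> is_flag g -> orbit_mat f g A ->
  (A (i, j) + capdim f g i (j - 1)%R + capdim f g (i - 1)%R j =
   capdim f g i j + capdim f g (i - 1)%R (j - 1)%R)%N.
Proof.
move=> ff gg /(_ i j) ->.
have e1 := posdiff i j ff gg; have e2 := posdiff i (j - 1) ff gg.
have : (\dim (f (i - 1)%R + (f i :&: g (j - 1)%R)) <= \dim (f (i - 1)%R + (f i :&: g j)))%N.
  by rewrite dimvS // addvS // capvS // flag_mono //; lia.
by move: e1 e2; vlia.
Qed.

(** The entries are mixed second differences of the dimensions of f_i :&: g_j, and these vanish for
    small i or j, so summation recovers them. Later arguments use this symmetric form, in which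
    exchanging the flags is transposing the matrix. *)
Lemma orbit_matP f g A : is_flag f -> is_flag g ->
  orbit_mat f g A <-> forall i j : int, capdim f g i j = cumul A i j.
Proof.
move=> ff gg; split=> [o|E i j]; last first.
  have e1 := posdiff i j ff gg; have e2 := posdiff i (j - 1) ff gg.
  have := cumulS A i j; have := cumulS A i (j - 1); have := rowcumS A i j.
  by move: e1 e2; rewrite !E; vlia.
have [N HN] := finsupp_bound A.
have [_ [[N1 f0] _]] := ff; have [_ [[N2 g0] _]] := gg.
have A0 (i j : int) : i < - N%:Z \/ j < - N%:Z -> A (i, j) = 0%N.
  by move=> h; apply/eqP/negPn/negP => /HN /=; lia.
apply: (@int_ind_from _ (Num.min N1 (- N%:Z - 1))) => [i iN j|i IHi].
  rewrite /capdim f0 ?cap0v ?dimv0; last by lia.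
  by rewrite /cumul msum_eq0 // => -[a b] /= ?; apply: A0; lia.
apply: (@int_ind_from _ (Num.min N2 (- N%:Z - 1))) => [j jN|j IHj].
  rewrite /capdim g0 ?capv0 ?dimv0; last by lia.
  by rewrite /cumul msum_eq0 // => -[a b] /= ?; apply: A0; lia.
have := orbit_matE i j ff gg o.
have := cumulS A i j; have := cumulS A i (j - 1); have := rowcumS A i j.
by rewrite IHj !IHi; lia.
Qed.

Lemma orbit_trm f g A : is_flag f -> is_flag g ->
  orbit_mat f g A <-> orbit_mat g f (trm A).
Proof.
move=> ff gg; rewrite !orbit_matP //; split=> E i j.
  by rewrite cumul_trm -E /capdim capvC.
by rewrite -cumul_trm -E /capdim capvC.
Qed.

Lemma orbit_inj f g A B : is_flag f -> is_flag g ->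
  orbit_mat f g A -> orbit_mat f g B -> A = B.
Proof.
by move=> ff gg; rewrite !orbit_matP // => E E'; apply: cumul_inj => i j; rewrite -E E'.
Qed.

Lemma orbit_dim f g A : is_flag f -> is_flag g -> orbit_mat f g A ->
  forall i : int, \dim (f i) = msum A (fun p => p.1 <= i).
Proof.
move=> ff gg; rewrite orbit_matP // => E i.
have [N HN] := finsupp_bound A; have [M gM] := flag_top gg.
have := E i (M + N)%N; rewrite /capdim gM ?capvf; last by lia.
by move=> ->; apply: eq_msum => p /HN /=; lia.
Qed.

Lemma orbit_codim f g A : is_flag f -> is_flag g -> orbit_mat f g A ->
  forall i : int, \dim (g i) = msum A (fun p => p.2 <= i).
Proof.
move=> ff gg /(orbit_trm A ff gg) o i.
by rewrite (orbit_dim gg ff o) msum_trm; apply: eq_msum.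
Qed.

End Flags.

(** * Elementary steps between flags *)

Definition emat (b : bool) (a : nat) (h : int) : mat :=
  if b then emx a h (h + 1) else emx a (h + 1) h.
Definition smat (b : bool) (a : nat) (h : int) (l : nvec) : mat := madd (emat b a h) (diagm l).

(* [smat b a h l] moves [a] units from row [losing b h] to row [gaining b h]. *)
Definition gaining (b : bool) (h : int) : int := if b then h else h + 1.
Definition losing (b : bool) (h : int) : int := if b then h + 1 else h.

Lemma msum_smat b a h l P :
  msum (smat b a h l) P = (a * P (gaining b h, losing b h) + nsum l (fun u => P (u, u)))%N.
Proof. by rewrite msumD msum_diagm /emat; case: b; rewrite msum_emx. Qed.

Lemma smatE b a h l p :
  smat b a h l p = (a * (p == (gaining b h, losing b h)) + l p.1 * (p.1 == p.2))%N.
Proof. by rewrite maddE diagmE /emat; case: b; rewrite emxE. Qed.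

Lemma trm_smat b a h l : trm (smat b a h l) = smat (~~ b) a h l.
Proof.
apply: matP => i j; rewrite trmE !smatE /=; congr (_ + _)%N.
  by congr (_ * _)%N; case: b => /=; rewrite !xpair_eqE andbC.
by rewrite eq_sym; case: eqP => [->|]; rewrite ?muln0.
Qed.

Definition lestep (F : finFieldType) n (a : nat) (h : int) (f f1 : flagT F n) : Prop :=
  (forall i : int, i != h -> f i = f1 i) /\ (f h <= f1 h)%VS /\ (\dim (f h) + a = \dim (f1 h))%N.

Definition flagstep (F : finFieldType) n (b : bool) (a : nat) (h : int) (f1 f : flagT F n) : Prop :=
  if b then lestep a h f f1 else lestep a h f1 f.

Section Steps.
Variables (F : finFieldType) (n : nat).
Implicit Types (f g : flagT F n) (U : {vspace 'rV[F]_n}).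

(** The inclusion at i comes from comparing dim (f1 i :&: f i) with dim (f i). Conversely, after
    such a step f1 i and f j are always nested, so the dimensions of the components determine all
    intersections. *)
Lemma orbit_smat_true f1 f a h l : is_flag f1 -> is_flag f ->
  orbit_mat f1 f (smat true a h l) <->
  (forall i : int, \dim (f1 i) = msum (smat true a h l) (fun p => p.1 <= i)) /\ lestep a h f f1.
Proof.
move=> ff1 ff; split=> [o|[d [eqf [fh dh]]]].
  have d1 := orbit_dim ff1 ff o; have d2 := orbit_codim ff1 ff o; split=> //.
  move: o; rewrite orbit_matP // => o.
  have sub i : (f i <= f1 i)%VS.
    apply/capv_idPr/eqP; rewrite eqEdim capvSr /=.
    have := o i i; rewrite /capdim => ->; rewrite d2 /cumul !msum_smat /=.
    by rewrite leq_add ?leq_mul2l //= /nsum; [lia | apply: eq_leq; apply: eq_bigl => u; lia].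
  split; last by split=> //; rewrite d1 d2 !msum_smat /=; lia.
  move=> i ih; apply/eqP; rewrite eqEdim sub d1 d2 !msum_smat /= leq_add2r leq_mul2l; lia.
rewrite orbit_matP // => i j; rewrite /cumul msum_smat /= /capdim.
have [jh|jh] := eqVneq j h; last first.
  rewrite (eqf _ jh); have [ij|ij] := leP i j.
    rewrite (capv_idPl (flag_mono ff1 ij)) d msum_smat /=; congr (_ * _ + _)%N; first by lia.
    by apply: eq_bigl => u; lia.
  rewrite (capv_idPr (flag_mono ff1 (ltW ij))) d msum_smat /=; congr (_ * _ + _)%N; first by lia.
  by apply: eq_bigl => u; lia.
subst j; have [hi|hi] := leP h i.
  rewrite (capv_idPr (subv_trans fh (flag_mono ff1 hi))).
  have := d h; rewrite msum_smat -dh /= => e.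
  have -> : nsum l (fun u => (u <= i) && (u <= h)) = nsum l (fun u => u <= h).
    by apply: eq_bigl => u; lia.
  lia.
have ih : i != h by lia.
rewrite -(eqf _ ih) (capv_idPl (flag_mono ff (ltW hi))) (eqf _ ih) d msum_smat /=.
by congr (_ * _ + _)%N; [lia | apply: eq_bigl => u; lia].
Qed.

Lemma orbit_smat f1 f b a h l : is_flag f1 -> is_flag f ->
  orbit_mat f1 f (smat b a h l) <->
  (forall i : int, \dim (f1 i) = msum (smat b a h l) (fun p => p.1 <= i)) /\ flagstep b a h f1 f.
Proof.
move=> ff1 ff; case: b; first exact: orbit_smat_true.
rewrite orbit_trm // trm_smat /= orbit_smat_true //.
(* Transposition leaves a condition on the dimensions of f; the step turns it into one on those of
   f1. *)
suff E : lestep a h f1 f -> ((forall i : int, \dim (f i) = msum (smat true a h l) (fun p => p.1 <= i)) <->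
    (forall i : int, \dim (f1 i) = msum (smat false a h l) (fun p => p.1 <= i))).
  by split=> -[d s]; split => //; apply/(E s).
case=> eqf [_ dh]; split=> d i; have := d i; rewrite !msum_smat /=.
  by case: (eqVneq i h) => [->|ih]; [lia | rewrite eqf //; lia].
by case: (eqVneq i h) => [->|ih]; [lia | rewrite eqf //; lia].
Qed.

Definition upd f (h : int) U : flagT F n := fun i => if i == h then U else f i.

Lemma is_flag_upd f (h : int) U : is_flag f ->
  (f (h - 1)%R <= U)%VS -> (U <= f (h + 1)%R)%VS ->
  is_flag (upd f h U).
Proof.
move=> ff lo hi; have [fS [[M f0] ft]] := ff; split=> [i|].
  rewrite /upd; case: eqVneq => [->|ih]; case: eqVneq => [e|ih'] //.
  by have -> : i = h - 1 by lia.
split.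
  exists (Num.min M (h - 1)) => i iM; rewrite /upd; case: eqVneq => [ih|_]; first by lia.
  by apply: f0; lia.
move=> x; have [i xi] := ft x; exists (Num.max i (h + 1)).
rewrite /upd; case: eqVneq => [?|_]; first by lia.
by apply: (subvP (flag_mono ff _) _ xi); lia.
Qed.
End Steps.

(** * Flags and matrices in a window *)

Definition ints (N : nat) : seq int := [seq k%:Z - N%:Z | k <- iota 0 (N.*2.+1)].

Lemma mem_ints N (i : int) : (i \in ints N) = (`|i| <= N)%N.
Proof.
apply/mapP/idP => [[k + ->]|iN]; first by rewrite mem_iota; lia.
by exists (absz (i + N%:Z)); rewrite ?mem_iota; lia.
Qed.

Lemma ints_uniq N : uniq (ints N).
Proof. by rewrite map_inj_uniq ?iota_uniq // => x y; lia. Qed.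

Definition box (N : nat) : seq (int * int) := [seq (i, j) | i <- ints N, j <- ints N].

Lemma mem_box N (p : int * int) : (p \in box N) = (`|p.1| <= N)%N && (`|p.2| <= N)%N.
Proof.
case: p => i j /=; rewrite -!mem_ints; apply/allpairsP/andP => [[[a b] /= [ia ib [-> ->]]]|[ii jj]] //.
by exists (i, j).
Qed.

Definition inN (N : nat) (A : mat) : bool := all (mem (box N)) (finsupp A).

Lemma inNP N (A : mat) : reflect (forall p, A p != 0%N -> (`|p.1| <= N)%N /\ (`|p.2| <= N)%N) (inN N A).
Proof.
apply: (iffP allP) => E p; first by rewrite -mem_finsupp => /E /=; rewrite mem_box => /andP.
by rewrite mem_finsupp /= mem_box => /E[-> ->].
Qed.

Lemma inN_exists (A : mat) : exists N, inN N A.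
Proof. by have [N HN] := finsupp_bound A; exists N; apply/inNP. Qed.

Lemma inN_leq M N (A : mat) : (M <= N)%N -> inN M A -> inN N A.
Proof. by move=> MN /inNP E; apply/inNP => p /E; lia. Qed.

Definition mat_of_ffun N r (g : {ffun 'I_(N.*2.+1) * 'I_(N.*2.+1) -> 'I_r.+1}) : mat :=
  [fsfun p in seq_fset tt (box N) =>
     nat_of_ord (g (inord (absz (p.1 + N%:Z)), inord (absz (p.2 + N%:Z)))) | 0%N].

(** No entry exceeds the entry sum r, so functions from the box to 'I_r.+1 reach every matrix of the
    window. *)
Definition Om (N r : nat) : seq mat :=
  [seq A <- undup [seq mat_of_ffun g | g <- enum {: {ffun 'I_(N.*2.+1) * 'I_(N.*2.+1) -> 'I_r.+1}}]
   | sig A == r].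

Lemma Om_uniq N r : uniq (Om N r).
Proof. by rewrite filter_uniq // undup_uniq. Qed.

Lemma mem_Om N r (A : mat) : (A \in Om N r) = inN N A && (sig A == r).
Proof.
rewrite mem_filter mem_undup andbC; case: eqP => sA; rewrite ?andbF ?andbT //.
apply/mapP/inNP => [[g _ -> p]|HA].
  rewrite fsfunE seq_fsetE mem_box /=; case: ifP => // /andP[] //.
exists [ffun k : 'I_(N.*2.+1) * 'I_(N.*2.+1) =>
    inord (A ((k.1 : nat)%:Z - N%:Z, (k.2 : nat)%:Z - N%:Z))]; first by rewrite mem_enum.
apply: matP => i j; rewrite fsfunE seq_fsetE mem_box /= ffunE /=; case: ifP => [/andP[/= iN jN]|no].
  rewrite !inordK; try lia.
    by congr (A (_, _)); lia.
  rewrite ltnS -sA sigE; exact: (@leq_msum1 A xpredT).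
by apply/eqP/negPn/negP => /HA /= [iN jN]; rewrite iN jN in no.
Qed.

Section Window.
Variables (F : finFieldType) (n N : nat).
Implicit Types (f g : flagT F n) (U : {vspace 'rV[F]_n}).

Definition wflag := {ffun 'I_(N.*2.+1) -> {vspace 'rV[F]_n}}.
Implicit Types (t : wflag).

Definition wext t : flagT F n := fun i =>
  if i < - N%:Z then 0%VS else if N%:Z <= i then fullv else t (inord (absz (i + N%:Z))).
Definition wres f : wflag := [ffun k : 'I_(N.*2.+1) => f (k%:Z - N%:Z)].

Definition windowed f : Prop :=
  (forall i : int, i < - N%:Z -> f i = 0%VS) /\ (forall i : int, N%:Z <= i -> f i = fullv).

Lemma wext_windowed t : windowed (wext t).
Proof. by split=> i h; rewrite /wext; [rewrite h | rewrite h; case: ltP => //; lia]. Qed.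

Lemma wresK f : windowed f -> wext (wres f) = f.
Proof.
case=> f0 f1; apply: funext => i; rewrite /wext; case: ltP => [/f0 //|i1]; case: leP => [/f1 //|i2].
by rewrite ffunE inordK; [congr f; lia | lia].
Qed.

(* The component of index N of a wflag is ignored by wext; wf normalizes it. *)
Definition wf t : bool := `[< is_flag (wext t) >] && (wres (wext t) == t).

Lemma wf_flag t : wf t -> is_flag (wext t).
Proof. by case/andP => /asboolP. Qed.

Lemma wf_wres f : is_flag f -> windowed f -> wf (wres f).
Proof. by move=> ff fN; rewrite /wf wresK // eqxx andbT; apply/asboolP. Qed.

Definition pos t1 t2 : mat :=
  [fsfun p in seq_fset tt (box N) =>
     (\dim (wext t1 (p.1 - 1)%R + (wext t1 p.1 :&: wext t2 p.2)) -
      \dim (wext t1 (p.1 - 1)%R + (wext t1 p.1 :&: wext t2 (p.2 - 1)%R)))%N | 0%N].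

(** Only the entries in the box are tabulated; outside it one of the flags is stationary at 0 or at
    the whole space, and the difference of dimensions is 0. *)
Lemma orbit_pos t1 t2 : orbit_mat (wext t1) (wext t2) (pos t1 t2).
Proof.
have [z1 o1] := wext_windowed t1; have [z2 o2] := wext_windowed t2.
move=> i j; rewrite fsfunE seq_fsetE mem_box /= /=; case: ifP => //.
move/negbT; rewrite negb_and -!ltnNge => /orP[iN|jN].
  have [i0|i0] := leP 0 i.
    by rewrite (o1 (i - 1)) ?(addv_idPl (subvf _)) ?subnn //; vlia.
  by rewrite (z1 (i - 1)) ?(z1 i) ?cap0v ?subnn //; vlia.
have [j0|j0] := leP 0 j.
  by rewrite (o2 (j - 1)) ?(o2 j) ?subnn //; vlia.
by rewrite (z2 (j - 1)) ?(z2 j) ?subnn //; vlia.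
Qed.

Lemma posP t1 t2 A : wf t1 -> wf t2 -> orbit_mat (wext t1) (wext t2) A <-> pos t1 t2 = A.
Proof.
move=> /wf_flag f1 /wf_flag f2; split=> [|<-]; last exact: orbit_pos.
exact: orbit_inj f1 f2 (orbit_pos _ _).
Qed.

Lemma pos_Om t1 t2 : wf t1 -> wf t2 -> pos t1 t2 \in Om N n.
Proof.
move=> /wf_flag f1 /wf_flag f2; rewrite mem_Om; apply/andP; split.
  apply/inNP => p; rewrite fsfunE seq_fsetE mem_box /=; case: ifP => // /andP[] //.
have := orbit_dim f1 f2 (orbit_pos t1 t2) N%:Z; rewrite (wext_windowed t1).2 // dimvf /dim /= mul1n => e.
rewrite [X in _ == X]e sigE; apply/eqP; apply: eq_msum => p.
rewrite fsfunE seq_fsetE mem_box /=; case: ifP => // /andP[]; lia.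
Qed.

Lemma orbit_windowed f g A : is_flag f -> is_flag g -> orbit_mat f g A -> A \in Om N n ->
  windowed f.
Proof.
move=> ff gg o; rewrite mem_Om => /andP[/inNP AN /eqP sA].
have d := orbit_dim ff gg o; split=> i iN; apply/eqP.
  rewrite -dimv_eq0 d msum_eq0 // => p pi.
  by apply/eqP/negPn/negP => /AN; vlia.
rewrite eqEdim subvf dimvf d /dim /= mul1n -[X in (X <= _)%N]sA.
by rewrite sigE; apply: eq_leq; apply: eq_msum => p /AN /=; lia.
Qed.

Lemma orbit_windowed2 f g A : is_flag f -> is_flag g -> orbit_mat f g A -> A \in Om N n ->
  windowed g.
Proof.
move=> ff gg /(orbit_trm A ff gg) o AO; apply: (orbit_windowed gg ff o).
move: AO; rewrite !mem_Om => /andP[/inNP AN /eqP sA]; apply/andP; split.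
  by apply/inNP => -[i j]; rewrite trmE => /AN /= [].
by apply/eqP; rewrite sigE msum_trm -sA.
Qed.

End Window.

(** * Convolution with an elementary matrix *)

Section StepCount.
Variables (F : finFieldType) (n N : nat).
Implicit Types (f g : flagT F n) (U : {vspace 'rV[F]_n}) (t : wflag F n N).

(* The component f_h of a flag f one elementary step away from f1 lies between
   the components of f1 of indices [gaining b h - 1] and [gaining b h]. *)
Definition step_meets b h f1 f2 (B : mat) : {set {vspace 'rV[F]_n}} :=
  subspaces_meeting (fun j : nat => (f1 (gaining b h) :&: f2 (j%:Z - N%:Z - 1)%R)%VS) (f1 (gaining b h - 1)%R)
    (fun j : nat => cumul B h (j%:Z - N%:Z - 1)) N.*2.+1.

(** Necessary for an intermediate flag to exist ([step_conditions]), and enough for every subspace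
    in [step_meets] to give one ([meets_step]). Only matrices occur in it, so the count splits into
    this test and a count of subspaces. *)
Definition step_cond b a h l (B C : mat) : Prop :=
  (forall i : int, msum C (fun p => p.1 <= i) = msum (smat b a h l) (fun p => p.1 <= i)) /\
  (forall i j : int, i != h -> cumul C i j = cumul B i j) /\
  (if b then msum B (fun p => (p.1 <= h)%R) + a = msum C (fun p => (p.1 <= h)%R)
   else msum C (fun p => (p.1 <= h)%R) + a = msum B (fun p => (p.1 <= h)%R))%N.

Lemma gaining_pred b (h : int) : gaining b h - 1 = if b then h - 1 else h.
Proof. by rewrite /gaining; case: b => //; lia. Qed.

Lemma gaining_bounds b (h : int) : (h <= gaining b h) && (gaining b h <= h + 1).
Proof. by rewrite /gaining; case: b; lia. Qed.

Lemma step_between b a (h : int) f1 f : is_flag f1 -> is_flag f -> flagstep b a h f1 f ->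
  (f1 (gaining b h - 1)%R <= f h)%VS /\ (f h <= f1 (gaining b h))%VS.
Proof.
rewrite gaining_pred /gaining => ff1 ff; case: b => -[e [s d]]; split=> //.
  by rewrite -e; [apply: flag_mono => //; lia | lia].
by rewrite e; [apply: flag_mono => //; lia | lia].
Qed.

Lemma step_conditions f1 f2 f b a (h : int) l (B C : mat) :
  is_flag f1 -> is_flag f2 -> is_flag f -> orbit_mat f1 f2 C ->
  orbit_mat f1 f (smat b a h l) -> orbit_mat f f2 B -> step_cond b a h l B C.
Proof.
move=> ff1 ff2 ff oC oS oB.
have dC := orbit_dim ff1 ff2 oC; have dB := orbit_dim ff ff2 oB.
move: oS; rewrite orbit_smat // => -[dS st]; split; last split.
- by move=> i; rewrite -dC dS.
- move=> i j ih; move: oC oB; rewrite !orbit_matP // => <- <-; rewrite /capdim.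
  by move: st; rewrite /flagstep; case: b {dS} => -[e _]; rewrite e.
by move: st; rewrite /flagstep -dC -dB; case: b {dS} => -[_ [_ e]].
Qed.

Lemma step_mem f1 f2 f b a (h : int) l (B C : mat) :
  is_flag f1 -> is_flag f2 -> is_flag f -> windowed N f2 -> orbit_mat f1 f2 C ->
  orbit_mat f1 f (smat b a h l) -> orbit_mat f f2 B ->
  f = upd f1 h (f h) /\ f h \in step_meets b h f1 f2 B.
Proof.
move=> ff1 ff2 ff [z2 w2] oC; rewrite orbit_smat // => -[dS st] oB; split.
  apply: funext => i; rewrite /upd; case: eqVneq => [->//|ih].
  by move: st; rewrite /flagstep; case: b {dS} => -[e _]; rewrite e.
have [lo hi] := step_between ff1 ff st.
rewrite inE; apply/and3P; split.
- by apply: subv_trans lo; rewrite capvSl.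
- rewrite subv_cap hi /= w2 ?subvf //; lia.
apply/forallP => j; rewrite capvA (capv_idPl hi).
by apply/eqP; move: oB; rewrite orbit_matP // => oB; exact: oB.
Qed.

Lemma meets_step f1 f2 b a (h : int) l (B C : mat) U :
  is_flag f1 -> is_flag f2 -> windowed N f2 -> inN N B -> orbit_mat f1 f2 C ->
  step_cond b a h l B C -> U \in step_meets b h f1 f2 B ->
  [/\ is_flag (upd f1 h U), orbit_mat (upd f1 h U) f2 B &
      orbit_mat f1 (upd f1 h U) (smat b a h l)].
Proof.
move=> ff1 ff2 [z2 w2] /inNP BN oC [cS [cB cd]].
(* The chain in [step_meets] starts at f2 of index -N - 1, which is 0, and ends at f2 of index N,
   which is everything. *)
have top : f2 ((N.*2.+1)%:Z - N%:Z - 1)%R = fullv by rewrite w2 //; lia.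
rewrite inE top capvf => /and3P[lo hi /forallP dU].
have fg : (f1 (gaining b h - 1)%R <= f1 (gaining b h))%VS by apply: flag_mono => //; lia.
rewrite (capv_idPl fg) in lo.
have ffu : is_flag (upd f1 h U).
  apply: is_flag_upd => //.
    by apply: subv_trans lo; apply: flag_mono => //; have := gaining_bounds b h; lia.
  by apply: (subv_trans hi); apply: flag_mono => //; have := gaining_bounds b h; lia.
have dC := orbit_dim ff1 ff2 oC.
have dUw (j : int) : - N%:Z - 1 <= j -> j <= N%:Z -> \dim (U :&: f2 j) = cumul B h j.
  move=> j1 j2; have jN : (absz (j + N%:Z + 1)%R < N.*2.+2)%N by lia.
  have /eqP := dU (Ordinal jN); rewrite /= capvA (capv_idPl hi).
  by have -> : (absz (j + N%:Z + 1))%:Z - N%:Z - 1 = j by lia.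
have dUj (j : int) : \dim (U :&: f2 j) = cumul B h j.
  have [j1|j1] := leP (- N%:Z - 1) j; last first.
    rewrite z2 ?capv0 ?dimv0; last by lia.
    rewrite /cumul msum_eq0 // => p /= pj; apply/eqP/negPn/negP => /BN; vlia.
  have [j2|j2] := leP j N%:Z; first exact: dUw.
  rewrite w2 ?capvf; last by lia.
  have <- : cumul B h N%:Z = cumul B h j by apply: eq_msum => p /BN /=; lia.
  by rewrite -dUw ?w2 ?capvf //; lia.
have oB : orbit_mat (upd f1 h U) f2 B.
  rewrite orbit_matP // => i j; rewrite /capdim /upd; case: eqVneq => [->|ih]; first exact: dUj.
  by move: oC; rewrite orbit_matP // => oC; rewrite -cB // -oC.
split=> //; rewrite orbit_smat //; split=> [i|]; first by rewrite dC cS.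
have dUB : \dim U = msum B (fun p => p.1 <= h).
  by have := orbit_dim ffu ff2 oB h; rewrite /upd eqxx.
move: lo hi cd; rewrite gaining_pred /gaining /flagstep; case: b {cS fg dU} => lo hi cd.
  split=> [i ih|]; first by rewrite /upd (negPf ih).
  by rewrite /upd eqxx dUB dC; split.
split=> [i ih|]; first by rewrite /upd (negPf ih).
by rewrite /upd eqxx dUB dC; split.
Qed.

Definition cnt (A B : mat) t1 t2 : nat := #|[set t : wflag F n N | [&& wf t, pos t1 t == A & pos t t2 == B]]|.

(** A flag one step away from t1 amounts to its h-th component; the bounds on h keep the modified
    flag in the window. *)
Lemma cnt_smat t1 t2 b a (h : int) l B :
  wf t1 -> wf t2 -> - N%:Z <= h -> h < N%:Z -> inN N B ->
  cnt (smat b a h l) B t1 t2 =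
  if pselect (step_cond b a h l B (pos t1 t2)) then #|step_meets b h (wext t1) (wext t2) B| else 0%N.
Proof.
move=> w1 w2 h1 h2 BN; have ff1 := wf_flag w1; have ff2 := wf_flag w2.
have oC := orbit_pos t1 t2.
case: pselect => c; last first.
  rewrite /cnt (_ : [set t | _] = finset.set0) ?cards0 //; apply/setP => t; rewrite !inE.
  apply/negP => /and3P[w /eqP oS /eqP oB]; apply: c.
  apply: (step_conditions ff1 ff2 (wf_flag w) oC); first by apply/posP.
  by apply/posP.
have updw U : windowed N (upd (wext t1) h U).
  have [z o] := wext_windowed t1.
  by split=> i iN; rewrite /upd; case: eqVneq => [ih|_]; [lia | exact: z | lia | exact: o].
rewrite /cnt (_ : [set t | _] = (fun U => wres N (upd (wext t1) h U)) @: step_meets b h (wext t1) (wext t2) B).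
  rewrite card_in_imset // => U W _ _ e.
  have := congr1 (fun t => wext t h) e; rewrite !wresK //.
  by rewrite /upd eqxx.
apply/setP => t; rewrite inE; apply/idP/imsetP => [/and3P[w /eqP oS /eqP oB]|[U US ->]].
  have [e m] := @step_mem _ _ _ b a h l B _ ff1 ff2 (wf_flag w) (wext_windowed t2) oC
     ((posP _ w1 w).2 oS) ((posP _ w w2).2 oB).
  exists (wext t h) => //; rewrite -e.
  by case/andP: w => _ /eqP.
have [fu oB oS] := meets_step ff1 ff2 (wext_windowed t2) BN oC c US.
have wu := wf_wres fu (updw U); rewrite wu /=.
apply/andP; split; apply/eqP/posP; rewrite ?wresK //.
Qed.
End StepCount.

(* The rows of the position matrix determine all the dimensions used by [card_meets_poly]. *)
Lemma cnt_smat_poly N b a (h : int) l B :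
  - N%:Z <= h -> h < N%:Z -> inN N B ->
  exists P : mat -> {poly int}, forall (F : finFieldType) n (t1 t2 : wflag F n N),
    wf t1 -> wf t2 -> (cnt (smat b a h l) B t1 t2)%:Z = (P (pos t1 t2)).[#|F|%:Z].
Proof.
move=> h1 h2 BN.
pose J (j : nat) : int := j%:Z - N%:Z - 1.
have hall (C : mat) : exists P : {poly int}, cumul C (gaining b h) (J 0%N) = 0%N ->
    forall (F : finFieldType) n (H : nat -> {vspace 'rV[F]_n}) (L : {vspace 'rV[F]_n}),
    (forall j, (j < N.*2.+1)%N -> (H j <= H j.+1)%VS) ->
    (forall j, j <= N.*2.+1 -> \dim (H j) = cumul C (gaining b h) (J j) /\
        \dim (L :&: H j) = cumul C (gaining b h - 1)%R (J j))%N ->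
    #|subspaces_meeting H L (fun j => cumul B h (J j)) N.*2.+1|%:Z = P.[#|F|%:Z].
  (* [choice] asks for a polynomial at every C; those with entries to the left of the window are not
     positions in it and get 0. *)
  have [c0|c0] := eqVneq (cumul C (gaining b h) (J 0%N)) 0%N; last by exists 0 => e; rewrite e in c0.
  have [P HP] := @card_meets_poly N.*2.+1 (fun j => cumul C (gaining b h) (J j))
    (fun j => cumul C (gaining b h - 1)%R (J j)) (fun j => cumul B h (J j)) c0.
  by exists P => _; exact: HP.
have [P HP] := choice hall.
exists (fun C => if pselect (step_cond b a h l B C) then P C else 0) => F n t1 t2 w1 w2.
have ff1 := wf_flag w1; have ff2 := wf_flag w2.
rewrite cnt_smat //; case: pselect => c; last by rewrite horner0.
have := orbit_pos t1 t2; rewrite orbit_matP // => o.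
apply: HP.
- by rewrite -o /capdim (wext_windowed t2).1 ?capv0 ?dimv0 // /J; lia.
- by move=> j _; rewrite capvS // flag_mono //; lia.
move=> j _; split; first by rewrite -o.
have fg : (wext t1 (gaining b h - 1)%R <= wext t1 (gaining b h))%VS by apply: flag_mono => //; lia.
by rewrite capvA (capv_idPl fg) -o.
Qed.

(** * Leading terms *)

Definition ent (A : mat) (i j : int) : nat := A (i, j).

Lemma entP (A B : mat) : (forall i j : int, ent A i j = ent B i j) -> A = B.
Proof. exact: matP. Qed.

Lemma rowcum_ent A i j : rowcum A i j = (rowcum A i (j - 1)%R + ent A i j)%N.
Proof. exact: rowcumS. Qed.

Lemma ent_madd A B i j : ent (madd A B) i j = (ent A i j + ent B i j)%N.
Proof. exact: maddE. Qed.

Lemma ent_rowm h t i j : ent (rowm h t) i j = if i == h then t j else 0%N.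
Proof. by rewrite /ent rowmE /=; case: eqP; rewrite ?muln1 ?muln0. Qed.

Lemma ent_emx a h k i j : ent (emx a h k) i j = if (i == h) && (j == k) then a else 0%N.
Proof. by rewrite /ent emxE xpair_eqE; case: (_ && _); rewrite ?muln1 ?muln0. Qed.

Lemma ent_diagm l i j : ent (diagm l) i j = if i == j then l i else 0%N.
Proof. by rewrite /ent diagmE /=; case: eqP; rewrite ?muln1 ?muln0. Qed.

Lemma msum_eq0_ent (A : mat) (P : pred (int * int)) :
  (forall i j : int, P (i, j) -> ent A i j = 0%N) -> msum A P = 0%N.
Proof. by move=> E; apply: msum_eq0 => -[i j]; exact: E. Qed.

(** Stated as an equality of sums because entries are natural numbers; t u units change rows in
    column u. *)
Definition moves (b : bool) (h : int) (t : nvec) (B C : mat) : Prop :=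
  madd C (rowm (losing b h) t) = madd B (rowm (gaining b h) t).

(* [lead b h J a B C]: C arises from B by moving a units in column J, the extremal
   (rightmost if b, leftmost otherwise) column from which row [losing b h] can lose. *)
Definition lead (b : bool) (h J : int) (a : nat) (B C : mat) : Prop :=
  [/\ madd C (emx a (losing b h) J) = madd B (emx a (gaining b h) J),
      (if b then h + 1 <= J else J <= h),
      (forall u : int, (if b then J < u else u < J) -> ent B (losing b h) u = 0%N) &
      (forall u : int, (if b then J <= u else u <= J) -> ent B (gaining b h) u = 0%N)].

(** The weak half of prec, which products preserve; strictness returns through row and column sums
    in [prec_leq_sig]. *)
Definition leq_sig (B A : mat) : Prop :=
  forall i j : int, i != j -> (sigij B i j <= sigij A i j)%N.

Lemma sigijE A i j : sigij A i j =
  if i < j then msum A (fun p => (p.1 <= i) && (j <= p.2)) else msum A (fun p => (i <= p.1) && (p.2 <= j)).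
Proof. by []. Qed.

Lemma nsum_cond t (c : bool) Q : nsum t (fun u => c && Q u) = (c * nsum t Q)%N.
Proof. by case: c; rewrite ?mul1n ?mul0n // /nsum big_pred0. Qed.

Lemma leq_nsum t (P : pred int) : (nsum t P <= nsum t xpredT)%N.
Proof. by rewrite /nsum [leqRHS](bigID P) /= leq_addr. Qed.

Lemma msum_moves b h t B C P : moves b h t B C ->
  (msum C P + nsum t (fun u => P (losing b h, u)) = msum B P + nsum t (fun u => P (gaining b h, u)))%N.
Proof. by move=> e; have := congr1 (fun A => msum A P) e; rewrite !msumD !msum_rowm. Qed.

Lemma msum_lead b h J a B C P : lead b h J a B C ->
  (msum C P + a * P (losing b h, J) = msum B P + a * P (gaining b h, J))%N.
Proof. by case=> e _ _ _; have := congr1 (fun A => msum A P) e; rewrite !msumD !msum_emx. Qed.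

Lemma nsum_const t (c : bool) : nsum t (fun _ => c) = (c * nsum t xpredT)%N.
Proof. by rewrite -nsum_cond; apply: eq_bigl => u; rewrite andbT. Qed.

Lemma gaining_losing b (h : int) :
  (gaining b h = h /\ losing b h = h + 1) \/ (gaining b h = h + 1 /\ losing b h = h).
Proof. by case: b; [left | right]. Qed.

(** Away from index h the intersections with f2 are unchanged, so only rows h and h + 1 differ, and
    each column of these two rows keeps its total. The gaining row can only grow: the h-th
    components of f1 and f are nested, and the graded pieces that f2 induces on a subspace embed
    into those of a larger one. The vector t is this growth. *)
Lemma orbit_moves (F : finFieldType) n (f1 f2 f : flagT F n) b a (h : int) l (B C : mat) :
  is_flag f1 -> is_flag f2 -> is_flag f -> orbit_mat f1 f2 C ->
  orbit_mat f1 f (smat b a h l) -> orbit_mat f f2 B ->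
  exists t, moves b h t B C /\ nsum t xpredT = a.
Proof.
move=> ff1 ff2 ff oC oS oB; have [cS [cB cd]] := step_conditions ff1 ff2 ff oC oS oB.
have rowsE (i u : int) : i != h -> i != h + 1 -> ent C i u = ent B i u.
  move=> i1 i2; have i3 : i - 1 != h by lia.
  have r v : rowcum C i v = rowcum B i v.
    by have := cumulS C i v; have := cumulS B i v; rewrite !cB //; lia.
  by have := rowcum_ent C i u; have := rowcum_ent B i u; rewrite !r; lia.
have r2 (v : int) : (rowcum C h v + rowcum C (h + 1) v = rowcum B h v + rowcum B (h + 1) v)%N.
  have i1 : h - 1 != h by lia. have i2 : h + 1 != h by lia.
  have := cumulS C h v; have := cumulS B h v; have := cumulS C (h + 1) v; have := cumulS B (h + 1) v.
  have -> : h + 1 - 1 = h by lia.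
  by rewrite (cB _ v i1) (cB _ v i2); lia.
have sumE (u : int) : (ent C h u + ent C (h + 1)%R u = ent B h u + ent B (h + 1)%R u)%N.
  have := r2 u; have := r2 (u - 1); have := rowcum_ent C h u; have := rowcum_ent C (h + 1) u.
  by have := rowcum_ent B h u; have := rowcum_ent B (h + 1) u; lia.
have gain (u : int) : (ent B (gaining b h) u <= ent C (gaining b h) u)%N.
  have inc (U W : {vspace 'rV[F]_n}) : (U <= W)%VS ->
      (\dim (U :&: f2 u) + \dim (W :&: f2 (u - 1)%R) <= \dim (W :&: f2 u) + \dim (U :&: f2 (u - 1)%R))%N.
    move=> UW; have G : (f2 (u - 1)%R <= f2 u)%VS by apply: flag_mono => //; lia.
    have := dimv_sum_cap (U :&: f2 u) (W :&: f2 (u - 1)%R).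
    rewrite -capvA [(f2 u :&: _)%VS]capvC -capvA (capv_idPl G) capvA (capv_idPl UW).
    move=> <-; rewrite leq_add2r; apply: dimvS.
    by rewrite subv_add capvS //= capvS.
  have hh : h - 1 != h by lia.
  have e1 := cumulS B h u; have e2 := cumulS B h (u - 1); have e3 := rowcum_ent B h u.
  have e4 := cumulS C h u; have e5 := cumulS C h (u - 1); have e6 := rowcum_ent C h u.
  have e7 := cB (h - 1) u hh; have e8 := cB (h - 1) (u - 1) hh; have e9 := sumE u.
  move: oS oC oB; rewrite orbit_smat // !orbit_matP // /capdim => -[_ st] oC oB.
  move: st; rewrite /flagstep /gaining; case: b cd {cS} => cd [_ [/inc]]; rewrite !oC !oB; lia.
pose s := [fset p.2 | p in (finsupp C `|` finsupp B)%fset]%fset.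
pose t : nvec := [fsfun u in s => (ent C (gaining b h) u - ent B (gaining b h) u)%N | 0%N].
have tE (u : int) : t u = (ent C (gaining b h) u - ent B (gaining b h) u)%N.
  rewrite fsfunE; case: ifP => // /negP no; apply/esym/eqP; rewrite subn_eq0.
  apply: contra_notT no; rewrite -ltnNge => lt; apply/imfsetP; exists (gaining b h, u) => //=.
  by rewrite in_fsetU !mem_finsupp; move: lt; rewrite /ent; case: (C _).
have mv : moves b h t B C.
  apply: entP => i u; rewrite !ent_madd !ent_rowm tE; have := gain u; have := sumE u.
  have := @rowsE i u.
  case: (gaining_losing b h) => -[-> ->].
    case: (eqVneq i h) => [->|ih]; case: (eqVneq _ (h + 1)) => [e|ih'] /=; try lia.
    by rewrite e; lia.
  case: (eqVneq i h) => [->|ih]; case: (eqVneq _ (h + 1)) => [e|ih'] /=; try lia.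
  by rewrite e; lia.
exists t; split=> //.
have := msum_moves (fun p => p.1 <= h) mv; rewrite /=.
rewrite (nsum_const t (losing b h <= h)) (nsum_const t (gaining b h <= h)).
by move: cd; rewrite /gaining /losing; case: (b); lia.
Qed.

(** Only the sums that contain the gaining row but not the losing one can change. If such a sum
    includes column J, then C gains all a units there and C' at most a. If it stops beyond J, then C
    gains nothing, and what C' gains is bounded by the losing row of B' on these columns. Adding
    that row gives the adjacent sigma of B', which is at most that of B, and there the losing row of
    B contributes 0. *)
Lemma order_step b h J t a B B' C C' :
  moves b h t B' C' -> nsum t xpredT = a -> lead b h J a B C -> leq_sig B' B ->
  leq_sig C' C.
Proof.
move=> mv ta ld BB i j ij; have [_ Jh zx _] := ld.
have eC' P := msum_moves P mv; have eC P := msum_lead P ld.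
have la := leq_nsum t; rewrite ta in la.
have := BB _ _ ij; rewrite !sigijE; case: ltP => ji.
  have := eC' (fun p => (p.1 <= i) && (j <= p.2)); have := eC (fun p => (p.1 <= i) && (j <= p.2)).
  rewrite /= !(nsum_cond t _ (fun u => j <= u)) => e1 e2.
  have := la (fun u => j <= u); move: e1 e2.
  set m := nsum t _; have [ih|ih] := eqVneq i h; last first.
    have -> : (losing b h <= i) = (gaining b h <= i) by rewrite /losing /gaining; case: b {mv ld Jh zx eC eC'}; lia.
    by case: (gaining b h <= i) => /=; lia.
  subst i; case: b mv ld Jh zx eC eC' => /= mv ld Jh zx eC eC'; last first.
    rewrite lexx; have -> : (h + 1 <= h) = false by lia.
    by (have -> : (j <= J) = false by lia); rewrite /=; lia.
  rewrite lexx; have -> : (h + 1 <= h) = false by lia.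
  case: leP => jJ; first by rewrite /=; lia.
  have h1j : h + 1 != j by lia.
  have hj : h + 1 < j by lia.
  have := BB _ _ h1j; rewrite !sigijE hj.
  have split A : msum A (fun p => (p.1 <= h + 1) && (j <= p.2)) =
      (msum A (fun p => (p.1 <= h)%R && (j <= p.2)%R) + msum A (fun p => (p.1 == h + 1)%R && (j <= p.2)%R))%N.
    rewrite (msumID _ (fun p => p.1 <= h)); congr (_ + _)%N; apply: eq_msum => p _ /=; lia.
  rewrite !split [X in (_ <= _ + X)%N]msum_eq0_ent; last first.
    by move=> k u /= /andP[/eqP -> ju]; apply: zx; lia.
  have := eC' (fun p => (p.1 == h + 1) && (j <= p.2)).
  rewrite /= eqxx !(nsum_cond t _ (fun u => j <= u)) -/m.
  have -> : (h == h + 1) = false by lia.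
  by rewrite /=; lia.
have := eC' (fun p => (i <= p.1) && (p.2 <= j)); have := eC (fun p => (i <= p.1) && (p.2 <= j)).
rewrite /= !(nsum_cond t _ (fun u => u <= j)) => e1 e2.
have := la (fun u => u <= j); move: e1 e2.
set m := nsum t _; have [ih|ih] := eqVneq i (h + 1); last first.
  have -> : (i <= losing b h) = (i <= gaining b h) by rewrite /losing /gaining; case: b {mv ld Jh zx eC eC'}; lia.
  by case: (i <= gaining b h) => /=; lia.
have i1 : (i <= h + 1) = true by lia.
have i2 : (i <= h) = false by lia.
case: b mv ld Jh zx eC eC' => /= mv ld Jh zx eC eC'; rewrite ?i1 ?i2.
  by (have -> : (J <= j) = false by lia); rewrite /=; lia.
case: leP => jJ; first by rewrite /=; lia.
have h1j : h != j by lia.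
have hj : (h < j) = false by lia.
have := BB _ _ h1j; rewrite !sigijE hj.
have split A : msum A (fun p => (h <= p.1) && (p.2 <= j)) =
    (msum A (fun p => (i <= p.1)%R && (p.2 <= j)%R) + msum A (fun p => (p.1 == h)%R && (p.2 <= j)%R))%N.
  rewrite (msumID _ (fun p => i <= p.1)); congr (_ + _)%N; apply: eq_msum => p _ /=; lia.
rewrite !split [X in (_ <= _ + X)%N]msum_eq0_ent; last first.
  by move=> k u /= /andP[/eqP -> ju]; apply: zx; lia.
have := eC' (fun p => (p.1 == h) && (p.2 <= j)).
rewrite /= eqxx !(nsum_cond t _ (fun u => u <= j)) -/m.
have -> : (h + 1 == h) = false by lia.
by rewrite /=; lia.
Qed.

(** From J on, the gaining row of C holds exactly the a units at J, so t is zero strictly beyond J.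
    The inequality between B' and B at (gaining b h, J) forces at least a units of t to lie at J or
    beyond. Hence t is concentrated in column J, and B' and B undo the same move. *)
Lemma order_step_eq b h J t a B B' C :
  moves b h t B' C -> nsum t xpredT = a -> lead b h J a B C -> leq_sig B' B -> B' = B.
Proof.
move=> mv ta ld BB; have [e Jh zx zy] := ld.
have gl : losing b h != gaining b h by rewrite /losing /gaining; case: (b); lia.
have entC u : ent C (gaining b h) u = (ent B (gaining b h) u + (if u == J then a else 0))%N.
  have := congr1 (fun A => ent A (gaining b h) u) e; rewrite !ent_madd !ent_emx eqxx /=.
  by rewrite [gaining b h == _]eq_sym (negPf gl) /=; lia.
have entC' u : ent C (gaining b h) u = (ent B' (gaining b h) u + t u)%N.
  have := congr1 (fun A => ent A (gaining b h) u) mv; rewrite !ent_madd !ent_rowm eqxx.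
  by rewrite [gaining b h == _]eq_sym (negPf gl) /=; lia.
have t0 u : (if b then J < u else u < J) -> t u = 0%N.
  move=> Ju; have := entC u; rewrite entC' zy; last by move: Ju; case: (b); lia.
  have -> : (u == J) = false by move: Ju; case: (b); lia.
  by lia.
pose Q u := if b then J <= u else u <= J.
have tQ : nsum t Q = t J.
  rewrite /nsum (eq_bigr (fun u => (if u == J then t u else 0)%N)); last first.
    move=> u Qu; case: eqVneq => // uJ; apply: t0; move: Qu uJ; rewrite /Q; case: (b); lia.
  rewrite -big_mkcondr /=; have QJ : Q J by rewrite /Q; case: (b).
  case: (boolP (J \in finsupp t)) => tJ.
    rewrite (eq_bigl (fun u => u == J)); last by move=> u /=; case: eqP => [->|]; rewrite ?QJ ?andbF.
    by rewrite big_mkcond (bigD1_seq J) ?fset_uniq //= eqxx big1 ?addn0 // => u /negPf ->.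
  by rewrite (fsfun_dflt tJ) big1 // => u /andP[_ /eqP ->]; rewrite (fsfun_dflt tJ).
have tJ : t J = a.
  have la := leq_nsum t Q; rewrite ta tQ in la.
  suff : (a <= t J)%N by lia.
  rewrite -tQ.
  have gJ : gaining b h != J by move: Jh; rewrite /gaining; case: (b); lia.
  have := BB _ _ gJ; rewrite !sigijE; case: ltP => lt.
    have bt : b by move: lt Jh; rewrite /gaining; case: (b) => //; lia.
    have e2 : (losing b h <= gaining b h) = false by rewrite /losing /gaining bt; lia.
    have := msum_moves (fun p => (p.1 <= gaining b h) && (J <= p.2)) mv.
    have := msum_lead (fun p => (p.1 <= gaining b h) && (J <= p.2)) ld.
    by rewrite /= !(nsum_cond t _ (fun u => J <= u)) !lexx e2 /Q bt /=; lia.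
  have bt : b = false by move: lt Jh gJ; rewrite /gaining; case: (b) => //; lia.
  have e2 : (gaining b h <= losing b h) = false by rewrite /losing /gaining bt; lia.
  have := msum_moves (fun p => (gaining b h <= p.1) && (p.2 <= J)) mv.
  have := msum_lead (fun p => (gaining b h <= p.1) && (p.2 <= J)) ld.
  by rewrite /= !(nsum_cond t _ (fun u => u <= J)) !lexx e2 /Q bt /=; lia.
have t0' u : u != J -> t u = 0%N.
  move=> uJ; have := ta; have -> : nsum t xpredT = msum (diagm t) xpredT by rewrite msum_diagm.
  rewrite (msumID _ (fun p => p == (J, J))) /= msum_xpred1 diagmE eqxx muln1 tJ.
  have := @leq_msum1 (diagm t) (fun p => p != (J, J)) (u, u).
  by rewrite xpair_eqE (negPf uJ) diagmE eqxx muln1 /= => /(_ isT); lia.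
apply: entP => i u; have := congr1 (fun A => ent A i u) mv; have := congr1 (fun A => ent A i u) e.
rewrite !ent_madd !ent_emx !ent_rowm.
have [->|uJ] := eqVneq u J; first by rewrite !andbT tJ; case: (i == losing b h); case: (i == gaining b h); lia.
by rewrite !andbF t0' //; case: (i == losing b h); case: (i == gaining b h); lia.
Qed.

Lemma msum_rows N A (P : pred int) : inN N A ->
  msum A (fun p => P p.1) = (\sum_(i <- ints N | P i) ro A i)%N.
Proof.
move=> /inNP AN; rewrite msum_cond [RHS]big_mkcond /=.
under [RHS]eq_bigr do rewrite roE msum_cond.
rewrite (eq_bigr (fun i => \sum_(p <- finsupp A) P i * ((p.1 == i) * A p))%N); last first.
  by move=> i _; rewrite -big_distrr /=; case: (P i); rewrite ?mul1n ?mul0n.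
rewrite exchange_big /= !big_seq; apply: eq_bigr => p; rewrite mem_finsupp => /AN[pN _].
rewrite (bigD1_seq p.1) ?ints_uniq ?mem_ints //= eqxx mul1n big1 ?addn0 // => i /negPf ip.
by rewrite [p.1 == i]eq_sym ip mul0n muln0.
Qed.

Lemma eq_ro_msum A B (P : pred int) : ro A =1 ro B ->
  msum A (fun p => P p.1) = msum B (fun p => P p.1).
Proof.
move=> e; have [N1 A1] := inN_exists A; have [N2 B2] := inN_exists B.
rewrite (msum_rows P (inN_leq (leq_maxl N1 N2) A1)) (msum_rows P (inN_leq (leq_maxr N1 N2) B2)).
by apply: eq_bigr => i _; rewrite e.
Qed.

Lemma ro_trm A : ro (trm A) =1 co A.
Proof. by move=> i; rewrite roE msum_trm coE; apply: eq_msum. Qed.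
Lemma co_trm A : co (trm A) =1 ro A.
Proof. by move=> i; rewrite coE msum_trm roE; apply: eq_msum. Qed.

Lemma eq_co_msum A B (P : pred int) : co A =1 co B ->
  msum A (fun p => P p.2) = msum B (fun p => P p.2).
Proof.
move=> e; have /(eq_ro_msum P) : ro (trm A) =1 ro (trm B) by move=> i; rewrite !ro_trm.
by rewrite !msum_trm.
Qed.

Lemma eq_ro_sig A B : ro A =1 ro B -> sig A = sig B.
Proof. by move/(eq_ro_msum xpredT). Qed.

Lemma eq_co_sig A B : co A =1 co B -> sig A = sig B.
Proof. by move/(eq_co_msum xpredT). Qed.

Lemma inN_rows_cols N A B C : ro C =1 ro A -> co C =1 co B -> inN N A -> inN N B -> inN N C.
Proof.
move=> eA eB /inNP AN /inNP BN; apply/inNP => -[i j] Cij; split=> /=.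
  have : ro C i != 0%N by have := @leq_msum1 C (fun p => p.1 == i) (i, j); rewrite eqxx roE => /(_ isT); case: (C _) Cij; lia.
  by rewrite eA roE => /msum_neq0 [p [/eqP <- /AN[]]].
have : co C j != 0%N by have := @leq_msum1 C (fun p => p.2 == j) (i, j); rewrite eqxx coE => /(_ isT); case: (C _) Cij; lia.
by rewrite eB coE => /msum_neq0 [p [/eqP <- /BN[]]].
Qed.

Lemma rowcum_mono A i j j' : (forall u : int, j < u -> u <= j' -> ent A i u = 0%N) ->
  j <= j' -> rowcum A i j = rowcum A i j'.
Proof.
move=> z jj; rewrite {2}/rowcum (msumID _ (fun p => p.2 <= j)) [X in (_ + X)%N]msum_eq0_ent ?addn0.
  by apply: eq_msum => p _ /=; lia.
by move=> k u /= /andP[/andP[/eqP -> ?] ?]; apply: z; lia.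
Qed.

Lemma step_cond_move b a (h J : int) l B C :
  (forall P : pred (int * int),
     msum C P + a * P (losing b h, J) = msum B P + a * P (gaining b h, J))%N ->
  ro (smat b a h l) =1 ro C -> step_cond b a h l B C.
Proof.
move=> eC eS; split; last split.
- by move=> i; rewrite (eq_ro_msum (fun k => k <= i) eS).
- move=> i j ih; have := eC (fun p => (p.1 <= i) && (p.2 <= j)); rewrite /= /cumul.
  have -> : (losing b h <= i) = (gaining b h <= i) by rewrite /losing /gaining; case: (b); lia.
  by lia.
have := eC (fun p => p.1 <= h); rewrite /= /losing /gaining.
have lt : (h + 1 <= h) = false by lia.
by case: (b); rewrite lexx lt; lia.
Qed.

(* Over a leading position the flag in between is unique: its h-th component is
   [f1_(g-1) + (f1_g :&: f2_j0)], where g is the gaining row. *)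
Lemma cnt_lead (F : finFieldType) n N (t1 t2 : wflag F n N) b a (h J : int) l B :
  wf t1 -> wf t2 -> - N%:Z <= h -> h < N%:Z -> inN N B -> (absz J <= N)%N ->
  ro (smat b a h l) =1 ro (pos t1 t2) -> lead b h J a B (pos t1 t2) ->
  cnt (smat b a h l) B t1 t2 = 1%N.
Proof.
move=> w1 w2 h1 h2 BN JN eS ld; set C := pos t1 t2 in eS ld *.
have ff1 := wf_flag w1; have ff2 := wf_flag w2; have oC := orbit_pos t1 t2; rewrite -/C in oC.
have [e Jh zx zy] := ld; have eC P := msum_lead P ld.
have cond : step_cond b a h l B C by apply: step_cond_move eC eS.
rewrite cnt_smat //; case: pselect => [c|//].
(* The moved units sit in column J: the h-th component excludes them when row h gains and includes
   them when row h loses. *)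
set g := gaining b h; pose j0 : int := if b then J - 1 else J.
have gB j : cumul B h j = (cumul C (g - 1)%R j + rowcum C g (Num.min j j0))%N.
  have rC k : rowcum C g k = (rowcum B g k + a * (J <= k)%R)%N.
    have := eC (fun p => (p.1 == g) && (p.2 <= k)); rewrite /= -/g eqxx.
    have -> : (losing b h == g) = false by rewrite /g /losing /gaining; case: (b); lia.
    by rewrite /rowcum /=; lia.
  have cC : (cumul C h j + a * ((losing b h <= h) && (J <= j))%R = cumul B h j + a * ((g <= h) && (J <= j))%R)%N.
    exact: (eC (fun p => (p.1 <= h) && (p.2 <= j))).
  rewrite rC; rewrite /j0 /g /gaining /losing in cC rC zy *; case: (b) cC rC zy => cC rC zy.
    have := cumulS C h j; rewrite rC.
    have -> : rowcum B h j = rowcum B h (Num.min j (J - 1)).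
      by apply/esym/rowcum_mono; [move=> u ? ?; apply: zy; lia | lia].
    move: cC; rewrite lexx; have -> : (h + 1 <= h) = false by lia.
    have -> : (J <= Num.min j (J - 1)) = false by lia.
    by rewrite /=; lia.
  have -> : rowcum B (h + 1) (Num.min j J) = 0%N.
    by apply: msum_eq0_ent => k u /= /andP[/eqP -> ?]; apply: zy; lia.
  have -> : h + 1 - 1 = h by lia.
  have -> : (J <= Num.min j J) = (J <= j) by lia.
  move: cC; rewrite lexx; have -> : (h + 1 <= h) = false by lia.
  by rewrite /=; lia.
have fg : (wext t1 (g - 1)%R <= wext t1 g)%VS by apply: flag_mono => //; lia.
have [z2 o2] := wext_windowed t2.
have top : wext t2 ((N.*2.+1)%:Z - N%:Z - 1)%R = fullv by rewrite o2 //; lia.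
have dC i j : \dim (wext t1 i :&: wext t2 j) = cumul C i j by move: oC; rewrite orbit_matP // => <-.
pose W := (wext t1 (g - 1)%R + (wext t1 g :&: wext t2 j0))%VS.
have Wg : (W <= wext t1 g)%VS by rewrite subv_add fg capvSl.
have dW j : \dim (W :&: wext t2 j) = cumul B h j.
  rewrite gB; have [jj|jj] := leP j j0.
    have G : (wext t2 j <= wext t2 j0)%VS by apply: flag_mono.
    have -> : (W :&: wext t2 j = wext t1 g :&: wext t2 j)%VS.
      apply/eqP; rewrite eqEsubv capvS //= subv_cap capvSr andbT.
      by rewrite (subv_trans _ (addvSr _ _)) // capvS.
    by rewrite dC cumulS.
  have G : (wext t2 j0 <= wext t2 j)%VS by apply: flag_mono => //; exact: ltW.
  have -> : (W :&: wext t2 j = (wext t1 g :&: wext t2 j0) + (wext t1 (g - 1)%R :&: wext t2 j))%VS.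
    by rewrite /W addvC vspace_modl // (subv_trans _ G) // capvSr.
  have := dimv_sum_cap (wext t1 g :&: wext t2 j0) (wext t1 (g - 1)%R :&: wext t2 j).
  have -> : (wext t1 g :&: wext t2 j0 :&: (wext t1 (g - 1)%R :&: wext t2 j) = wext t1 (g - 1)%R :&: wext t2 j0)%VS.
    apply/eqP; rewrite eqEsubv !subv_cap.
    rewrite (subv_trans (capvSr _ _) (capvSl _ _)) (subv_trans (capvSl _ _) (capvSr _ _)) /=.
    rewrite (subv_trans (capvSl _ _) fg) capvSr capvSl /=.
    exact: subv_trans (capvSr _ _) G.
  rewrite !dC; have := cumulS C g j0; vlia.

suff -> : step_meets N b h (wext t1) (wext t2) B = [set W]%SET by rewrite cards1.
apply/setP => U; rewrite finset.in_set1 /step_meets inE -/g top capvf (capv_idPl fg).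
apply/and3P/eqP => [[lo hi /forallP dU]|->]; last first.
  split=> //; first exact: addvSl.
  by apply/forallP => j; rewrite capvA (capv_idPl Wg) dW.
have dUw (j : int) : - N%:Z - 1 <= j -> j <= N%:Z -> \dim (U :&: wext t2 j) = cumul B h j.
  move=> j1 j2; have jN : (absz (j + N%:Z + 1)%R < N.*2.+2)%N by lia.
  have /eqP := dU (Ordinal jN); rewrite /= capvA (capv_idPl hi).
  by have -> : (absz (j + N%:Z + 1))%:Z - N%:Z - 1 = j by lia.
have j0N : - N%:Z - 1 <= j0 /\ j0 <= N%:Z by rewrite /j0; case: (b); lia.
(* By dimension U contains all of f1_g :&: f2_j0, hence W; the prescribed dimensions at index N then
   agree. *)
apply/esym/eqP; rewrite eqEdim; apply/andP; split.
  rewrite subv_add lo /=.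
  have := dUw j0 j0N.1 j0N.2; rewrite gB minxx -cumulS -dC => e1.
  have /eqP <- : (U :&: wext t2 j0)%VS == (wext t1 g :&: wext t2 j0)%VS.
    by rewrite eqEdim capvS //= e1.
  exact: capvSl.
have := dW N%:Z; have := dUw N%:Z; rewrite o2 // !capvf => -> //; last by lia.
by move=> ->.
Qed.

(** * The exponent d_A under leading moves *)

Definition wsum (A : mat) (w : int * int -> nat) : nat := (\sum_(p <- finsupp A) A p * w p)%N.

Lemma wsum_sub (A : mat) (s : seq (int * int)) w :
  uniq s -> {subset finsupp A <= s} -> wsum A w = (\sum_(p <- s) A p * w p)%N.
Proof.
move=> us sub; rewrite /wsum [RHS](bigID (mem (finsupp A))) /= [X in (_ + X)%N]big1 ?addn0; last first.
  by move=> p /fsfun_dflt ->.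
rewrite -[RHS]big_filter; apply: perm_big; apply: uniq_perm; rewrite ?filter_uniq ?fset_uniq //.
by move=> p; rewrite mem_filter; case: (boolP (p \in finsupp A)) => //= pA; rewrite (sub _ pA).
Qed.

Lemma wsumD A B w : wsum (madd A B) w = (wsum A w + wsum B w)%N.
Proof.
pose s := enum_fset (finsupp A `|` finsupp B)%fset.
rewrite !(@wsum_sub _ s) ?fset_uniq //.
- by rewrite -big_split; apply: eq_bigr => p _; rewrite maddE mulnDl.
- by move=> p pB; rewrite in_fsetU pB orbT.
- by move=> p pA; rewrite in_fsetU pA.
- move=> p; rewrite mem_finsupp maddE in_fsetU !mem_finsupp.
  by case: (A p) => //; case: (B p).
Qed.

Lemma wsum_addw A w w' : wsum A (fun p => w p + w' p)%N = (wsum A w + wsum A w')%N.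
Proof. by rewrite /wsum -big_split; apply: eq_bigr => p _; rewrite mulnDr. Qed.

Lemma wsum_emx a i j w : wsum (emx a i j) w = (a * w (i, j))%N.
Proof.
rewrite (@wsum_sub _ [:: (i, j)]) ?big_seq1 //; first by rewrite emxE eqxx muln1.
by move=> p; rewrite mem_finsupp emxE mem_seq1; case: (p == _); rewrite ?muln0.
Qed.

Lemma wsum_cond A a (P : pred (int * int)) : wsum A (fun p => a * P p)%N = (a * msum A P)%N.
Proof. by rewrite msum_cond /wsum big_distrr; apply: eq_bigr => p _; rewrite /= mulnCA [(A p * _)%N]mulnC. Qed.

Definition dcone (p : int * int) : pred (int * int) := fun q => (q.1 <= p.1) && (p.2 < q.2).

Lemma dA_wsum A : dA A = wsum A (fun p => msum A (dcone p)).
Proof. by apply: eq_bigr => p _; rewrite /msum big_distrr. Qed.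

(** d is a quadratic form; the new units do not pair with each other, since the inequality between
    columns is strict. *)
Lemma dA_madd_emx A a i j : dA (madd A (emx a i j)) =
  (dA A + a * (msum A (dcone (i, j)) + msum A (fun p => dcone p (i, j))))%N.
Proof.
rewrite !dA_wsum wsumD wsum_emx !msumD !msum_emx.
rewrite (_ : wsum A _ = (wsum A (fun p => msum A (dcone p)) + wsum A (fun p => a * dcone p (i, j)))%N)%N.
  rewrite wsum_cond {4}/dcone /= ltxx andbF muln0 addn0; lia.
by rewrite -wsum_addw; apply: eq_bigr => p _; rewrite msumD msum_emx.
Qed.

Lemma dA_diagm l : dA (diagm l) = 0%N.
Proof.
rewrite dA_wsum /wsum big1 // => -[i j] _; rewrite diagmE /=; case: eqP => [<-|]; rewrite ?muln0 //.
by rewrite muln1 msum_diagm /nsum big_pred0 ?muln0 // => u; rewrite /dcone /=; lia.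
Qed.

Lemma maddC A B : madd A B = madd B A.
Proof. by apply: entP => i j; rewrite !ent_madd addnC. Qed.

Lemma nsum1 t (k : int) : nsum t (fun u => u == k) = t k.
Proof.
have := msum_diagm t (fun p => p == (k, k)); rewrite msum_xpred1 diagmE eqxx muln1 => ->.
by apply: eq_bigl => u; rewrite xpair_eqE andbb.
Qed.

Lemma dA_smat b a (h : int) l : dA (smat b a h l) = (a * l (gaining b h))%N.
Proof.
rewrite /smat maddC /emat /gaining; case: b; rewrite dA_madd_emx dA_diagm !msum_diagm add0n; congr (_ * _)%N.
  rewrite -nsum1 /nsum big_pred0 ?add0n; first by apply: eq_bigl => u; rewrite /dcone /=; lia.
  by move=> u; rewrite /dcone /=; lia.
rewrite -nsum1 /nsum [X in (_ + X)%N]big_pred0 ?addn0; first by apply: eq_bigl => u; rewrite /dcone /=; lia.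
by move=> u; rewrite /dcone /=; lia.
Qed.

Lemma dA_move (y x J : int) a B C : madd C (emx a x J) = madd B (emx a y J) ->
  (dA C + a * (msum B (dcone (x, J)) + msum B (fun p => dcone p (x, J))) =
   dA B + a * (msum B (dcone (y, J)) + msum B (fun p => dcone p (y, J))))%N.
Proof.
move=> e; have := congr1 dA e; rewrite !dA_madd_emx.
have eP P : (msum C P + a * P (x, J) = msum B P + a * P (y, J))%N.
  by have := congr1 (fun A => msum A P) e; rewrite !msumD !msum_emx.
have z k m : dcone (k, J) (m, J) = false by rewrite /dcone /= ltxx andbF.
have e1 k : msum C (dcone (k, J)) = msum B (dcone (k, J)).
  by have := eP (dcone (k, J)); rewrite !z !muln0 !addn0.
have e2 k : msum C (fun p => dcone p (k, J)) = msum B (fun p => dcone p (k, J)).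
  by have := eP (fun p => dcone p (k, J)); rewrite !z !muln0 !addn0.
by rewrite !e1 !e2.
Qed.

Lemma dcone_succ B (h k J : int) : k = h + 1 ->
  msum B (dcone (k, J)) = (msum B (dcone (h, J)) + msum B (fun p => (p.1 == k) && (J < p.2)%R))%N /\
  msum B (fun p => dcone p (h, J)) =
   (msum B (fun p => dcone p (k, J)) + msum B (fun p => (p.1 == h) && (p.2 < J)%R))%N.
Proof.
move=> ->; split.
  by rewrite (msumID _ (fun p => p.1 <= h)); congr (_ + _)%N; apply: eq_msum => p _; rewrite /dcone /=; lia.
by rewrite (msumID _ (fun p => h + 1 <= p.1)); congr (_ + _)%N; apply: eq_msum => p _; rewrite /dcone /=; lia.
Qed.

Lemma ro_smat b a (h : int) l (i : int) :
  ro (smat b a h l) i = (a * (i == gaining b h) + l i)%N.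
Proof. by rewrite roE msum_smat /= nsum1 eq_sym. Qed.

Lemma co_smat b a (h : int) l (i : int) :
  co (smat b a h l) i = (a * (i == losing b h) + l i)%N.
Proof. by rewrite coE msum_smat /= nsum1 eq_sym. Qed.

Lemma losing_gaining b (h : int) : (losing b h == gaining b h) = false.
Proof. by rewrite /losing /gaining; case: b; lia. Qed.

(** Moving a units between adjacent rows changes d by a times the difference between the part of the
    gaining row before J and the part of the losing row beyond J. By [lead] the latter is zero and
    the former is the whole gaining row of B, whose sum is the diagonal entry appearing in
    [dA_smat]. So a leading coefficient carries the power v^0. *)
Lemma dA_lead b h J a B C l : lead b h J a B C -> ro (smat b a h l) =1 ro C ->
  dA C = (dA (smat b a h l) + dA B)%N.
Proof.
move=> ld eS; have [e Jh zx zy] := ld; rewrite dA_smat.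
have lg : l (gaining b h) = ro B (gaining b h).
  have := msum_lead (fun p => p.1 == gaining b h) ld; rewrite -!roE -eS ro_smat /= eqxx.
  by rewrite losing_gaining; lia.
have roz : ro B (gaining b h) = msum B (fun p => (p.1 == gaining b h) && (if b then p.2 < J else J < p.2)).
  rewrite roE (msumID _ (fun p => if b then p.2 < J else J < p.2)) [X in (_ + X)%N]msum_eq0_ent ?addn0 //.
  by move=> i j /= /andP[/eqP -> jJ]; apply: zy; case: (b) jJ; lia.
have xz : msum B (fun p => (p.1 == losing b h) && (if b then J < p.2 else p.2 < J)) = 0%N.
  by apply: msum_eq0_ent => i j /= /andP[/eqP -> jJ]; apply: zx.
have := dA_move e; rewrite lg roz; move: xz {eS zx zy lg roz ld e Jh}.
have [] := @dcone_succ B h (h + 1) J erefl; rewrite /gaining /losing; case: b => e1 e2 xz.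
  by rewrite e1 e2 xz; lia.
by rewrite e1 e2 xz; lia.
Qed.

(** * The degree of a matrix *)

Definition wt (N : nat) (A : mat) : nat :=
  (\sum_(i <- ints N) \sum_(j <- ints N | j != i) sigij A i j)%N.

Lemma sigij_gt0 N A (i j : int) : inN N A -> (0 < sigij A i j)%N -> i != j ->
  (i \in ints N) && (j \in ints N).
Proof.
move=> /inNP AN h ij; rewrite !mem_ints; move: h; rewrite sigijE lt0n; case: ltP => ji /msum_neq0 [p [/= pp /AN[]]]; vlia.
Qed.

Lemma wt_lt N A B (i j : int) : leq_sig B A -> i != j -> (sigij B i j < sigij A i j)%N ->
  inN N A -> (wt N B < wt N A)%N.
Proof.
move=> le ij lt AN.
have /andP[iN jN] : (i \in ints N) && (j \in ints N) by apply: (sigij_gt0 AN); lia.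
rewrite /wt (bigD1_seq i) ?ints_uniq //= [X in (_ < X)%N](bigD1_seq i) ?ints_uniq //=.
have le' k : (\sum_(j <- ints N | j != k) sigij B k j <= \sum_(j <- ints N | j != k) sigij A k j)%N.
  by apply: leq_sum => m mk; apply: le; rewrite eq_sym.
rewrite -addSn leq_add //; last by apply: leq_sum.
rewrite -!(big_filter _ (fun m => m != i)).
have jF : j \in [seq m <- ints N | m != i] by rewrite mem_filter eq_sym ij.
have us : uniq [seq m <- ints N | m != i] by rewrite filter_uniq ?ints_uniq.
have si m : m \in [seq m <- ints N | m != i] -> i != m by rewrite mem_filter eq_sym => /andP[].
move: [seq m <- ints N | m != i] jF us si => s jF us si.
rewrite (bigD1_seq j) // [X in (_ < X)%N](bigD1_seq j) //=.
rewrite -addSn leq_add // big_seq_cond [X in (_ <= X)%N]big_seq_cond; apply: leq_sum => m.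
by case/andP => /si im _; apply: le.
Qed.

Lemma wt_prec N A B : prec B A -> inN N A -> (wt N B < wt N A)%N.
Proof. by case=> le [i [j [ij lt]]] AN; apply: wt_lt le ij lt AN. Qed.

(** Each corner counted by [cumul] complements an off-diagonal sigma: inside the first i rows when i
    <= j, inside the first j columns when j < i. The totals of these rows and columns are known. *)
Lemma sigij_inj A B : ro A =1 ro B -> co A =1 co B ->
  (forall i j : int, i != j -> sigij A i j = sigij B i j) -> A = B.
Proof.
move=> er ec E; apply: cumul_inj => i j.
have [ji|ij] := ltP j i.
  have h : i + 1 != j by lia.
  have := E _ _ h; rewrite !sigijE; have -> : (i + 1 < j) = false by lia.
  have := eq_co_msum (fun k => k <= j) ec.
  have split X : msum X (fun p => p.2 <= j) =
      (cumul X i j + msum X (fun p => (i + 1 <= p.1)%R && (p.2 <= j)%R))%N.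
    by rewrite (msumID _ (fun p => p.1 <= i)); congr (_ + _)%N; apply: eq_msum => p _ /=; lia.
  by rewrite !split => e1 e2; move: e1; rewrite e2 => /addIn.
have h : i != j + 1 by lia.
have := E _ _ h; rewrite !sigijE; have -> : (i < j + 1) by lia.
have := eq_ro_msum (fun k => k <= i) er.
have split X : msum X (fun p => p.1 <= i) =
    (cumul X i j + msum X (fun p => (p.1 <= i)%R && (j + 1 <= p.2)%R))%N.
  by rewrite (msumID _ (fun p => p.2 <= j)); congr (_ + _)%N; apply: eq_msum => p _ /=; lia.
by rewrite !split => e1 e2; move: e1; rewrite e2 => /addIn.
Qed.

Lemma prec_leq_sig A B : ro B =1 ro A -> co B =1 co A -> leq_sig B A -> B != A -> prec B A.
Proof.
move=> er ec le BA; split=> //; have [//|no] := pselect (exists i j : int, i != j /\ (sigij B i j < sigij A i j)%N).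
case/eqP: BA; apply: sigij_inj => // i j ij; apply/eqP; rewrite eqn_leq le //= leqNgt.
by apply/negP => lt; apply: no; exists i, j.
Qed.

Lemma lead_leq_sig b h J a B C : lead b h J a B C -> leq_sig B C.
Proof.
move=> ld i j ij; have [_ Jh _ _] := ld; rewrite !sigijE; case: ltP => ji.
  have := msum_lead (fun p => (p.1 <= i) && (j <= p.2)) ld; rewrite /=.
  have : (losing b h <= i) && (j <= J) -> (gaining b h <= i) && (j <= J).
    by move: Jh {ld}; rewrite /losing /gaining; case: b => ?; lia.
  by case: (_ && _); case: (_ && _) => //=; lia.
have := msum_lead (fun p => (i <= p.1) && (p.2 <= j)) ld; rewrite /=.
have : (i <= losing b h) && (J <= j) -> (i <= gaining b h) && (J <= j).
  by move: Jh {ld}; rewrite /losing /gaining; case: b => ?; lia.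
by case: (_ && _); case: (_ && _) => //=; lia.
Qed.

Lemma lead_wt N b (h J : int) a B C : lead b h J a B C -> (0 < a)%N -> inN N C -> (wt N B < wt N C)%N.
Proof.
move=> ld a0 CN; have [_ Jh _ _] := ld.
have gJ : gaining b h != J by move: Jh; rewrite /gaining; case: (b); lia.
apply: (wt_lt (lead_leq_sig ld) gJ) => //; rewrite !sigijE; case: ltP => lt.
  have := msum_lead (fun p => (p.1 <= gaining b h) && (J <= p.2)) ld; rewrite /= !lexx.
  have -> : (losing b h <= gaining b h) = false by move: lt Jh; rewrite /losing /gaining; case: (b); lia.
  by rewrite /=; lia.
have := msum_lead (fun p => (gaining b h <= p.1) && (p.2 <= J)) ld; rewrite /= !lexx.
have -> : (gaining b h <= losing b h) = false by move: lt Jh gJ; rewrite /losing /gaining; case: (b); lia.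
by rewrite /=; lia.
Qed.

(** * Undoing a leading move *)

Lemma seq_argmax (T : eqType) (f : T -> nat) (s : seq T) x0 : x0 \in s ->
  exists2 x, x \in s & forall y, y \in s -> (f y <= f x)%N.
Proof.
move=> x0s; pose P m := has (fun x => f x == m) s.
have exP : exists m, P m by exists (f x0); apply/hasP; exists x0.
have ub m : P m -> (m <= \max_(x <- s) f x)%N.
  by case/hasP => x xs /eqP <-; apply: leq_bigmax_seq.
case: (ex_maxnP exP ub) => m /hasP[x xs /eqP fx] mx; exists x => // y ys.
by rewrite fx; apply: mx; apply/hasP; exists y.
Qed.

Definition shift_entry (A : mat) (y x J : int) : mat :=
  [fsfun p in ((x, J) |` finsupp A)%fset =>
     (if p == (y, J) then 0 else if p == (x, J) then A (x, J) + A (y, J) else A p)%N | 0%N].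

Lemma ent_shift A y x J i j : x != y -> ent (shift_entry A y x J) i j =
  if j == J then if i == y then 0%N else if i == x then (ent A x J + ent A y J)%N else ent A i j
  else ent A i j.
Proof.
move=> xy; rewrite /ent fsfunE !xpair_eqE in_fsetU in_fset1 xpair_eqE.
case: (eqVneq j J) => [->|jJ]; rewrite ?andbT ?andbF /=.
  case: (eqVneq i y) => [->|iy]; first by case: ifP.
  case: (eqVneq i x) => [->|ix] //=.
  by case: ifP => // /negbT /fsfun_dflt ->.
by case: ifP => // /negbT /fsfun_dflt ->.
Qed.

Lemma shift_entry_madd A (y x J : int) : x != y ->
  madd A (emx (A (y, J)) x J) = madd (shift_entry A y x J) (emx (A (y, J)) y J).
Proof.
move=> xy; apply: entP => i j; rewrite !ent_madd !ent_emx ent_shift // -/(ent A y J).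
case: (eqVneq j J) => [->|jJ]; rewrite ?andbT ?andbF //.
case: (eqVneq i y) => [->|iy]; first by rewrite eq_sym (negPf xy) add0n addn0.
by case: (eqVneq i x) => [->|ix]; rewrite ?addn0.
Qed.

(** If some entry lies above the diagonal, one in the last such column is pushed one row down.
    Otherwise the leftmost entry of the first row with something below the diagonal is pushed one
    row up. Extremality empties the two rows where [lead] requires it. *)
Lemma lead_exists N A : inN N A -> (exists p : int * int, p.1 != p.2 /\ A p != 0%N) ->
  exists b (h J : int) a B, [/\ lead b h J a B A, (0 < a)%N,
    - N%:Z <= h /\ h < N%:Z, (absz J <= N)%N & inN N B].
Proof.
move=> AN0; have /inNP AN := AN0; move=> [p0 [p0d p0A]].
have inB (y x J : int) : x != y -> (absz x <= N)%N -> A (y, J) != 0%N -> inN N (shift_entry A y x J).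
  move=> xy xN yA; apply/inNP => -[i j]; rewrite -/(ent _ i j) ent_shift //.
  have [_ JN] := AN _ yA.
  case: (eqVneq j J) => [->|jJ]; last by move/AN.
  case: (eqVneq i y) => [//|iy]; case: (eqVneq i x) => [->//|ix] /AN //.
have [[p1 [p1d p1A]]|noup] := pselect (exists p : int * int, p.1 < p.2 /\ A p != 0%N).
  pose s := [seq p : int * int <- finsupp A | p.1 < p.2].
  (* A lexicographic order coded in base 2N + 1; in the window both digits are at most 2N. *)
  pose key (p : int * int) := (absz (p.2 + N%:Z)%R * N.*2.+1 + absz (p.1 + N%:Z)%R)%N.
  have p1s : p1 \in s by rewrite mem_filter p1d mem_finsupp.
  have [[h J]] := seq_argmax key p1s; rewrite mem_filter mem_finsupp => /andP[/= hJ hA] mx.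
  have [/= hN JN] := AN _ hA.
  have mx' (i j : int) : i < j -> A (i, j) != 0%N -> (key (i, j) <= key (h, J))%N.
    by move=> ij ijA; apply: mx; rewrite mem_filter ij mem_finsupp.
  have z (i j : int) : i < j -> J < j -> ent A i j = 0%N.
    move=> ij Jj; apply/eqP/negPn/negP => ijA; have := mx' _ _ ij ijA; have [/= iN jN] := AN _ ijA.
    by rewrite /key /=; nia.
  have hx : h + 1 != h by lia.
  exists true, h, J, (A (h, J)), (shift_entry A h (h + 1) J).
  split; rewrite ?lt0n //; [|lia|by apply: inB => //; lia].
  split; rewrite /gaining /losing; first exact: shift_entry_madd.
  - lia.
  - move=> u Ju; rewrite ent_shift //; have -> : (u == J) = false by lia.
    by apply: z; lia.
  - move=> u Ju; rewrite ent_shift // eqxx; case: eqP => // uJ.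
    by apply: z; lia.
have low (i j : int) : A (i, j) != 0%N -> j <= i.
  by move=> ijA; rewrite leNgt; apply/negP => ij; apply: noup; exists (i, j).
pose s := [seq p : int * int <- finsupp A | p.2 < p.1].
pose key (p : int * int) := (absz (N%:Z - p.1)%R * N.*2.+1 + absz (N%:Z - p.2)%R)%N.
have p0s : p0 \in s.
  rewrite mem_filter mem_finsupp p0A andbT; case: (p0) p0d p0A => i j /= ij /low; lia.
have [[y J]] := seq_argmax key p0s; rewrite mem_filter mem_finsupp => /andP[/= hJ hA] mx.
have [/= yN JN] := AN _ hA.
have mx' (i j : int) : j < i -> A (i, j) != 0%N -> (key (i, j) <= key (y, J))%N.
  by move=> ij ijA; apply: mx; rewrite mem_filter ij mem_finsupp.
have z (i j : int) : j < i -> i < y \/ i = y /\ j < J -> ent A i j = 0%N.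
  move=> ij Jj; apply/eqP/negPn/negP => ijA; have := mx' _ _ ij ijA; have [/= iN jN] := AN _ ijA.
  by rewrite /key /=; nia.
have yx : y - 1 != y by lia.
have y1 : y - 1 + 1 = y by lia.
exists false, (y - 1), J, (A (y, J)), (shift_entry A y (y - 1) J).
split; rewrite ?lt0n //; [|lia|by apply: inB => //; lia].
split; rewrite /gaining /losing ?y1; first exact: shift_entry_madd.
- lia.
- move=> u Ju; rewrite ent_shift //; have -> : (u == J) = false by lia.
  by apply: z; lia.
- move=> u Ju; rewrite ent_shift // eqxx; case: eqP => // uJ.
  by apply: z; lia.
Qed.

Lemma lead_step_matrix b h J a B C : lead b h J a B C ->
  exists l, ro (smat b a h l) =1 ro C /\ co (smat b a h l) =1 ro B.
Proof.
move=> ld; have [_ _ _ _] := ld.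
pose l : nvec := [fsfun i in [fset p.1 | p in finsupp B]%fset =>
   (ro B i - a * (i == losing b h))%N | 0%N].
have lE i : l i = (ro B i - a * (i == losing b h))%N.
  rewrite fsfunE; case: imfsetP => // no; rewrite roE msum_eq0 // => p /eqP pi.
  apply/eqP; rewrite -[_ == _]negbK -mem_finsupp; apply/negP => pB.
  by apply: no; exists p.
have gl := losing_gaining b h; rewrite eq_sym in gl.
have e i : (ro C i + a * (i == losing b h) = ro B i + a * (i == gaining b h))%N.
  by have := msum_lead (fun p => p.1 == i) ld; rewrite /= -!roE ![_ == i]eq_sym.
exists l; split=> i; rewrite ?ro_smat ?co_smat lE; have := e i.
  by case: eqVneq => [->|_]; rewrite ?gl /=; lia.
case: eqVneq => [->|_] /=; last by lia.
by rewrite eq_sym gl; lia.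
Qed.

(** * Existence of Hall polynomials *)

Lemma orbit_ro (F : finFieldType) n (f g g' : flagT F n) A B :
  is_flag f -> is_flag g -> is_flag g' -> orbit_mat f g A -> orbit_mat f g' B -> ro A =1 ro B.
Proof.
move=> ff gg gg' /(orbit_dim ff gg) oA /(orbit_dim ff gg') oB i.
have E X : msum X (fun p => p.1 <= i) = (msum X (fun p => (p.1 <= i - 1)%R) + ro X i)%N.
  rewrite (msumID _ (fun p => p.1 <= i - 1)) roE; congr (_ + _)%N; apply: eq_msum => p _ /=; lia.
by have := oA i; have := oB i; have := oA (i - 1); have := oB (i - 1); rewrite !E; vlia.
Qed.

Lemma orbit_co (F : finFieldType) n (f g g' : flagT F n) A B :
  is_flag f -> is_flag g -> is_flag g' -> orbit_mat g f A -> orbit_mat g' f B -> co A =1 co B.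
Proof.
move=> ff gg gg' /(orbit_trm A gg ff) oA /(orbit_trm B gg' ff) oB i.
by have := orbit_ro ff gg gg' oA oB i; rewrite !ro_trm.
Qed.

Lemma orbit_coro (F : finFieldType) n (f g g' : flagT F n) A B :
  is_flag f -> is_flag g -> is_flag g' -> orbit_mat g f A -> orbit_mat f g' B -> co A =1 ro B.
Proof.
move=> ff gg gg' /(orbit_trm A gg ff) oA oB i.
by have := orbit_ro ff gg gg' oA oB i; rewrite !ro_trm.
Qed.

Section Convolution.
Variables (F : finFieldType) (n N : nat).
Implicit Types (t : wflag F n N) (x y : mat -> {poly int}).
Local Notation q := (#|F|%:Z).

Lemma pos_ro t1 t2 t3 : wf t1 -> wf t2 -> wf t3 -> ro (pos t1 t2) =1 ro (pos t1 t3).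
Proof. by move=> /wf_flag f1 /wf_flag f2 /wf_flag f3; apply: (orbit_ro f1 f2 f3); apply: orbit_pos. Qed.
Lemma pos_co t1 t2 t3 : wf t1 -> wf t2 -> wf t3 -> co (pos t1 t3) =1 co (pos t2 t3).
Proof. by move=> /wf_flag f1 /wf_flag f2 /wf_flag f3; apply: (orbit_co f3 f1 f2); apply: orbit_pos. Qed.
Lemma pos_coro t1 t2 t3 : wf t1 -> wf t2 -> wf t3 -> co (pos t1 t2) =1 ro (pos t2 t3).
Proof. by move=> /wf_flag f1 /wf_flag f2 /wf_flag f3; apply: (orbit_coro f2 f1 f3); apply: orbit_pos. Qed.

Definition realize x t1 t2 : int := (x (pos t1 t2)).[q].
Definition conv (phi psi : wflag F n N -> wflag F n N -> int) t1 t2 : int :=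
  \sum_(t | wf t) phi t1 t * psi t t2.

Lemma cnt_sum A B t1 t2 :
  (cnt A B t1 t2)%:Z = \sum_(t | wf t) (pos t1 t == A)%:R * (pos t t2 == B)%:R.
Proof.
rewrite /cnt -sum1_card -natz natr_sum [RHS]big_mkcond [LHS]big_mkcond; apply: eq_bigr => t _.
by rewrite inE; case: (wf t); case: (_ == A); case: (_ == B); rewrite ?mulr0 ?mul0r ?mulr1.
Qed.

Lemma cnt_neq0 A B t1 t2 : cnt A B t1 t2 != 0%N ->
  exists t, [/\ wf t, pos t1 t = A & pos t t2 = B].
Proof.
rewrite -lt0n => /card_gt0P[t]; rewrite inE => /and3P[w /eqP e1 /eqP e2].
by exists t.
Qed.

Lemma sum_Om (G : mat -> int) t1 t2 : wf t1 -> wf t2 ->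
  \sum_(A <- Om N n) (pos t1 t2 == A)%:R * G A = G (pos t1 t2).
Proof.
move=> w1 w2; rewrite (bigD1_seq (pos t1 t2)) ?Om_uniq ?pos_Om //= eqxx mul1r big1 ?addr0 //.
by move=> A /negPf AA; rewrite eq_sym AA mul0r.
Qed.

Lemma convA (f g h : wflag F n N -> wflag F n N -> int) t1 t2 :
  conv (conv f g) h t1 t2 = conv f (conv g h) t1 t2.
Proof.
rewrite /conv; under eq_bigr do rewrite mulr_suml.
rewrite exchange_big; apply: eq_bigr => t _; rewrite mulr_sumr; apply: eq_bigr => t' _.
by rewrite mulrA.
Qed.

End Convolution.

Definition deltam (A : mat) : mat -> {poly int} := fun B => (B == A)%:R.

Lemma realize_delta (F : finFieldType) n N A (t1 t2 : wflag F n N) :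
  realize (deltam A) t1 t2 = (pos t1 t2 == A)%:R.
Proof. by rewrite /realize /deltam; case: (_ == _); rewrite ?hornerC ?horner0. Qed.

Definition same_real N r (F : finFieldType) (phi psi : wflag F r N -> wflag F r N -> int) : Prop :=
  forall t1 t2, wf t1 -> wf t2 -> phi t1 t2 = psi t1 t2.

(* Left convolution by x preserves the functions whose values are polynomial in q. *)
Definition Good N r (x : mat -> {poly int}) : Prop :=
  forall y, exists z, forall F : finFieldType,
    same_real (conv (@realize F r N x) (realize y)) (realize z).

Lemma Good_ext N r x x' : Good N r x ->
  (forall F : finFieldType, same_real (@realize F r N x) (realize x')) -> Good N r x'.
Proof.
move=> gx E y; have [z Hz] := gx y; exists z => F t1 t2 w1 w2; rewrite -Hz //.
by apply: eq_bigr => t wt; rewrite E.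
Qed.

Lemma Good_sub N r x x' : Good N r x -> Good N r x' -> Good N r (fun C => x C - x' C).
Proof.
move=> gx gx' y; have [z Hz] := gx y; have [z' Hz'] := gx' y.
exists (fun C => z C - z' C) => F t1 t2 w1 w2; rewrite [RHS]/realize hornerD hornerN.
rewrite -[(z _).[_]]/(realize z t1 t2) -[(z' _).[_]]/(realize z' t1 t2) -Hz // -Hz' // /conv -sumrB; apply: eq_bigr => t wt.
by rewrite /realize hornerD hornerN mulrBl.
Qed.

Lemma Good_scale N r c x : Good N r x -> Good N r (fun C => c * x C).
Proof.
move=> gx y; have [z Hz] := gx y.
exists (fun C => c * z C) => F t1 t2 w1 w2; rewrite [RHS]/realize hornerM.
rewrite -[(z _).[_]]/(realize z t1 t2) -Hz // /conv mulr_sumr; apply: eq_bigr => t wt.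
by rewrite /realize hornerM mulrA.
Qed.

Lemma Good_sum N r (s : seq mat) (x : mat -> mat -> {poly int}) :
  (forall A, A \in s -> Good N r (x A)) -> Good N r (fun C => \sum_(A <- s) x A C).
Proof.
elim: s => [|A s IH] gs.
  move=> y; exists (fun=> 0) => F t1 t2 w1 w2; rewrite [RHS]/realize horner0 /conv big1 // => t _.
  by rewrite /realize big_nil horner0 mul0r.
move=> y; have [z Hz] := gs A (mem_head _ _) y.
have [z' Hz'] := IH (fun B Bs => gs B (mem_behead (s := A :: s) Bs)) y.
exists (fun C => z C + z' C) => F t1 t2 w1 w2; rewrite [RHS]/realize hornerD.
rewrite -[(z _).[_]]/(realize z t1 t2) -[(z' _).[_]]/(realize z' t1 t2) -Hz // -Hz' // /conv -big_split; apply: eq_bigr => t wt /=.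
by rewrite /realize big_cons hornerD mulrDl.
Qed.

Lemma Good_conv N r x x' z : Good N r x -> Good N r x' ->
  (forall F : finFieldType, same_real (conv (@realize F r N x) (realize x')) (realize z)) ->
  Good N r z.
Proof.
move=> gx gx' Hz y; have [u Hu] := gx' y; have [u' Hu'] := gx u.
exists u' => F t1 t2 w1 w2; rewrite -Hu' //.
transitivity (conv (conv (@realize F r N x) (realize x')) (realize y) t1 t2).
  by apply: eq_bigr => t wt; rewrite Hz.
by rewrite convA; apply: eq_bigr => t wt; rewrite Hu.
Qed.

Definition hall N r (A B : mat) : Prop := exists P : mat -> {poly int},
  forall (F : finFieldType) (t1 t2 : wflag F r N), wf t1 -> wf t2 ->
    (cnt A B t1 t2)%:Z = (P (pos t1 t2)).[#|F|%:Z].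

Lemma hall_smat N r b a (h : int) l B :
  - N%:Z <= h -> h < N%:Z -> inN N B -> hall N r (smat b a h l) B.
Proof.
by move=> h1 h2 BN; have [P HP] := cnt_smat_poly b a l h1 h2 BN; exists P => F; apply: HP.
Qed.

Lemma Good_delta N r A : (forall B, B \in Om N r -> hall N r A B) -> Good N r (deltam A).
Proof.
move=> HA y.
have ex (B : mat) : exists P : mat -> {poly int}, B \in Om N r ->
    forall (F : finFieldType) (t1 t2 : wflag F r N), wf t1 -> wf t2 ->
    (cnt A B t1 t2)%:Z = (P (pos t1 t2)).[#|F|%:Z].
  by case: (boolP (B \in Om N r)) => [/HA [P HP]|_]; [exists P | exists (fun=> 0)].
have [P HP] := choice ex.
exists (fun C => \sum_(B <- Om N r) P B C * y B) => F t1 t2 w1 w2.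
rewrite [RHS]/realize horner_sum big_seq.
under eq_bigr => B BO do rewrite hornerM -HP // cnt_sum mulr_suml.
rewrite -big_seq exchange_big; apply: eq_bigr => t wt /=.
rewrite realize_delta.
under [RHS]eq_bigr do rewrite -mulrA.
by rewrite -mulr_sumr (sum_Om (fun B => (y B).[_])).
Qed.

Lemma hall_Good N r A B : Good N r (deltam A) -> hall N r A B.
Proof.
move=> /(_ (deltam B))[z Hz]; exists z => F t1 t2 w1 w2.
rewrite -/(realize z t1 t2) -Hz // cnt_sum; apply: eq_bigr => t wt.
by rewrite !realize_delta.
Qed.

Lemma lead_co b h J a B C : lead b h J a B C -> co B =1 co C.
Proof.
by move=> ld j; have := msum_lead (fun p => p.2 == j) ld; rewrite /= => /addIn.
Qed.

Lemma lead_sig b h J a B C : lead b h J a B C -> sig B = sig C.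
Proof. by move/lead_co/eq_co_sig. Qed.

Lemma cnt_prec (F : finFieldType) n N (t1 t2 : wflag F n N) b a (h J : int) l B B' C :
  wf t1 -> wf t2 -> lead b h J a B C -> ro (smat b a h l) =1 ro C ->
  leq_sig B' B -> co B' =1 co B -> cnt (smat b a h l) B' t1 t2 != 0%N ->
  [/\ ro (pos t1 t2) =1 ro C, co (pos t1 t2) =1 co C, leq_sig (pos t1 t2) C &
      pos t1 t2 = C -> B' = B].
Proof.
move=> w1 w2 ld eS le eco /cnt_neq0[t [w e1 e2]].
have [s [mv ts]] := orbit_moves (wf_flag w1) (wf_flag w2) (wf_flag w)
   (orbit_pos _ _) ((posP _ w1 w).2 e1) ((posP _ w w2).2 e2).
split.
- by move=> i; rewrite -eS -e1; apply: pos_ro.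
- by move=> i; rewrite -(lead_co ld) -eco -e2; apply: pos_co.
- exact: order_step mv ts ld le.
- by move=> e; rewrite e in mv; apply: order_step_eq mv ts ld le.
Qed.

Lemma Good_all N r A : (0 < N)%N -> A \in Om N r -> Good N r (deltam A).
Proof.
move=> N0; have [m] := ubnP (wt N A); elim: m A => // m IH A Am AO.
have [AN /eqP sA] := andP (etrans (esym (mem_Om N r A)) AO).
have [off|diag] := pselect (exists p : int * int, p.1 != p.2 /\ A p != 0%N); last first.
  pose l : nvec := [fsfun i in [fset p.1 | p in finsupp A]%fset => A (i, i) | 0%N].
  have lE i : l i = A (i, i).
    rewrite fsfunE; case: imfsetP => // no; apply/esym/eqP/negPn/negP; rewrite -mem_finsupp => ?.
    by apply: no; exists (i, i).
  (* A diagonal matrix is a step matrix with a = 0, for any h in the window; h = -N is admissible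
     because 0 < N. *)
  have -> : A = smat true 0 (- N%:Z) l.
    apply: matP => i j; rewrite smatE /= lE mul0n add0n.
    case: eqVneq => [->|ij]; first by rewrite muln1.
    by rewrite muln0; apply/eqP/negPn/negP => ijA; apply: diag; exists (i, j).
  apply: Good_delta => B; rewrite mem_Om => /andP[BN _]; apply: hall_smat => //; lia.
have [b [h [J [a [B [ld a0 [h1 h2] JN BN]]]]]] := lead_exists AN off.
have [l [eS eB]] := lead_step_matrix ld.
have BO : B \in Om N r by rewrite mem_Om BN (lead_sig ld) sA eqxx.
have gB : Good N r (deltam B) by apply: IH => //; have := lead_wt ld a0 AN; lia.
have gS : Good N r (deltam (smat b a h l)).
  by apply: Good_delta => X; rewrite mem_Om => /andP[XN _]; apply: hall_smat.
have [P HP] := hall_Good B gS.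
(* The product of S and B: coefficient 1 at A by [cnt_lead], and 0 at all remaining positions of
   weight not below that of A by [cnt_prec]. *)
pose z C : {poly int} := if C == A then 1 else if (wt N C < wt N A)%N then P C else 0.
have Hz (F : finFieldType) : same_real (conv (@realize F r N (deltam (smat b a h l))) (realize (deltam B))) (realize z).
  move=> t1 t2 w1 w2; transitivity ((cnt (smat b a h l) B t1 t2)%:Z).
    by rewrite cnt_sum; apply: eq_bigr => t _; rewrite !realize_delta.
  rewrite /realize /z; case: eqP => [e|/eqP ne].
    by rewrite hornerC (@cnt_lead F r N t1 t2 b a h J l B) // e.
  case: ifP => lt; first exact: HP.
  rewrite horner0; have [->//|nz] := eqVneq (cnt (smat b a h l) B t1 t2) 0%N.
  have [er ec le _] := cnt_prec w1 w2 ld eS (fun _ _ _ => leqnn _) (fun _ => erefl) nz.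
  by rewrite (wt_prec (prec_leq_sig er ec le ne) AN) in lt.
have gz := Good_conv gS gB Hz.
have gl : Good N r (fun C => \sum_(D <- [seq D <- Om N r | (wt N D < wt N A)%N]) P D * deltam D C).
  apply: Good_sum => D; rewrite mem_filter => /andP[lt DO]; apply: Good_scale.
  by apply: IH => //; lia.
apply: Good_ext (Good_sub gz gl) _ => F t1 t2 w1 w2.
rewrite /realize; congr (_.[_]); rewrite /z {2}/deltam.
set C := pos t1 t2; have CO : C \in Om N r by exact: pos_Om.
have -> : \sum_(D <- [seq D <- Om N r | (wt N D < wt N A)%N]) P D * deltam D C =
    if (wt N C < wt N A)%N then P C else 0.
  rewrite big_filter big_mkcond (bigD1_seq C) ?Om_uniq //= big1 ?addr0.
    by rewrite /deltam eqxx mulr1.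
  by move=> D /negPf DC; rewrite /deltam eq_sym DC mulr0 if_same.
case: eqVneq => [->|_]; first by rewrite ltnn subr0.
by rewrite subrr.
Qed.

(** * The structure constants *)

Section Coordinate.
Variables (F : finFieldType) (n : nat).

Definition coordsp (S : {set 'I_n}) : {vspace 'rV[F]_n} :=
  (\sum_(b in S) <[(delta_mx 0 b : 'rV[F]_n)%R]>)%VS.

Lemma coordspP (S : {set 'I_n}) (x : 'rV[F]_n) :
  reflect (forall b, b \notin S -> x 0 b = 0) (x \in coordsp S).
Proof.
apply: (iffP idP) => [/memv_sumP[u uS ->] b bS|x0].
  rewrite summxE big1 // => c cS; have /vlineP[k ->] := uS c cS.
  rewrite !mxE eqxx /=; case: (b =P c) => [e|_]; last by rewrite mulr0.
  by rewrite e cS in bS.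
rewrite (row_sum_delta x) (bigID (mem S)) /= [X in _ + X]big1 ?addr0; last first.
  by move=> b /x0 ->; rewrite scale0r.
by apply: memv_suml => b bS; rewrite memvZ // (subvP (sumv_sup b bS (subvv _))) ?memv_line.
Qed.

Lemma coordspI S T : (coordsp S :&: coordsp T)%VS = coordsp (S :&: T).
Proof.
apply/vspaceP => x; rewrite memv_cap; apply/andP/coordspP => [[/coordspP xS /coordspP xT] b|x0].
  by rewrite finset.in_setI negb_and => /orP[/xS|/xT].
by split; apply/coordspP => b bS; apply: x0; rewrite finset.in_setI (negPf bS) ?andbF.
Qed.

Lemma coordspT : coordsp finset.setT = fullv.
Proof. by apply/vspaceP => x; rewrite memvf; apply/coordspP => b; rewrite finset.in_setT. Qed.

Lemma dim_coordsp S : \dim (coordsp S) = #|S|.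
Proof.
have le T : (\dim (coordsp T) <= #|T|)%N.
  rewrite /coordsp (leq_trans (dimv_leq_sum _ _ _)) // -sum1_card; apply: leq_sum => b _.
  by rewrite dim_vline leq_b1.
have full : (coordsp S + coordsp (~: S))%VS = fullv.
  apply/vspaceP => x; rewrite memvf (row_sum_delta x); apply: memv_suml => b _.
  rewrite memvZ //; case: (boolP (b \in S)) => bS.
    by rewrite (subvP (addvSl _ _)) // (subvP (sumv_sup b bS (subvv _))) ?memv_line.
  have bS' : b \in ~: S by rewrite finset.in_setC.
  by rewrite (subvP (addvSr _ _)) // (subvP (sumv_sup b bS' (subvv _))) ?memv_line.
have := (dimv_add_leqif (coordsp S) (coordsp (~: S))).1; rewrite full dimvf /dim /= mul1n.
move=> d; apply/eqP; rewrite eqn_leq le -(leq_add2r #|~: S|) cardsC card_ord.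
by apply: leq_trans d _; rewrite leq_add2l le.
Qed.

End Coordinate.

(** The r basis vectors are labelled by matrix positions, C p of them by p; f1 i is spanned by those
    with row label at most i, f2 j by those with column label at most j. Intersections of coordinate
    spaces then count labels, and this number is [cumul C i j]. *)
Lemma pos_surj (F : finFieldType) N r C : C \in Om N r ->
  exists t1 t2 : wflag F r N, [/\ wf t1, wf t2 & pos t1 t2 = C].
Proof.
rewrite mem_Om => /andP[/inNP CN /eqP sC].
pose L := flatten [seq nseq (C p) p | p <- finsupp C].
have sL : size L = r.
  rewrite size_flatten /shape -map_comp -sC sumnE big_map; apply: eq_bigr => p _.
  by rewrite /= size_nseq.
have cL (P : pred (int * int)) : count P L = msum C P.
  rewrite /L /msum; elim: (finsupp C : seq _) => [|p s IH]; first by rewrite big_nil.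
  rewrite /= count_cat IH big_cons count_nseq; case: (P p); rewrite ?mul1n //.
pose lab (b : 'I_r) := nth (0, 0) L b.
have card_lab (P : pred (int * int)) : #|[set b | P (lab b)]%SET| = msum C P.
  by rewrite -cL -sum1dep_card -sum1_count (big_nth (0, 0)) sL big_mkord.
have labN b : (absz (lab b).1 <= N)%N /\ (absz (lab b).2 <= N)%N.
  apply: CN; rewrite -msum_xpred1 -card_lab -lt0n; apply/card_gt0P; exists b.
  by rewrite inE.
pose f1 (i : int) := coordsp F [set b | (lab b).1 <= i]%SET.
pose f2 (j : int) := coordsp F [set b | (lab b).2 <= j]%SET.
have flagf (c : int * int -> int) : (forall b, absz (c (lab b)) <= N)%N ->
    let f := (fun i => coordsp F [set b | c (lab b) <= i]%SET) : flagT F r in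
    is_flag f /\ windowed N f.
  move=> cN; have z (i : int) : i < - N%:Z -> coordsp F [set b | c (lab b) <= i]%SET = 0%VS.
    move=> iN; apply/eqP; rewrite -dimv_eq0 dim_coordsp cards_eq0; apply/eqP/setP => b.
    by rewrite !inE; have := cN b; lia.
  have o (i : int) : N%:Z <= i -> coordsp F [set b | c (lab b) <= i]%SET = fullv.
    by move=> iN; rewrite -coordspT; congr coordsp; apply/setP => b; rewrite !inE; have := cN b; lia.
  split=> //; split=> [i|].
    by apply/subvP => x /coordspP x0; apply/coordspP => b; rewrite !inE => h; apply: x0; rewrite inE; lia.
  split; first by exists (- N%:Z - 1) => i iN; apply: z; lia.
  by move=> x; exists N%:Z; rewrite o ?memvf.
have [ff1 w1] := flagf fst (fun b => (labN b).1).
have [ff2 w2] := flagf snd (fun b => (labN b).2).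
exists (wres N f1), (wres N f2).
have wf1 : wf (wres N f1) by exact: wf_wres.
have wf2 : wf (wres N f2) by exact: wf_wres.
split=> //; apply/posP => //; rewrite !wresK // orbit_matP // => i j.
rewrite /capdim /f1 /f2 coordspI dim_coordsp /cumul -card_lab; congr (#|pred_of_set _|).
by apply/setP => b; rewrite !inE.
Qed.

Lemma eq_poly_primes (P Q : {poly int}) : (forall p, prime p -> P.[p%:Z] = Q.[p%:Z]) -> P = Q.
Proof.
move=> E; apply/eqP; rewrite -subr_eq0; apply/negPn/negP => PQ.
have [s [us ss sp]] : exists s : seq int, [/\ uniq s, size s = size (P - Q) & forall x, x \in s -> exists2 p, prime p & x = p%:Z].
  elim: (size (P - Q)) => [|k [s [us ss sp]]]; first by exists [::].
  have [p mp pp] := prime_above (\max_(x <- s) `|x|)%N.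
  exists (p%:Z :: s); split; rewrite /= ?ss ?us ?andbT //.
    apply/negP => ps; have := @leq_bigmax_seq _ s xpredT (fun x : int => absz x) p%:Z ps isT.
    by rewrite /= leqNgt mp.
  by move=> x; rewrite inE => /predU1P[->|/sp //]; exists p.
suff : (size s < size (P - Q)%R)%N by rewrite ss ltnn.
apply: max_poly_roots => //; apply/allP => x /sp [p pp ->].
by rewrite rootE hornerD hornerN E // subrr.
Qed.

Lemma count_is_unique (F : finFieldType) n (P : flagT F n -> Prop) k k' :
  count_is P k -> count_is P k' -> k = k'.
Proof.
suff H m m' : count_is P m -> count_is P m' -> (m <= m')%N.
  by move=> c c'; apply/eqP; rewrite eqn_leq (H _ _ c c') (H _ _ c' c).
move=> [g [gP [gi _]]] [g' [_ [_ gs']]].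
have [s Hs] := choice (fun t => gs' (g t) (gP t)).
have si : injective s.
  by move=> t u e; apply: gi => i; rewrite Hs e -Hs.
by have := leq_card s si; rewrite !card_ord.
Qed.

Section Gpoly.
Variables (N r : nat) (N0 : (0 < N)%N).
Implicit Types (A B C D E S : mat).

Lemma count_is_cnt (F : finFieldType) A B C (f1 f2 : flagT F r) (t1 t2 : wflag F r N) :
  A \in Om N r -> f1 = wext t1 -> f2 = wext t2 -> wf t1 -> wf t2 ->
  count_is (fun f => is_flag f /\ orbit_mat f1 f A /\ orbit_mat f f2 B) (cnt A B t1 t2).
Proof.
move=> AO -> -> w1 w2.
pose T := [set t : wflag F r N | [&& wf t, pos t1 t == A & pos t t2 == B]]%SET.
exists (fun k : 'I_#|T| => wext (enum_val k)); split; last split.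
- move=> k; have := enum_valP k; rewrite inE => /and3P[w /eqP e1 /eqP e2].
  by split; [exact: wf_flag | split; apply/posP].
- move=> k k' e; apply: enum_val_inj.
  have := enum_valP k; have := enum_valP k'; rewrite !inE => /and3P[/andP[_ /eqP w'] _ _].
  move=> /and3P[/andP[_ /eqP w''] _ _]; rewrite -w' -w''.
  by congr wres; apply: funext.
move=> f [ff [o1 o2]].
have fN := orbit_windowed2 (wf_flag w1) ff o1 AO.
have fT : wres N f \in T.
  have w := wf_wres ff fN; rewrite inE w /=; apply/andP.
  by split; apply/eqP/posP; rewrite ?wresK.
by exists (enum_rank_in fT (wres N f)) => i; rewrite enum_rankK_in // wresK.
Qed.

(** As the three matrices lie in the window, so do both flags at position C and every flag in
    between; counting arbitrary flags is thus counting in a finite type. *)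
Lemma gpoly_specE A B C P : A \in Om N r -> B \in Om N r -> C \in Om N r ->
  gpoly_spec A B C P <->
  forall (F : finFieldType) (t1 t2 : wflag F r N), wf t1 -> wf t2 -> pos t1 t2 = C ->
    (cnt A B t1 t2)%:Z = P.[#|F|%:Z].
Proof.
move=> AO BO CO; have /andP[CN /eqP sC] := etrans (esym (mem_Om N r C)) CO.
rewrite /gpoly_spec sC; split=> H F.
  move=> t1 t2 w1 w2 e.
  have [k [ck <-]] := H F _ _ (wf_flag w1) (wf_flag w2) ((posP _ w1 w2).2 e).
  congr (Posz _); apply: (count_is_unique _ ck).
  exact: count_is_cnt.
move=> f1 f2 ff1 ff2 o; exists (cnt A B (wres N f1) (wres N f2)).
have w1 := orbit_windowed ff1 ff2 o CO; have w2 := orbit_windowed2 ff1 ff2 o CO.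
have wf1 := wf_wres ff1 w1; have wf2 := wf_wres ff2 w2.
split; first by apply: count_is_cnt; rewrite ?wresK.
by apply: H => //; apply/posP; rewrite ?wresK.
Qed.

Lemma gpolyP A B (F : finFieldType) (t1 t2 : wflag F r N) :
  A \in Om N r -> B \in Om N r -> wf t1 -> wf t2 ->
  (cnt A B t1 t2)%:Z = (gpoly A B (pos t1 t2)).[#|F|%:Z].
Proof.
move=> AO BO w1 w2; have CO := pos_Om w1 w2.
have [P HP] := hall_Good B (Good_all N0 AO).
have ex : exists P, gpoly_spec A B (pos t1 t2) P.
  by exists (P (pos t1 t2)); apply/gpoly_specE => // F' s1 s2 v1 v2 <-; exact: HP.
have := ClassicalEpsilon.epsilon_spec (inhabits 0) _ ex; rewrite -/(gpoly A B (pos t1 t2)).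
by move/gpoly_specE; apply.
Qed.

Lemma gpoly_eq A B C P : A \in Om N r -> B \in Om N r -> C \in Om N r ->
  (forall (F : finFieldType) (t1 t2 : wflag F r N), wf t1 -> wf t2 -> pos t1 t2 = C ->
    (cnt A B t1 t2)%:Z = P.[#|F|%:Z]) -> gpoly A B C = P.
Proof.
move=> AO BO CO H; apply: eq_poly_primes => p pp.
have [t1 [t2 [w1 w2 e]]] := pos_surj 'F_p CO.
have := H _ _ _ w1 w2 e; have := gpolyP AO BO w1 w2.
by rewrite e card_Fp // => -> ->.
Qed.

Lemma gpoly_neq0 A B C : A \in Om N r -> B \in Om N r -> C \in Om N r -> gpoly A B C != 0 ->
  exists (F : finFieldType) (t1 t2 : wflag F r N),
    [/\ wf t1, wf t2, pos t1 t2 = C & cnt A B t1 t2 != 0%N].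
Proof.
move=> AO BO CO nz; have [//|no] := pselect (exists (F : finFieldType) (t1 t2 : wflag F r N),
    [/\ wf t1, wf t2, pos t1 t2 = C & cnt A B t1 t2 != 0%N]).
case/eqP: nz; apply: gpoly_eq => // F t1 t2 w1 w2 e; rewrite horner0.
have [->//|nz] := eqVneq (cnt A B t1 t2) 0%N.
by case: no; exists F, t1, t2.
Qed.

(** At a prime both sides are values of the same triple convolution of indicator functions. *)
Lemma gpoly_assoc A B C E : A \in Om N r -> B \in Om N r -> C \in Om N r -> E \in Om N r ->
  \sum_(D <- Om N r) gpoly A B D * gpoly D C E = \sum_(D <- Om N r) gpoly B C D * gpoly A D E.
Proof.
move=> AO BO CO EO; apply: eq_poly_primes => p pp.
have [t1 [t2 [w1 w2 e]]] := pos_surj 'F_p EO.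
rewrite !horner_sum -e.
pose d X (s s' : wflag 'F_p r N) : int := (pos s s' == X)%:R.
have c1 X Y (s s' : wflag 'F_p r N) : X \in Om N r -> Y \in Om N r -> wf s -> wf s' ->
    (gpoly X Y (pos s s')).[p%:Z] = conv (d X) (d Y) s s'.
  by move=> XO YO v v'; have := gpolyP XO YO v v'; rewrite card_Fp // => <-; rewrite cnt_sum.
transitivity (conv (conv (d A) (d B)) (d C) t1 t2).
  rewrite big_seq; under eq_bigr => D DO do rewrite hornerM (c1 D C) // mulr_sumr.
  rewrite -big_seq exchange_big; apply: eq_bigr => t wt /=.
  rewrite -(c1 A B) // -(sum_Om (fun D => (gpoly A B D).[p%:Z]) w1 wt) mulr_suml.
  by apply: eq_bigr => D _; rewrite mulrA [_ * d D _ _]mulrC.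
rewrite convA big_seq; under [RHS]eq_bigr => D DO do rewrite hornerM (c1 A D) // mulr_sumr.
rewrite -big_seq exchange_big; apply: eq_bigr => t wt /=.
rewrite -(c1 B C) // -(sum_Om (fun D => (gpoly B C D).[p%:Z]) wt w2) mulr_sumr.
by apply: eq_bigr => D _; rewrite /d; ring.
Qed.

End Gpoly.

(** * Particular structure constants *)

Lemma ent_emat b a h i j :
  ent (emat b a h) i j = if (i == gaining b h) && (j == losing b h) then a else 0%N.
Proof. by rewrite /emat; case: b; rewrite ent_emx. Qed.

Lemma qbin_gt n m : (n < m)%N -> qbin n m = 0.
Proof.
elim: n m => [|n IH] [|m] //= nm; rewrite !IH ?mulr0 ?addr0 //; lia.
Qed.

Lemma qbinn n : qbin n n = 1.
Proof. by elim: n => //= n IH; rewrite IH qbin_gt ?mulr0 ?add0r. Qed.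

Lemma qbin_1 n : qbin n 1 = \sum_(i < n) 'X^i.
Proof.
elim: n => [|n IH]; first by rewrite big_ord0.
rewrite big_ord_recl /= IH mulr_sumr addrC expr0; congr (_ + _); first by case: (n).
by apply: eq_bigr => i _; rewrite /bump /= add1n expr1 exprS.
Qed.

Lemma qbin_pred n : qbin n.+1 n = \sum_(i < n.+1) 'X^i.
Proof.
elim: n => [|n IH]; first by rewrite big_ord1 expr0.
by rewrite big_ord_recr /= -IH -/(qbin n.+1 n.+1) -/(qbin n.+1 n) qbinn mulr1 addrC.
Qed.

Lemma inN_smat N b a h l B C : ro (smat b a h l) =1 ro C -> co (smat b a h l) =1 ro B ->
  inN N C -> inN N B -> inN N (smat b a h l).
Proof.
move=> eC eB CN BN; apply: (@inN_rows_cols N C (trm B)) => //.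
  by move=> i; rewrite eB co_trm.
by apply/inNP => -[i j]; rewrite trmE => ji; have [/= ? ?] := inNP N B BN _ ji.
Qed.

Lemma gpoly_lead b h J a B C l : lead b h J a B C ->
  ro (smat b a h l) =1 ro C -> co (smat b a h l) =1 ro B -> gpoly (smat b a h l) B C = 1.
Proof.
move=> ld eC eB; have [N1 CN] := inN_exists C; have [N2 BN] := inN_exists B.
pose N := (N1 + N2 + absz J + absz h).+1%N.
have {}CN : inN N C by apply: inN_leq CN; rewrite /N; lia.
have {}BN : inN N B by apply: inN_leq BN; rewrite /N; lia.
have SN := inN_smat eC eB CN BN.
have BO : B \in Om N (sig C) by rewrite mem_Om BN (lead_sig ld) eqxx.
have CO : C \in Om N (sig C) by rewrite mem_Om CN eqxx.
have SO : smat b a h l \in Om N (sig C) by rewrite mem_Om SN (eq_ro_sig eC) eqxx.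
apply: (gpoly_eq (N := N) (r := sig C)) => // F t1 t2 w1 w2 e.
rewrite hornerC (@cnt_lead F (sig C) N t1 t2 b a h J l B) ?e //; rewrite /N; lia.
Qed.

Lemma smat0 b h l : smat b 0 h l = diagm l.
Proof. by apply: matP => i j; rewrite smatE diagmE mul0n. Qed.

Lemma ro_diagm l i : ro (diagm l) i = l i.
Proof. by rewrite roE msum_diagm nsum1. Qed.
Lemma co_diagm l i : co (diagm l) i = l i.
Proof. by rewrite coE msum_diagm nsum1. Qed.

Lemma gpoly_diag l C : ro (diagm l) =1 ro C -> gpoly (diagm l) C C = 1.
Proof.
move=> e; have [N CN] := inN_exists C; rewrite -(smat0 true 0).
have eC : ro (smat true 0 0 l) =1 ro C by rewrite smat0.
have eB : co (smat true 0 0 l) =1 ro C by move=> i; rewrite smat0 co_diagm -e ro_diagm.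
(* A move of 0 units is leading in any column beyond the support of C, for example N + 1. *)
apply: (@gpoly_lead true 0 (N%:Z + 1) 0) => //; split=> //; rewrite /losing /gaining; try lia.
- by apply: entP => i j; rewrite !ent_madd !ent_emx; do 2!case: ifP.
- by move=> u Ju; apply/eqP/negPn/negP => /(inNP _ _ CN) /=; lia.
- by move=> u Ju; apply/eqP/negPn/negP => /(inNP _ _ CN) /=; lia.
Qed.

Lemma nsum_eq0 t : nsum t xpredT = 0%N -> forall u, t u = 0%N.
Proof.
move=> t0 u; have := @leq_msum1 (diagm t) xpredT (u, u) isT.
by rewrite msum_diagm t0 diagmE eqxx muln1 leqn0 => /eqP.
Qed.

Section GpolySupport.
Variables (N r : nat) (N0 : (0 < N)%N).

Lemma gpoly_match A B C : A \in Om N r -> B \in Om N r -> C \in Om N r -> gpoly A B C != 0 ->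
  [/\ ro A =1 ro C, co B =1 co C & co A =1 ro B].
Proof.
move=> AO BO CO /(gpoly_neq0 N0 AO BO CO)[F [t1 [t2 [w1 w2 <- /cnt_neq0[t [w <- <-]]]]]].
split; [exact: pos_ro | exact: (fun i => esym (pos_co w1 w w2 i)) | exact: pos_coro].
Qed.

Lemma gpoly_smat_prec b h J a l B B' C C' :
  smat b a h l \in Om N r -> B' \in Om N r -> C' \in Om N r ->
  gpoly (smat b a h l) B' C' != 0 -> lead b h J a B C -> ro (smat b a h l) =1 ro C ->
  leq_sig B' B -> co B' =1 co B ->
  [/\ ro C' =1 ro C, co C' =1 co C, leq_sig C' C & C' = C -> B' = B].
Proof.
move=> SO BO CO /(gpoly_neq0 N0 SO BO CO)[F [t1 [t2 [w1 w2 <- nz]]]] ld eS le ec.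
exact: cnt_prec w1 w2 ld eS le ec nz.
Qed.

Lemma gpoly_smat_moves b h a l B C :
  smat b a h l \in Om N r -> B \in Om N r -> C \in Om N r ->
  gpoly (smat b a h l) B C != 0 -> exists t, moves b h t B C /\ nsum t xpredT = a.
Proof.
move=> SO BO CO /(gpoly_neq0 N0 SO BO CO)[F [t1 [t2 [w1 w2 <- /cnt_neq0[t [w e1 e2]]]]]].
exact: orbit_moves (wf_flag w1) (wf_flag w2) (wf_flag w) (orbit_pos _ _)
  ((posP _ w1 w).2 e1) ((posP _ w w2).2 e2).
Qed.

Lemma gpoly_diag_neq0 l B C : diagm l \in Om N r -> B \in Om N r -> C \in Om N r ->
  gpoly (diagm l) B C != 0 -> B = C.
Proof.
move=> DO BO CO; rewrite -(smat0 true 0) in DO * => /(gpoly_smat_moves DO BO CO)[t [mv /nsum_eq0 t0]].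
apply: entP => i j; have := congr1 (fun A => ent A i j) mv.
by rewrite !ent_madd !ent_rowm t0 !if_same !addn0.
Qed.

(** Only the h-th component of the middle flag is free. It lies between two given spaces at distance
    a + 1 and has a prescribed dimension, so the count is a Gaussian binomial with lower index a or
    1 according to b; both are the same geometric sum. *)
Lemma gpoly_bin b (h : int) a l1 l2 l3 (S := smat b 1 h l1) (B := smat b a h l2) (C := smat b a.+1 h l3) :
  - N%:Z <= h -> h < N%:Z ->
  S \in Om N r -> B \in Om N r -> C \in Om N r -> ro S =1 ro C -> co S =1 ro B -> co B =1 co C ->
  gpoly S B C = \sum_(i < a.+1) 'X^i.
Proof.
move=> h1 h2 SO BO CO eSC eSB eBC; apply: (gpoly_eq (N := N) (r := r)) => // F t1 t2 w1 w2 e.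
have BN : inN N B by move: BO; rewrite mem_Om => /andP[].
have ff1 := wf_flag w1; have ff2 := wf_flag w2.
have oC := (posP C w1 w2).2 e.
have [dC sC] := (orbit_smat b a.+1 h l3 ff1 ff2).1 oC.
have flagE (f : flagT F r) : is_flag f -> flagstep b 1 h (wext t1) f -> flagstep b a h f (wext t2) ->
    orbit_mat (wext t1) f S /\ orbit_mat f (wext t2) B.
  move=> ff s1 s2; have oS : orbit_mat (wext t1) f S.
    apply/orbit_smat => //; split=> // i; rewrite dC.
    by rewrite (eq_ro_msum (fun k => k <= i) eSC).
  split=> //; apply/orbit_smat => //; split=> // i.
  rewrite (orbit_codim ff1 ff oS) -(eq_ro_msum (A := trm S) (fun k => k <= i)).
    by rewrite msum_trm.
  by move=> k; rewrite ro_trm eSB.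
have orbE (f : flagT F r) : is_flag f -> orbit_mat (wext t1) f S -> orbit_mat f (wext t2) B ->
    flagstep b 1 h (wext t1) f /\ flagstep b a h f (wext t2).
  by move=> ff o1 o2; split; [have [] := (orbit_smat b 1 h l1 ff1 ff).1 o1 | have [] := (orbit_smat b a h l2 ff ff2).1 o2].
pose P := if b then wext t2 h else wext t1 h; pose H := if b then wext t1 h else wext t2 h.
pose m := if b then a else 1%N.
have PH : (P <= H)%VS /\ (\dim P + a.+1 = \dim H)%N.
  by move: sC; rewrite /P /H /flagstep; case: (b) => -[_ [? ?]].
have sE U : flagstep b 1 h (wext t1) (upd (wext t1) h U) /\ flagstep b a h (upd (wext t1) h U) (wext t2) <->
    [&& (P <= U)%VS, (U <= H)%VS & \dim U == (\dim P + m)%N].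
  move: sC PH; rewrite /flagstep /lestep /P /H /m /upd eqxx; case: (b) => -[eqC _] [_ dPH].
    split=> [[[_ [UH dH]] [_ [PU dP]]]|/and3P[PU UH /eqP dU]]; first by rewrite PU UH -dP eqxx.
    split; split; first by move=> i /negPf ->.
    - by split=> //; rewrite dU; vlia.
    - by move=> i ih; rewrite (negPf ih) eqC.
    by split.
  split=> [[[_ [UH dH]] [_ [PU dP]]]|/and3P[PU UH /eqP dU]]; first by rewrite PU UH -dH eqxx.
  split; split; first by move=> i /negPf ->.
  - by split.
  - by move=> i ih; rewrite (negPf ih) eqC.
  by split=> //; rewrite dU; vlia.
have cond : step_cond b 1 h l1 B C.
    have l23 i : l2 i = (l3 i + (i == losing b h))%N.
      by have := eBC i; rewrite !co_smat; lia.
    have mv : madd C (emx 1 (losing b h) (losing b h)) = madd B (emx 1 (gaining b h) (losing b h)).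
      apply: entP => i j; rewrite !ent_madd !ent_emx !ent_emat !ent_diagm l23.
      have gl := losing_gaining b h.
      case: (eqVneq i j) => [<-|ij].
        case: (eqVneq i (losing b h)) => [->|ix]; last by rewrite !andbF; lia.
        by rewrite gl /=; lia.
      case: (eqVneq j (losing b h)) => [ej|_]; rewrite ?andbF // ?andbT.
      have -> : (i == losing b h) = false by rewrite -ej (negPf ij).
      by case: (i == gaining b h); lia.
    apply: (@step_cond_move b 1 h (losing b h)) eSC => Q.
    by have := congr1 (fun A => msum A Q) mv; rewrite !msumD !msum_emx.
(* With Z = 0 the condition on U :&: Z is void, which brings the set into the form of
   [card_subspaces_meet]. *)
have stepE : step_meets N b h (wext t1) (wext t2) B =
    [set U : {vspace 'rV[F]_r} | [&& (P <= U)%VS, (U <= H)%VS, (U :&: 0 == P :&: 0)%VS & \dim U == (\dim P + m)%N]]%SET.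
  apply/setP => U; rewrite [RHS]inE !capv0 eqxx /=; apply/idP/idP => [UB|/sE[s1 s2]].
    have [fu oB oS] := meets_step ff1 ff2 (wext_windowed t2) BN oC cond UB.
    by apply/sE; apply: orbE.
  have fu : is_flag (upd (wext t1) h U).
    have /and3P[PU UH _] := (sE U).1 (conj s1 s2).
    have i1 : h - 1 != h by lia.
    have i2 : h + 1 != h by lia.
    have := sC; move: PU UH; rewrite /flagstep /P /H; case: (b) => PU UH -[eqC _]; apply: is_flag_upd => //.
    - by rewrite -(eqC _ i1) (subv_trans _ PU) // flag_mono //; lia.
    - by rewrite (subv_trans UH) // flag_mono //; lia.
    - by rewrite (subv_trans _ PU) // flag_mono //; lia.
    by rewrite (eqC _ i2) (subv_trans UH) // flag_mono //; lia.
  have [oS oB] := flagE _ fu s1 s2.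
  have [_] := step_mem ff1 ff2 fu (wext_windowed t2) oC oS oB.
  by rewrite /upd eqxx.
rewrite cnt_smat // e; case: pselect => [c|//]; rewrite stepE card_subspaces_meet ?sub0v //; last by case: PH.
rewrite addv0 subnn mul0n mul1r -PH.2 addKn /m; case: (b); last by rewrite qbin_1.
by rewrite qbin_pred.
Qed.
End GpolySupport.

(** * Scalars *)

(** P and s may differ wherever f is 0, so P itself may be infinite. *)
Lemma fsum_seq (T : choiceType) (R : nmodType) (P : set T) (f : T -> R) (s : seq T) :
  uniq s -> (forall p, P p -> p \notin s -> f p = 0) -> (forall p, p \in s -> ~ P p -> f p = 0) ->
  \sum_(p \in P) f p = \sum_(p <- s) f p.
Proof.
move=> us out inn.
have e := @bigfs R 0 _ T s (mem P) f us.
rewrite -[P in LHS]set_mem_set -e; last by move=> p /set_mem; apply: out.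
rewrite big_mkcond big_seq [RHS]big_seq; apply: eq_bigr => p ps.
by case: ifP => // /negP h; rewrite inn // => Pp; apply: h; apply: mem_set.
Qed.

Definition toQv (P : {poly int}) : Qv := tofrac ((map_poly intr P : {poly rat}) \Po 'X^2).

Lemma toQvD P Q : toQv (P + Q) = toQv P + toQv Q.
Proof. by rewrite /toQv rmorphD comp_polyD tofracD. Qed.
Lemma toQvM P Q : toQv (P * Q) = toQv P * toQv Q.
Proof. by rewrite /toQv rmorphM comp_polyM tofracM. Qed.
Lemma toQv0 : toQv 0 = 0.
Proof. by rewrite /toQv rmorph0 comp_poly0 tofrac0. Qed.
Lemma toQv1 : toQv 1 = 1.
Proof. by rewrite /toQv rmorph1 comp_polyC tofrac1. Qed.
Lemma toQvXn i : toQv 'X^i = v ^+ (2 * i).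
Proof. by rewrite /toQv rmorphXn /= map_polyX rmorphXn /= comp_polyX tofracXn tofracXn exprM. Qed.

Lemma toQv_sum I (s : seq I) (P : I -> {poly int}) :
  toQv (\sum_(i <- s) P i) = \sum_(i <- s) toQv (P i).
Proof. exact: (big_morph toQv toQvD toQv0). Qed.

Lemma gQE A B C : gQ A B C = toQv (gpoly A B C).
Proof. by []. Qed.

Lemma v_neq0 : v != 0.
Proof. by rewrite /v tofrac_eq0 polyX_eq0. Qed.

Lemma vX_inj (m n : nat) : v ^+ m = v ^+ n -> m = n.
Proof.
rewrite -!tofracXn => /eqP; rewrite tofrac_eq => /eqP /(congr1 (fun p : {poly rat} => size p)).
by rewrite !size_polyXn => -[].
Qed.

Lemma vz_eq1 (z : int) : v ^ z = 1 -> z = 0.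
Proof.
case: z => n; first by rewrite -exprnP -(expr0 v) => /vX_inj ->.
rewrite NegzE => h; have := congr1 (fun x => x^-1) h; rewrite /= -exprnN invrK invr1 -(expr0 v).
by move/vX_inj.
Qed.

Lemma vzD (a b : int) : v ^ (a + b) = v ^ a * v ^ b.
Proof. by rewrite expfzDr ?v_neq0. Qed.

Lemma vz_neq0 (z : int) : v ^ z != 0.
Proof. by rewrite expfz_neq0 // v_neq0. Qed.

Lemma laurent0 : laurent 0.
Proof. by exists 0, 0%N; rewrite rmorph0 tofrac0 mul0r. Qed.

Lemma laurentM x y : laurent x -> laurent y -> laurent (x * y).
Proof.
move=> [p [k ->]] [p' [k' ->]]; exists (p * p'), (k + k')%N.
by rewrite rmorphM tofracM exprD invfM mulrACA.
Qed.

Lemma laurentD x y : laurent x -> laurent y -> laurent (x + y).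
Proof.
move=> [p [k ->]] [p' [k' ->]]; exists (p * 'X^k' + p' * 'X^k), (k + k')%N.
rewrite rmorphD !rmorphM /= !map_polyXn tofracD !tofracM !tofracXn.
by rewrite addf_div ?expf_neq0 ?v_neq0 // exprD.
Qed.

Lemma laurent_tofrac (p : {poly int}) : laurent (tofrac (map_poly intr p)).
Proof. by exists p, 0%N; rewrite expr0 divr1. Qed.

Lemma laurent1 : laurent 1.
Proof. by have := laurent_tofrac 1; rewrite rmorph1 tofrac1. Qed.

Lemma laurentN x : laurent x -> laurent (- x).
Proof. by move=> [p [k ->]]; exists (- p), k; rewrite rmorphN tofracN mulNr. Qed.

Lemma laurent_vz (z : int) : laurent (v ^ z).
Proof.
case: z => n; first by exists 'X^n, 0%N; rewrite map_polyXn tofracXn expr0 divr1.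
by exists 1, n.+1; rewrite rmorph1 tofrac1 NegzE -exprnN mul1r.
Qed.

Lemma laurent_sum I (s : seq I) (P : pred I) (f : I -> Qv) :
  (forall i, P i -> laurent (f i)) -> laurent (\sum_(i <- s | P i) f i).
Proof.
by move=> H; apply: (big_ind laurent) => //; [exact: laurent0 | exact: laurentD].
Qed.

Lemma laurent_gQ A B C : laurent (gQ A B C).
Proof.
rewrite /gQ; suff -> : (map_poly intr (gpoly A B C) \Po 'X^2) =
    map_poly intr (gpoly A B C \Po 'X^2) :> {poly rat} by exact: laurent_tofrac.
by rewrite map_comp_poly map_polyXn.
Qed.

(** * The product of formal sums *)

Definition sconst (A B C : mat) : Qv := v ^ ((dA C)%:Z - (dA A)%:Z - (dA B)%:Z) * gQ A B C.

Lemma laurent_sconst A B C : laurent (sconst A B C).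
Proof. by apply: laurentM; [exact: laurent_vz | exact: laurent_gQ]. Qed.

Lemma sconst_neq0 A B C : sconst A B C != 0 -> gpoly A B C != 0.
Proof. by apply: contra_neq => e; rewrite /sconst gQE e toQv0 mulr0. Qed.

(** The exponent d_D cancels between the two factors on each side, leaving the common power v^(d_E -
    d_A - d_B - d_C) and associativity of [gpoly]. *)
Lemma sconst_assoc N r A B C E : (0 < N)%N ->
  A \in Om N r -> B \in Om N r -> C \in Om N r -> E \in Om N r ->
  \sum_(D <- Om N r) sconst A B D * sconst D C E = \sum_(D <- Om N r) sconst B C D * sconst A D E.
Proof.
move=> N0 AO BO CO EO.
pose z := (dA E)%:Z - (dA A)%:Z - (dA B)%:Z - (dA C)%:Z.
transitivity (v ^ z * toQv (\sum_(D <- Om N r) gpoly A B D * gpoly D C E)).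
  rewrite toQv_sum mulr_sumr; apply: eq_bigr => D _; rewrite toQvM /sconst !gQE mulrACA -vzD.
  by congr (v ^ _ * _); rewrite /z; lia.
rewrite (gpoly_assoc N0) // toQv_sum mulr_sumr; apply: eq_bigr => D _.
rewrite toQvM /sconst !gQE mulrACA -vzD.
by congr (v ^ _ * _); rewrite /z; lia.
Qed.

(** For a right factor y, the target C bounds the columns of the matrices that contribute; bounding
    their rows as well is what confines the left factor. *)
Definition locN (N : nat) (y : elt) : Prop :=
  forall B, y B != 0 -> (forall p, B p != 0%N -> (absz p.2 <= N)%N) -> inN N B.

Definition loc (y : elt) : Prop := exists M, forall N, (M <= N)%N -> locN N y.

Lemma co_bound N (B C : mat) : co B =1 co C -> (forall p, C p != 0%N -> (absz p.2 <= N)%N) ->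
  forall p, B p != 0%N -> (absz p.2 <= N)%N.
Proof.
move=> e CN [i j] Bij; have : co B j != 0%N.
  by have := @leq_msum1 B (fun p => p.2 == j) (i, j); rewrite eqxx coE => /(_ isT); case: (B _) Bij; lia.
by rewrite e coE => /msum_neq0 [p [/eqP <- /CN]].
Qed.

Lemma ro_bound N (B C : mat) : ro B =1 ro C -> (forall p, C p != 0%N -> (absz p.1 <= N)%N) ->
  forall p, B p != 0%N -> (absz p.1 <= N)%N.
Proof.
move=> e CN [i j] Bij; have : ro B i != 0%N.
  by have := @leq_msum1 B (fun p => p.1 == i) (i, j); rewrite eqxx roE => /(_ isT); case: (B _) Bij; lia.
by rewrite e roE => /msum_neq0 [p [/eqP <- /CN]].
Qed.

Lemma coro_bound N (A B : mat) : co A =1 ro B -> (forall p, B p != 0%N -> (absz p.1 <= N)%N) ->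
  forall p, A p != 0%N -> (absz p.2 <= N)%N.
Proof.
move=> e BN [i j] Aij; have eB : ro (trm A) =1 ro B by move=> k; rewrite ro_trm.
by apply: (ro_bound eB BN (p := (j, i))); rewrite trmE.
Qed.

Lemma inN_of_bounds N (A : mat) : (forall p, A p != 0%N -> (absz p.1 <= N)%N) ->
  (forall p, A p != 0%N -> (absz p.2 <= N)%N) -> inN N A.
Proof. by move=> a b; apply/inNP => p pA; rewrite a ?b. Qed.

(** The columns of B are those of C, [locN] bounds its rows, and these are the columns of A, so all
    nonzero terms come from the window. Conversely, pairs in the window with mismatched row or
    column sums have [gpoly] equal to 0. *)
Lemma emulE N r (x y : elt) C : (0 < N)%N -> C \in Om N r -> locN N y ->
  emul x y C = \sum_(A <- Om N r) \sum_(B <- Om N r) x A * y B * sconst A B C.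
Proof.
move=> N0 CO yN; have [CN /eqP sC] := andP (etrans (esym (mem_Om N r C)) CO).
rewrite /emul (@fsum_seq _ _ _ _ [seq (A, B) | A <- Om N r, B <- Om N r]).
- by rewrite big_allpairs.
- by rewrite allpairs_uniq ?Om_uniq // => -[a b] [c d] _ _ [-> ->].
- move=> [A B] /= [eA [eB eAB]] out.
  have [y0|y0] := eqVneq (y B) 0; first by rewrite y0 mulr0 mul0r.
  have BN : inN N B.
    by apply: yN => //; apply: (co_bound eB) => p /(inNP _ _ CN)[].
  have AN : inN N A.
    apply: inN_of_bounds; first by apply: (ro_bound eA) => p /(inNP _ _ CN)[].
    by apply: (coro_bound eAB) => p /(inNP _ _ BN)[].
  case/negP: out; apply/allpairsP; exists (A, B); split=> //; rewrite mem_Om ?AN ?BN /=.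
    by rewrite (eq_ro_sig eA) sC.
  by rewrite (eq_co_sig eB) sC.
move=> p /allpairsP[[A B] /= [AO BO ->]] /= no.
suff e : gpoly A B C = 0 by rewrite gQE e toQv0 !mulr0.
apply/eqP/negPn/negP => nz; have [e1 e2 e3] := gpoly_match N0 AO BO CO nz.
by apply: no.
Qed.

Lemma locN_emul N x y : locN N x -> locN N y -> locN N (emul x y).
Proof.
move=> xN yN C nz CN.
have [p [[eA [eB eAB]] [x0 y0]]] : exists p : mat * mat,
    (ro p.1 =1 ro C /\ co p.2 =1 co C /\ co p.1 =1 ro p.2) /\ x p.1 != 0 /\ y p.2 != 0.
  have [//|no] := pselect (exists p : mat * mat,
    (ro p.1 =1 ro C /\ co p.2 =1 co C /\ co p.1 =1 ro p.2) /\ x p.1 != 0 /\ y p.2 != 0).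
  case/eqP: nz; apply: fsbig1 => p Pp; have [->|x0] := eqVneq (x p.1) 0; first by rewrite !mul0r.
  have [->|y0] := eqVneq (y p.2) 0; first by rewrite mulr0 mul0r.
  exfalso; exact: no (ex_intro _ p (conj Pp (conj x0 y0))).
have BN : inN N p.2 by apply: yN => //; apply: (co_bound eB).
have AN : inN N p.1 by apply: xN => //; apply: (coro_bound eAB) => q /(inNP _ _ BN)[].
apply: inN_of_bounds => //; apply: (@ro_bound N C p.1) => [i|q /(inNP _ _ AN)[]//].
by rewrite eA.
Qed.

Lemma loc_emul x y : loc x -> loc y -> loc (emul x y).
Proof.
move=> [M xM] [M' yM]; exists (maxn M M') => N MN.
by apply: locN_emul; [apply: xM | apply: yM]; lia.
Qed.

Lemma sum_rot (R : nmodType) (T : Type) (s : seq T) (f : T -> T -> T -> R) :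
  \sum_(c <- s) \sum_(a <- s) \sum_(b <- s) f c a b = \sum_(a <- s) \sum_(b <- s) \sum_(c <- s) f c a b.
Proof. by rewrite exchange_big; apply: eq_bigr => a _; rewrite exchange_big. Qed.

Lemma emulA x y z : loc x -> loc y -> loc z -> emul (emul x y) z = emul x (emul y z).
Proof.
move=> [M1 xM] [M2 yM] [M3 zM]; apply: funext => E; have [M4 EM] := inN_exists E.
pose N := (M1 + M2 + M3 + M4).+1; pose r := sig E; have N0 : (0 < N)%N by [].
have xN : locN N x by apply: xM; rewrite /N; lia.
have yN : locN N y by apply: yM; rewrite /N; lia.
have zN : locN N z by apply: zM; rewrite /N; lia.
have EO : E \in Om N r by rewrite mem_Om eqxx andbT; apply: inN_leq EM; rewrite /N; lia.
rewrite (emulE (emul x y) N0 EO zN) (emulE x N0 EO (locN_emul yN zN)).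
transitivity (\sum_(A <- Om N r) \sum_(B <- Om N r) \sum_(C <- Om N r)
    x A * y B * z C * \sum_(D <- Om N r) sconst A B D * sconst D C E).
  rewrite exchange_big /=.
  transitivity (\sum_(C <- Om N r) \sum_(D <- Om N r) \sum_(A <- Om N r) \sum_(B <- Om N r)
     x A * y B * z C * (sconst A B D * sconst D C E)).
    apply: eq_bigr => C _; rewrite big_seq [RHS]big_seq; apply: eq_bigr => D DO.
    rewrite (emulE x N0 DO yN) !mulr_suml; apply: eq_bigr => A _.
    by rewrite !mulr_suml; apply: eq_bigr => B _; ring.
  rewrite (eq_bigr _ (fun C _ => sum_rot (Om N r)
    (fun D A B => x A * y B * z C * (sconst A B D * sconst D C E)))).
  rewrite sum_rot; apply: eq_bigr => A _; apply: eq_bigr => B _; apply: eq_bigr => C _.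
  by rewrite mulr_sumr.
rewrite big_seq [RHS]big_seq; apply: eq_bigr => A AO.
transitivity (\sum_(B <- Om N r) \sum_(C <- Om N r)
    x A * y B * z C * \sum_(D <- Om N r) sconst B C D * sconst A D E).
  rewrite big_seq [RHS]big_seq; apply: eq_bigr => B BO; rewrite big_seq [RHS]big_seq.
  by apply: eq_bigr => C CO; rewrite (sconst_assoc N0).
transitivity (\sum_(D <- Om N r) \sum_(B <- Om N r) \sum_(C <- Om N r)
    x A * y B * z C * (sconst B C D * sconst A D E)).
  rewrite sum_rot; apply: eq_bigr => B _; apply: eq_bigr => C _; exact: mulr_sumr.
rewrite big_seq [RHS]big_seq; apply: eq_bigr => D DO.
rewrite (emulE y N0 DO zN) mulr_sumr mulr_suml; apply: eq_bigr => B _.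
by rewrite mulr_sumr mulr_suml; apply: eq_bigr => C _; ring.
Qed.

Lemma emul_single N r (x y : elt) A B C : (0 < N)%N -> locN N y ->
  A \in Om N r -> B \in Om N r -> C \in Om N r ->
  (forall A' B', A' \in Om N r -> B' \in Om N r -> x A' != 0 -> y B' != 0 ->
     sconst A' B' C != 0 -> A' = A /\ B' = B) ->
  emul x y C = x A * y B * sconst A B C.
Proof.
move=> N0 yN AO BO CO H; rewrite (emulE x N0 CO yN).
have z A' B' : A' \in Om N r -> B' \in Om N r -> (A' == A) && (B' == B) = false ->
    x A' * y B' * sconst A' B' C = 0.
  move=> AO' BO' ne; have [->|x0] := eqVneq (x A') 0; first by rewrite !mul0r.
  have [->|y0] := eqVneq (y B') 0; first by rewrite mulr0 mul0r.
  have [->|s0] := eqVneq (sconst A' B' C) 0; first by rewrite mulr0.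
  by have [e1 e2] := H _ _ AO' BO' x0 y0 s0; rewrite e1 e2 !eqxx in ne.
rewrite (bigD1_seq A) ?Om_uniq //= [X in _ + X]big_seq_cond [X in _ + X]big1 ?addr0; last first.
  move=> A' /andP[AO' /negPf AA]; rewrite big_seq big1 // => B' BO'; apply: z => //.
  by rewrite AA.
rewrite (bigD1_seq B) ?Om_uniq //= big_seq_cond big1 ?addr0 // => B' /andP[BO' /negPf BB].
by apply: z => //; rewrite BB andbF.
Qed.

Lemma emul_neq0 N r (x y : elt) C : (0 < N)%N -> locN N y -> C \in Om N r -> emul x y C != 0 ->
  exists A B, [/\ A \in Om N r, B \in Om N r & [/\ x A != 0, y B != 0 & sconst A B C != 0]].
Proof.
move=> N0 yN CO; rewrite (emulE x N0 CO yN) => nz.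
have [//|no] := pselect (exists A B, [/\ A \in Om N r, B \in Om N r &
  [/\ x A != 0, y B != 0 & sconst A B C != 0]]).
case/eqP: nz; rewrite big_seq big1 // => A AO; rewrite big_seq big1 // => B BO.
have [->|x0] := eqVneq (x A) 0; first by rewrite !mul0r.
have [->|y0] := eqVneq (y B) 0; first by rewrite mulr0 mul0r.
have [->|s0] := eqVneq (sconst A B C) 0; first by rewrite mulr0.
exfalso; apply: no; exists A, B; split=> //; split=> //.
Qed.

(** * The elements A(j, r) and the identity *)

Lemma sig_madd_diagm A l : sig (madd A (diagm l)) = (sig A + sigl l)%N.
Proof. by rewrite !sigE msumD msum_diagm. Qed.

Lemma madd_diagm_inj A l l' : madd A (diagm l) = madd A (diagm l') -> l = l'.
Proof.
move=> e; apply/fsfunP => i; have := congr1 (fun X => ent X i i) e.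
by rewrite !ent_madd !ent_diagm eqxx => /addnI.
Qed.

Lemma Aj_in A j r l : Aj A j r (madd A (diagm l)) =
  if sig (madd A (diagm l)) == r then v ^ dotv l j else 0.
Proof.
rewrite sig_madd_diagm /Aj; case: eqP => sr.
  rewrite (@fsum_seq _ _ _ _ [:: l]) //.
  - by rewrite big_seq1 eqxx mulr1.
  - move=> l' _; rewrite inE => l'l; case: eqP => [h|]; last by rewrite mulr0.
    by rewrite (madd_diagm_inj h) eqxx in l'l.
  by move=> l'; rewrite inE => /eqP ->.
apply: fsbig1 => l' /= sl'; case: eqP => [h|]; last by rewrite mulr0.
by rewrite (madd_diagm_inj h) sl' in sr.
Qed.

Lemma Aj_neq0 A j r C : Aj A j r C != 0 -> exists l, C = madd A (diagm l) /\ sig C = r.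
Proof.
move=> nz; have [[l e]|no] := pselect (exists l, C = madd A (diagm l)).
  by exists l; move: nz; rewrite e Aj_in; case: (sig _ =P r) => // _; rewrite eqxx.
case/eqP: nz; apply: fsbig1 => l _; case: eqP => [e|]; last by rewrite mulr0.
by case: no; exists l.
Qed.

Definition step_elt b m h r : elt := Aj (emat b m h) zvec0 r.

Lemma dotv0 l : dotv l zvec0 = 0.
Proof. by rewrite /dotv big1 // => i _; rewrite fsfunE ?if_same ?inE mulr0. Qed.

Lemma step_elt_in b m h r l : step_elt b m h r (smat b m h l) = (sig (smat b m h l) == r)%:R.
Proof. by rewrite /step_elt /smat Aj_in dotv0 expr0z; case: eqP. Qed.

Lemma step_elt_neq0 b m h r C : step_elt b m h r C != 0 -> exists l, C = smat b m h l /\ sig C = r.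
Proof. exact: Aj_neq0. Qed.

Lemma laurent_step_elt b m h r C : laurent (step_elt b m h r C).
Proof.
have [->|/step_elt_neq0[l [-> s]]] := eqVneq (step_elt b m h r C) 0; first exact: laurent0.
by rewrite step_elt_in -s eqxx; exact: laurent1.
Qed.

Lemma mat0_emat b h : mat0 = emat b 0 h.
Proof.
apply: entP => i j; rewrite ent_emat if_same /ent fsfunE //.
Qed.

Lemma eone_step_elt b h r : eone r = step_elt b 0 h r.
Proof. by rewrite /eone /step_elt (mat0_emat b h). Qed.

Lemma loc_Aj b m h j r : loc (Aj (emat b m h) j r).
Proof.
exists (absz h).+1 => N hN B /Aj_neq0[l [-> _]] cN; apply/inNP => -[i k] nz.
have kN := cN _ nz; split=> //=; move: nz kN; rewrite -/(ent _ i k) ent_madd ent_emat ent_diagm.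
case: (eqVneq i k) => [->//|_].
by case: (eqVneq i (gaining b h)) => [-> _ _|_] /=; [rewrite /gaining; case: (b); lia | ].
Qed.

Definition nice r (x : elt) : Prop := loc x /\ (forall A, x A != 0 -> sig A = r).

Lemma nice_step_elt b m h r : nice r (step_elt b m h r).
Proof. by split; [exact: loc_Aj | move=> A /step_elt_neq0[l []]]. Qed.

Lemma nice_emul r x y : nice r x -> nice r y -> nice r (emul x y).
Proof.
move=> [lx sx] [ly sy]; split; first exact: loc_emul.
move=> C nz; have [M yM] := ly; have [M' CM] := inN_exists C.
have CO : C \in Om (M + M').+1 (sig C) by rewrite mem_Om eqxx andbT; apply: inN_leq CM; lia.
have yN : locN (M + M').+1 y by apply: yM; lia.
have [A [B [_ BO [_ /sy <- _]]]] := emul_neq0 (ltn0Sn _) yN CO nz.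
by move: BO; rewrite mem_Om => /andP[_ /eqP].
Qed.

Lemma nice_eone r : nice r (eone r).
Proof. by rewrite (eone_step_elt true 0); exact: nice_step_elt. Qed.

Lemma nvec_ro C : exists l : nvec, l =1 ro C.
Proof.
pose l : nvec := [fsfun i in [fset p.1 | p in finsupp C]%fset => ro C i | 0%N].
exists l => i; rewrite fsfunE; case: imfsetP => // no; rewrite roE msum_eq0 // => p /eqP pi.
apply/eqP; rewrite -[_ == _]negbK -mem_finsupp; apply/negP => pC.
by apply: no; exists p.
Qed.

Lemma nvec_co C : exists l : nvec, l =1 co C.
Proof. by have [l e] := nvec_ro (trm C); exists l => i; rewrite e ro_trm. Qed.

Lemma window_of (C : mat) (m : nat) : exists N, [/\ (0 < N)%N, (m <= N)%N & C \in Om N (sig C)].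
Proof.
have [M CM] := inN_exists C; exists (m + M).+1; split=> //; first by lia.
by rewrite mem_Om eqxx andbT; apply: inN_leq CM; lia.
Qed.

Lemma diagm_Om N r (l : nvec) C : l =1 ro C -> C \in Om N r -> diagm l \in Om N r.
Proof.
move=> e; rewrite !mem_Om => /andP[CN /eqP <-]; apply/andP; split; last first.
  by apply/eqP/eq_ro_sig => i; rewrite ro_diagm e.
apply: (@inN_rows_cols N C (trm C)) => //.
- by move=> i; rewrite ro_diagm e.
- by move=> i; rewrite co_diagm co_trm e.
by apply/inNP => -[i j]; rewrite trmE => /(inNP _ _ CN) /= [].
Qed.

Lemma emul_diag (x y : elt) C (l : nvec) : (forall A, x A != 0 -> exists l, A = diagm l) ->
  l =1 ro C -> emul x y C = x (diagm l) * y C.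
Proof.
move=> xd e; have [N [N0 _ CO]] := window_of C 0.
have DO := diagm_Om e CO.
have eD : ro (diagm l) =1 ro C by move=> i; rewrite ro_diagm e.
have [CN _] := andP (etrans (esym (mem_Om N _ C)) CO).
rewrite /emul (@fsum_seq _ _ _ _ [:: (diagm l, C)]) //.
- by rewrite big_seq1 /= gQE gpoly_diag // toQv1 dA_diagm mulr1 (_ : _ - _ - _ = 0) ?expr0z ?mulr1 //; lia.
- move=> [A B] /= [e1 [e2 e3]] out; have [->|/xd[l' eA]] := eqVneq (x A) 0; first by rewrite !mul0r.
  have eAl : A = diagm l.
    by rewrite eA; congr diagm; apply/fsfunP => i; rewrite -ro_diagm -eA e1 -e.
  have [/eqP g0|g0] := boolP (gQ A B C == 0); first by rewrite g0 !mulr0.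
  have rB : ro B =1 ro C by move=> i; rewrite -e3 eAl co_diagm e.
  have BO : B \in Om N (sig C).
    by rewrite mem_Om (inN_rows_cols rB e2 CN CN) (eq_ro_sig rB) eqxx.
  case/negP: out; rewrite inE eAl xpair_eqE eqxx /=; apply/eqP.
  apply: (gpoly_diag_neq0 N0 DO BO CO); rewrite -eAl; apply: contraNneq g0 => g0.
  by rewrite gQE g0 toQv0.
move=> p; rewrite inE => /eqP -> /=; case; split; [exact: eD | split => // i].
by rewrite co_diagm e.
Qed.

Lemma eone_diag r A : eone r A != 0 -> exists l, A = diagm l.
Proof. by rewrite (eone_step_elt true 0) => /step_elt_neq0[l []]; rewrite smat0; exists l. Qed.

Lemma eoneE r l : eone r (diagm l) = (sigl l == r)%:R.
Proof. by rewrite (eone_step_elt true 0) -(smat0 true 0) step_elt_in /smat sig_madd_diagm sigE msum_emx mul0n. Qed.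

Lemma emul1 r y : nice r y -> emul (eone r) y = y.
Proof.
move=> [ly sy]; apply: funext => C; have [l e] := nvec_ro C.
rewrite (emul_diag _ (@eone_diag r) e) eoneE.
have -> : sigl l = sig C.
  by rewrite (@eq_ro_sig C (diagm l)) ?sigE ?msum_diagm // => i; rewrite ro_diagm e.
have [->|/sy ->] := eqVneq (y C) 0; first by rewrite mulr0.
by rewrite eqxx mul1r.
Qed.

Lemma emul_escalr c x y : emul x (escal c y) = escal c (emul x y).
Proof.
apply: funext => C; rewrite /emul /escal mulr_fsumr; apply: eq_fsbigr => p _.
by move: (v ^ _ * _) => k; ring.
Qed.

(** * Divided powers of the generators *)

Lemma vsub_neq0 k : (0 < k)%N -> v ^+ k - v ^- k != 0.
Proof.
move=> k0; rewrite subr_eq0; apply/eqP => e.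
have : v ^ (k%:Z + k%:Z) = 1.
  by rewrite vzD -exprnP {1}e mulVf // expf_neq0 // v_neq0.
by move/vz_eq1; lia.
Qed.

Lemma qint_neq0 m : (0 < m)%N -> qint m != 0.
Proof.
move=> m0; rewrite /qint mulf_neq0 ?vsub_neq0 // invr_neq0 //.
by have := vsub_neq0 (ltn0Sn 0); rewrite expr1.
Qed.

Lemma qfactS m : qfact m.+1 = qint m.+1 * qfact m.
Proof. by rewrite /qfact big_nat_recr //= mulrC. Qed.

Lemma qfact_neq0 m : qfact m != 0.
Proof.
elim: m => [|m IH]; first by rewrite /qfact big_geq // oner_eq0.
by rewrite qfactS mulf_neq0 ?qint_neq0.
Qed.

Lemma geometric_qint (K : fieldType) (x : K) m : x != 0 -> x - x^-1 != 0 ->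
  x ^ (- m%:Z) * (\sum_(i < m.+1) (x ^+ 2) ^+ i) = (x ^+ m.+1 - x ^- m.+1) / (x - x^-1).
Proof.
move=> x0 x1; apply: (mulIf x1); rewrite mulfVK //.
have := subrX1 (x ^+ 2) m.+1; set S := \sum_(i < _) _ => hS.
have a0 : x ^+ m.+1 != 0 by rewrite expf_neq0.
have ex : x ^- m = x / x ^+ m.+1 by rewrite exprS invfM mulVKf.
rewrite -exprnN ex; rewrite exprAC in hS.
move: (x ^+ m.+1) a0 hS {ex} => a a0 hS.
apply: (@mulfI _ a) => //.
transitivity ((x ^+ 2 - 1) * S); first by field; rewrite x0 a0.
by rewrite -hS; field.
Qed.

Lemma toQv_qint m : v ^ (- m%:Z) * toQv (\sum_(i < m.+1) 'X^i) = qint m.+1.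
Proof.
have v1 : v - v^-1 != 0.
  have := qint_neq0 (ltn0Sn 0); rewrite /qint expr1; apply: contra_neq => ->.
  by rewrite mul0r.
rewrite toQv_sum; under eq_bigr do rewrite toQvXn exprM.
exact: geometric_qint v_neq0 v1.
Qed.

Lemma nsum_single (t : nvec) (k : int) : (forall u, u != k -> t u = 0%N) -> nsum t xpredT = t k.
Proof.
move=> t0; rewrite -nsum1 /nsum [RHS]big_mkcond; apply: eq_bigr => u _.
by case: eqVneq => // /t0.
Qed.

Lemma smat_ro_inj b m h l l' : ro (smat b m h l) =1 ro (smat b m h l') -> l = l'.
Proof. by move=> e; apply/fsfunP => i; have := e i; rewrite !ro_smat => /addnI. Qed.

(** The losing row of a step matrix has nothing but its diagonal entry, so the unit can only leave
    in that column. *)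
Lemma moves_smat b (h : int) m l C t : moves b h t (smat b m h l) C -> nsum t xpredT = 1%N ->
  exists l3, C = smat b m.+1 h l3.
Proof.
move=> mv t1; have gl := losing_gaining b h.
have eC i j : (ent C i j + (if i == losing b h then t j else 0) = (if (i == gaining b h) && (j == losing b h) then m else 0) +
   (if i == j then l i else 0) + (if i == gaining b h then t j else 0))%N.
  by have := congr1 (fun A => ent A i j) mv; rewrite !ent_madd !ent_rowm ent_emat ent_diagm.
have t0 u : u != losing b h -> t u = 0%N.
  move=> ux; have := eC (losing b h) u; rewrite eqxx gl /= eq_sym (negPf ux); lia.
have tx : t (losing b h) = 1%N by rewrite -t1 (nsum_single t0).
pose l3 : nvec := [fsfun i in [fset p.1 | p in finsupp C]%fset => ent C i i | 0%N].
have l3E i : l3 i = ent C i i.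
  rewrite fsfunE; case: imfsetP => // no; apply/esym/eqP; rewrite -[_ == _]negbK -mem_finsupp.
  by apply/negP => pC; apply: no; exists (i, i).
exists l3; apply: entP => i j; rewrite ent_madd ent_emat ent_diagm l3E.
case: (eqVneq i j) => [<-|ij].
  case: (eqVneq i (gaining b h)) => [->|ig] //=.
  by rewrite [gaining b h == _]eq_sym gl.
have := eC i j; rewrite (negPf ij).
case: (eqVneq j (losing b h)) => [ej|jx]; last by rewrite t0 // !andbF; do 2!case: ifP; lia.
have -> : (i == losing b h) = false by rewrite -ej (negPf ij).
by rewrite ej tx !andbT; case: ifP; lia.
Qed.

(** Each C comes from a single pair of step matrices, whose coefficient is the geometric sum of
    [gpoly_bin]; the difference of the exponents d is -m, which makes that sum the symmetric quantum
    integer. *)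
Lemma emul_step_elt1 b m h r : emul (step_elt b 1 h r) (step_elt b m h r) = escal (qint m.+1) (step_elt b m.+1 h r).
Proof.
apply: funext => C; have [M yM] := (nice_step_elt b m h r).1.
have [N [N0 MN CO]] := window_of C (M + absz h).+1.
have yN : locN N (step_elt b m h r) by apply: yM; lia.
have gl := losing_gaining b h.
have [[l3 [eC sC]]|no] := pselect (exists l3, C = smat b m.+1 h l3 /\ sig C = r); last first.
  rewrite /escal; have [->|/step_elt_neq0 //] := eqVneq (step_elt b m.+1 h r C) 0.
  rewrite mulr0; apply/eqP/negPn/negP => nz.
  have [A [B [AO BO [/step_elt_neq0[l [eA _]] /step_elt_neq0[l' [eB sB]] /sconst_neq0]]]] := emul_neq0 N0 yN CO nz.
  rewrite eA in AO *; rewrite eB => g0; rewrite eB in BO.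
  have [t [mv t1]] := gpoly_smat_moves N0 AO BO CO g0.
  have [l3 e3] := moves_smat mv t1; apply: no; exists l3; split=> //.
  by rewrite -sB eB; move: BO; rewrite mem_Om => /andP[_ /eqP].
rewrite sC in CO.
have [l2 l2E] : exists l2 : nvec, forall i, l2 i = (l3 i + (i == losing b h))%N.
  have [l2 e2] := nvec_ro (madd (diagm l3) (emx 1 (losing b h) 0)); exists l2 => i.
  by rewrite e2 roE msumD msum_diagm msum_emx /= nsum1 mul1n [losing b h == i]eq_sym.
have [l1 l1E] : exists l1 : nvec, forall i, l1 i = (l3 i + m * (i == gaining b h))%N.
  have [l1 e1] := nvec_ro (madd (diagm l3) (emx m (gaining b h) 0)); exists l1 => i.
  by rewrite e1 roE msumD msum_diagm msum_emx /= nsum1 [gaining b h == i]eq_sym.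
pose S := smat b 1 h l1; pose B := smat b m h l2.
have eSC : ro S =1 ro C by move=> i; rewrite eC !ro_smat l1E; lia.
have eSB : co S =1 ro B by move=> i; rewrite co_smat ro_smat l1E l2E; lia.
have eBC : co B =1 co C by move=> i; rewrite eC !co_smat l2E; lia.
have [CN _] := andP (etrans (esym (mem_Om N r C)) CO).
have BN : inN N B.
  apply: yN; last by apply: (co_bound eBC) => p /(inNP _ _ CN)[].
  by rewrite step_elt_in -/B (eq_co_sig eBC) sC eqxx oner_eq0.
have SN := inN_smat eSC eSB CN BN.
have BO : B \in Om N r by rewrite mem_Om BN (eq_co_sig eBC) sC eqxx.
have SO : S \in Om N r by rewrite mem_Om SN (eq_ro_sig eSC) sC eqxx.
rewrite (emul_single N0 yN SO BO CO); last first.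
  move=> A' B' AO' BO' /step_elt_neq0[l [eA _]] /step_elt_neq0[l' [eB _]] /sconst_neq0 g0.
  have [e1 e2 e3] := gpoly_match N0 AO' BO' CO g0.
  have eAS : A' = S by rewrite eA; congr smat; apply: (@smat_ro_inj b 1 h) => i; rewrite -eA e1 -eSC.
  split=> //; rewrite eB; congr smat; apply: (@smat_ro_inj b m h) => i.
  by rewrite -eB -e3 eAS eSB.
have one (m' : nat) l : smat b m' h l \in Om N r -> step_elt b m' h r (smat b m' h l) = 1.
  by rewrite mem_Om => /andP[_ s]; rewrite step_elt_in s.
have eX : step_elt b m.+1 h r C = 1 by rewrite eC one -?eC.
rewrite /escal eX (one 1%N l1 SO) (one m l2 BO) !mul1r mulr1 /sconst gQE.
have hp : gpoly S B C = \sum_(i < m.+1) 'X^i.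
  rewrite eC; apply: (@gpoly_bin N r N0) => //; rewrite -?eC //; try lia.
rewrite hp.
rewrite -toQv_qint; congr (v ^ _ * _).
rewrite eC /S /B !dA_smat l1E l2E eqxx [gaining b h == _]eq_sym gl; lia.
Qed.

Lemma epow_step_elt b m h r : epow r (step_elt b 1 h r) m = escal (qfact m) (step_elt b m h r).
Proof.
elim: m => [|m IH].
  rewrite /epow /= (eone_step_elt b h) /escal; apply: funext => C.
  by rewrite /qfact big_geq // mul1r.
rewrite /epow iterS -/(epow _ _ _) IH emul_escalr emul_step_elt1 qfactS; apply: funext => C.
by rewrite /escal mulrA [qfact m * _]mulrC.
Qed.

Lemma dpow_step_elt b m h r : dpow r (step_elt b 1 h r) m = step_elt b m h r.
Proof.
rewrite /dpow epow_step_elt; apply: funext => C.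
by rewrite /escal mulrA mulVf ?mul1r // qfact_neq0.
Qed.

Lemma Emat_emat b h : Emat (gaining b h) (losing b h) = emat b 1 h.
Proof.
apply: entP => i j; rewrite ent_emat /ent fsfunE inE xpair_eqE.
by case: ifP.
Qed.

Lemma dpow_ee r i m : dpow r (ee r i) m = step_elt true m i r.
Proof. by rewrite -(dpow_step_elt true m i r) /step_elt -Emat_emat. Qed.

Lemma dpow_ff r i m : dpow r (ff r i) m = step_elt false m i r.
Proof. by rewrite -(dpow_step_elt false m i r) /step_elt -Emat_emat. Qed.

(* [tri r B y]: among the matrices with the row sums of B, the formal sum y has
   leading term [B] with coefficient 1 and Laurent coefficients. *)
Definition tri (r : nat) (B : mat) (y : elt) : Prop :=
  [/\ nice r y, sig B = r, y B = 1,
      (forall B', ro B' =1 ro B -> y B' != 0 -> co B' =1 co B /\ leq_sig B' B) &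
      (forall B', ro B' =1 ro B -> laurent (y B'))].

(** The row sums of C' single out one step matrix S as left factor, and the column sums of S are the
    row sums of B'; so what [tri] says about y covers every pair that contributes. The coefficient
    at C is 1 by [gpoly_lead], with exponent 0 by [dA_lead], and [order_step_eq] excludes other
    pairs there. *)
Lemma tri_step r b h J a B C y : tri r B y -> lead b h J a B C -> tri r C (emul (step_elt b a h r) y).
Proof.
move=> [ny sB yB supp lau] ld; have [M yM] := ny.1.
have [l [eSC eSB]] := lead_step_matrix ld; set S := smat b a h l in eSC eSB.
have sC : sig C = r by rewrite -(lead_sig ld).
have key C' : ro C' =1 ro C -> exists N, [/\ (0 < N)%N, locN N y, S \in Om N r, B \in Om N r & C' \in Om N r] /\
  forall A' B', A' \in Om N r -> B' \in Om N r -> step_elt b a h r A' != 0 -> sconst A' B' C' != 0 ->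
    A' = S /\ ro B' =1 ro B.
  move=> e; have [N1 CN] := inN_exists C'; have [N2 BN] := inN_exists B; have [N3 CN3] := inN_exists C.
  pose N := (N1 + N2 + N3 + M).+1; exists N.
  have {}CN : inN N C' by apply: inN_leq CN; rewrite /N; lia.
  have {}CN3 : inN N C by apply: inN_leq CN3; rewrite /N; lia.
  have {}BN : inN N B by apply: inN_leq BN; rewrite /N; lia.
  have CO : C' \in Om N r by rewrite mem_Om CN (eq_ro_sig e) sC eqxx.
  have N0 : (0 < N)%N by [].
  split.
    split=> //; first by apply: yM; rewrite /N; lia.
      by rewrite mem_Om (inN_smat eSC eSB CN3 BN) (eq_ro_sig eSC) sC eqxx.
    by rewrite mem_Om BN sB eqxx.
  move=> A' B' AO BO /step_elt_neq0[l' [eA _]] /sconst_neq0 g0.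
  have [e1 e2 e3] := gpoly_match N0 AO BO CO g0.
  have eAS : A' = S by rewrite eA; congr smat; apply: (@smat_ro_inj b a h) => i; rewrite -eA e1 e -eSC.
  by split=> // i; rewrite -e3 eAS eSB.
split; [|exact: sC| | |].
- by apply: nice_emul ny; exact: nice_step_elt.
- have [N [[N0 yN SO BO CO] H]] := key C (fun _ => erefl).
  rewrite (emul_single N0 yN SO BO CO); last first.
    move=> A' B' AO' BO' x0 y0 s0; have [eA eB] := H _ _ AO' BO' x0 s0; split=> //.
    have [ec le] := supp _ eB y0; have := sconst_neq0 s0; rewrite eA => g0.
    have [_ _ _] := gpoly_smat_prec N0 SO BO' CO g0 ld eSC le ec.
    exact.
  rewrite yB /S step_elt_in (eq_ro_sig eSC) sC eqxx /sconst gQE (gpoly_lead ld) // toQv1.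
  by rewrite (dA_lead ld eSC) PoszD !mul1r mulr1 -/S (_ : _ - _ - _ = 0) ?expr0z //; lia.
- move=> C' e nz; have [N [[N0 yN SO BO CO] H]] := key C' e.
  have [A' [B' [AO' BO' [x0 y0 s0]]]] := emul_neq0 N0 yN CO nz.
  have [eA eB] := H _ _ AO' BO' x0 s0; have [ec le] := supp _ eB y0.
  have := sconst_neq0 s0; rewrite eA => g0.
  by have [? ? ? _] := gpoly_smat_prec N0 SO BO' CO g0 ld eSC le ec.
move=> C' e; have [N [[N0 yN SO BO CO] H]] := key C' e.
rewrite (emulE _ N0 CO yN) big_seq; apply: laurent_sum => A AO; rewrite big_seq; apply: laurent_sum => B' BO'.
have [->|x0] := eqVneq (step_elt b a h r A) 0; first by rewrite !mul0r; exact: laurent0.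
have [->|s0] := eqVneq (sconst A B' C') 0; first by rewrite mulr0; exact: laurent0.
have [_ eB] := H _ _ AO BO' x0 s0.
by apply: laurentM; [apply: laurentM; [exact: laurent_step_elt | exact: lau] | exact: laurent_sconst].
Qed.

(** * Leading terms of the monomials *)

(** The common row sums of y are the column sums of the left factor, which leaves one step matrix
    and so one family of row sums. *)
Lemma homo_step r b h J a B C y : nice r y -> sig B = r -> (forall B', y B' != 0 -> ro B' =1 ro B) ->
  lead b h J a B C -> forall C', emul (step_elt b a h r) y C' != 0 -> ro C' =1 ro C.
Proof.
move=> ny sB H ld C' nz; have [l [eSC eSB]] := lead_step_matrix ld.
have sC := (nice_emul (nice_step_elt b a h r) ny).2 _ nz.
have [M yM] := ny.1; have [N [N0 MN CO]] := window_of C' M; rewrite sC in CO.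
have [A' [B' [AO BO [/step_elt_neq0[l' [eA _]] /H eB /sconst_neq0 g0]]]] := emul_neq0 N0 (yM _ MN) CO nz.
have [e1 _ e3] := gpoly_match N0 AO BO CO g0.
have el : l' = l.
  by apply/fsfunP => i; have := e3 i; rewrite eB -eSB eA !co_smat => /eqP; rewrite ?eqn_add2l ?eqn_add2r => /eqP ->.
by move=> i; rewrite -e1 eA el eSC.
Qed.

Definition act (y : elt) (xs : seq elt) : elt := foldr emul y xs.

Lemma nice_act r y xs : nice r y -> (forall x, List.In x xs -> nice r x) -> nice r (act y xs).
Proof.
move=> ny; elim: xs => [|x xs IH] nx; first exact: ny.
apply: nice_emul; first by apply: nx; left.
by apply: IH => z zx; apply: nx; right.
Qed.

Lemma emul_prodl r y xs : nice r y -> (forall x, List.In x xs -> nice r x) ->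
  emul (prodl r xs) y = act y xs.
Proof.
move=> ny; elim: xs => [|x xs IH] nx; first exact: emul1.
have nxs z : List.In z xs -> nice r z by move=> zx; apply: nx; right.
rewrite /= -IH // emulA //; first by have [] := nx x (or_introl erefl).
- by have [] := nice_act (nice_eone r) nxs.
- by case: ny.
Qed.

Lemma In_map (T : Type) (P : elt -> Prop) (f : T -> elt) (s : seq T) :
  (forall t, P (f t)) -> forall x, List.In x [seq f t | t <- s] -> P x.
Proof. by move=> H x; elim: s => //= t s IH [<-|/IH]. Qed.

Lemma intrangeS (m n : int) : m <= n -> intrange m n = m :: intrange (m + 1) n.
Proof.
move=> mn; rewrite /intrange mn.
have -> : (absz (n - m)%R + 1)%N = (absz (n - m)%R).+1 by rewrite addn1.
rewrite /= addr0; congr cons; case: ifP => mn1.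
  rewrite (_ : absz (n - m)%R = (absz (n - (m + 1))%R + 1)%N); last by lia.
  by rewrite (iotaDl 1 0) -map_comp; apply: eq_map => k /=; lia.
by have -> : absz (n - m)%R = 0%N by lia.
Qed.

Lemma intrange_ind (P : int -> seq int -> Prop) (n : int) :
  P (n + 1) [::] -> (forall (m : int) s, m <= n -> P (m + 1) s -> P m (m :: s)) ->
  forall m : int, m <= n + 1 -> P m (intrange m n).
Proof.
move=> P0 PS m mn; have [k e] : exists k : nat, n + 1 - m = k%:Z by exists (absz (n + 1 - m)%R); lia.
elim: k => [|k IH] in m mn e *.
  rewrite (_ : m = n + 1); last by lia.
  by rewrite /intrange ifF //; lia.
by rewrite intrangeS; [apply: PS; [|apply: IH] | ]; lia.
Qed.

(** The rightmost factor f n acts first, so the index of the invariant descends from n + 1 to m. *)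
Lemma act_up (Q : int -> elt -> Prop) (f : int -> elt) (m n : int) y :
  m <= n + 1 -> (forall (i : int) z, m <= i -> i <= n -> Q (i + 1) z -> Q i (emul (f i) z)) ->
  Q (n + 1) y -> Q m (act y [seq f i | i <- intrange m n]).
Proof.
move=> mn st Q0; move: st.
pose P (k : int) s := (forall (i : int) z, k <= i -> i <= n -> Q (i + 1) z -> Q i (emul (f i) z)) ->
  Q k (act y [seq f i | i <- s]).
apply: (@intrange_ind P) mn => // k s kn IH st; apply: (st k) => //=.
by apply: IH => i z ki; apply: st; lia.
Qed.

Lemma act_down (Q : int -> elt -> Prop) (f : int -> elt) (m n : int) y :
  m <= n + 1 -> (forall (i : int) z, m <= i -> i <= n -> Q i z -> Q (i + 1) (emul (f i) z)) ->
  Q m y -> Q (n + 1) (act y [seq f i | i <- rev (intrange m n)]).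
Proof.
move=> mn st Q0; move: st y Q0.
pose P (k : int) s := (forall (i : int) z, k <= i -> i <= n -> Q i z -> Q (i + 1) (emul (f i) z)) ->
  forall y, Q k y -> Q (n + 1) (act y [seq f i | i <- rev s]).
apply: (@intrange_ind P) mn => // k s kn IH st y Qy.
rewrite rev_cons -cats1 map_cat /act foldr_cat; apply: IH => [i z ki|]; first by apply: st; lia.
exact: st.
Qed.

(** An entry of column J on its way: a units have left (J, J) and are now at (x, J). Subtraction
    comes after addition, so that x = J returns B. *)
Definition mv (a : nat) (J x : int) (B : mat) : mat :=
  [fsfun p in (finsupp B `|` [fset (x, J)])%fset => (B p + a * (p == (x, J)) - a * (p == (J, J)))%N | 0%N].

Lemma ent_mv a (J x : int) B i j : ent (mv a J x B) i j =
  (ent B i j + a * ((i == x) && (j == J)) - a * ((i == J) && (j == J)))%N.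
Proof.
rewrite /ent /mv fsfunE !inE !xpair_eqE; case: ifP => // /norP[].
by rewrite mem_finsupp negbK => /eqP -> /negPf ->; rewrite muln0 sub0n.
Qed.

Lemma mv0 a J B : mv a J J B = B.
Proof. by apply: entP => i j; rewrite ent_mv addnK. Qed.

Lemma lo_hi A : lo A <= 0 /\ 0 <= hi A.
Proof. by rewrite /lo /hi bigmin_le_id bigmax_ge_id. Qed.

Lemma lo_hi_ent A (i j : int) : ent A i j != 0%N -> [/\ lo A <= i, lo A <= j, i <= hi A & j <= hi A].
Proof.
rewrite /ent -mem_finsupp => ijA.
have := ge_bigmin_seq 0 (i, j) xpredT (fun p => Num.min p.1 p.2) ijA isT.
have := le_bigmax_seq 0 (i, j) xpredT (fun p => Num.max p.1 p.2) ijA isT.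
by rewrite -/(lo A) -/(hi A) /= ge_max le_min => /andP[? ?] /andP[].
Qed.

Lemma nice_prodl r xs : (forall x, List.In x xs -> nice r x) -> nice r (prodl r xs).
Proof. exact/nice_act/nice_eone. Qed.

Lemma nice_fgroup r A (i j : int) : nice r (prodl r [seq dpow r (ff r k) (A (j, i)) | k <- rev (intrange i (j - 1))]).
Proof. by apply: nice_prodl; apply: In_map => k; rewrite dpow_ff; exact: nice_step_elt. Qed.

Lemma nice_egroup r A (i j : int) : nice r (prodl r [seq dpow r (ee r k) (A (i, j)) | k <- intrange i (j - 1)]).
Proof. by apply: nice_prodl; apply: In_map => k; rewrite dpow_ee; exact: nice_step_elt. Qed.

Lemma nice_Mj' r A m j : nice r (Mj' r A m j).
Proof. by apply: nice_prodl; apply: In_map => i; exact: nice_fgroup. Qed.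

Lemma nice_Mj r A m j : nice r (Mj r A m j).
Proof. by apply: nice_prodl; apply: In_map => i; exact: nice_egroup. Qed.

Lemma nice_fMinus r A : nice r (fMinus r A).
Proof. by apply: nice_prodl; apply: In_map => i; exact: nice_Mj'. Qed.

Lemma nice_ePlus r A : nice r (ePlus r A).
Proof. by apply: nice_prodl; apply: In_map => i; exact: nice_Mj. Qed.

Section Words.
Variables (r : nat) (A : mat) (T : mat -> elt -> Prop).
Hypotheses (T_nice : forall B y, T B y -> nice r y)
  (T_step : forall b (h J : int) a B C y, T B y -> lead b h J a B C -> T C (emul (step_elt b a h r) y)).

(** T will be [tri] while the f_i act and [top] while the e_i act. The vanishing hypotheses say
    that, apart from the diagonal entry at J, both rows of B are empty from J on, so that moving the
    travelling units one row further is a leading move. *)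
Lemma mv_step b (h J : int) a B y : (if b then h + 1 <= J else J <= h) ->
  (a <= ent B J J)%N ->
  (forall u : int, (if b then J <= u else u <= J) -> u != losing b h \/ u != J -> ent B (losing b h) u = 0%N) ->
  (forall u : int, (if b then J <= u else u <= J) -> ent B (gaining b h) u = 0%N) ->
  T (mv a J (losing b h) B) y -> T (mv a J (gaining b h) B) (emul (step_elt b a h r) y).
Proof.
move=> hJ aB z1 z2 Ty; apply: (T_step (J := J)) Ty _.
have gl := losing_gaining b h.
have gJ : (gaining b h == J) = false by move: hJ; rewrite /gaining; case: (b) => *; lia.
have Jl : (J == losing b h) || (ent B (losing b h) J == 0%N).
  case: (eqVneq J (losing b h)) => //= n0; apply/eqP/z1; first by case: (b).
  by left.
split=> //.
- apply: entP => i j; rewrite !ent_madd !ent_mv !ent_emx.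
  case: (eqVneq j J) => [->|_]; rewrite ?andbF ?muln0; last by rewrite ?subn0 ?addn0.
  rewrite !andbT; case: (eqVneq i J) => [->|iJ].
    rewrite eq_sym gJ muln0 addn0 muln1; case: (J == losing b h) => /=; lia.
  by do 2!case: eqP => _ /=; lia.
- move=> u uJ; have uJ' : (u == J) = false by case: (b) uJ => *; lia.
  rewrite ent_mv z1 ?uJ' ?andbF ?muln0 //; first by case: (b) uJ => *; lia.
  by right.
move=> u uJ; rewrite ent_mv z2 // [gaining b h == losing b h]eq_sym gl gJ /=; lia.
Qed.

(* The matrix with the column sums of A whose off-diagonal entries are those of A at
   positions in P and 0 elsewhere. *)
Definition St (P : int -> int -> bool) : mat :=
  [fsfun p in (finsupp A `|` [fset (q.2, q.2) | q in finsupp A])%fset =>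
     if p.1 == p.2 then msum A (fun q => (q.2 == p.2) && ((q.1 == q.2) || ~~ P q.1 q.2))
     else (P p.1 p.2 * A p)%N | 0%N].

Lemma ent_St P (i j : int) : ent (St P) i j =
  if i == j then msum A (fun q => (q.2 == j) && ((q.1 == q.2) || ~~ P q.1 q.2)) else (P i j * ent A i j)%N.
Proof.
rewrite /ent /St fsfunE !inE; case: ifP => // /norP[/=].
rewrite mem_finsupp negbK => /eqP ->; case: (eqVneq i j) => [->|_] no; last by rewrite muln0.
apply/esym/msum_eq0 => -[k l] /= /andP[/eqP -> _]; apply/eqP; rewrite -[_ == _]negbK -mem_finsupp.
by apply: contra no => kA; apply/imfsetP; exists (k, j).
Qed.

Lemma eq_St P P' : (forall i j : int, i != j -> ent A i j != 0%N -> P i j = P' i j) -> St P = St P'.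
Proof.
move=> e; apply: entP => i j; rewrite !ent_St; case: (eqVneq i j) => [_|ij].
  rewrite !msum_cond; apply: eq_big_seq => -[k l]; rewrite mem_finsupp => kA /=.
  by case: (eqVneq k l) => //= kl; rewrite e.
by have [->|nz] := eqVneq (ent A i j) 0%N; rewrite ?muln0 // e.
Qed.

(** Admitting (x, J) to P releases its units from the diagonal entry of column J, where [St] keeps
    them until then. *)
Lemma mv_St P (x J : int) : x != J -> P x J = false ->
  (ent A x J <= ent (St P) J J)%N /\
  mv (ent A x J) J x (St P) = St (fun i j => P i j || (i == x) && (j == J)).
Proof.
move=> xJ Px.
have key : ent (St P) J J = (ent A x J + ent (St (fun i j => P i j || (i == x) && (j == J))) J J)%N.
  rewrite !ent_St eqxx (msumID A (fun p => p == (x, J))) /ent -(msum_xpred1 A (x, J)); congr (_ + _)%N.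
    apply: eq_msum => -[i j] _ /=; rewrite xpair_eqE.
    by case: (i =P x) => [->|]; rewrite ?andbF //=; case: (j =P J) => [->|]; rewrite ?andbF //= Px orbT.
  apply: eq_msum => -[i j] _ /=; rewrite xpair_eqE.
  by case: (j =P J) => [->|]; rewrite ?andbF //=; case: (i =P x) => [->|]; rewrite ?andbF ?orbF ?andbT //= (negPf xJ) orbT.
split; first by rewrite key leq_addr.
apply: entP => i j; rewrite ent_mv.
case: (eqVneq i j) => [<-|ij].
  case: (eqVneq i J) => [->|iJ].
    by rewrite key [J == x]eq_sym (negPf xJ) /=; lia.
  rewrite !andbF !muln0 addn0 subn0 !ent_St eqxx; apply: eq_msum => -[k l] _ /=.
  by case: (l =P i) => //= ->; rewrite (negPf iJ) andbF orbF.
rewrite !ent_St (negPf ij); case: (eqVneq j J) => [jJ|_]; last by rewrite !andbF orbF; lia.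
subst j; rewrite (negPf ij); case: (eqVneq i x) => [ix|_] /=; last by rewrite orbF; lia.
by subst i; rewrite Px /=; lia.
Qed.

(** [Pf j i] lists the places filled after the group for the entry (j, i), [Pe j i] those filled
    before the group for (i, j). Factors act from the right, so the lower part is filled from the
    last row upwards, each row from right to left, and the upper part by columns from left to right,
    each from the top. *)
Definition Pf (j i : int) : int -> int -> bool := fun k l => (l < k) && ((j < k) || (k == j) && (i <= l)).
Definition Pe (j i : int) : int -> int -> bool :=
  fun k l => (l < k) || (k < l) && ((l < j) || (l == j) && (k < i)).

(** The factors f_i, ..., f_{j-1} carry the units of column i from row i down to row j, one row
    each. *)
Lemma f_path (i j : int) y : i < j -> T (St (Pf j (i + 1))) y ->
  T (St (Pf j i)) (emul (prodl r [seq dpow r (ff r k) (A (j, i)) | k <- rev (intrange i (j - 1))]) y).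
Proof.
move=> ij Ty; have [le e] := mv_St (P := Pf j (i + 1)) (x := j) (J := i) ltac:(lia) ltac:(rewrite /Pf; lia).
have -> : St (Pf j i) = mv (ent A j i) i j (St (Pf j (i + 1))).
  by rewrite e; apply: eq_St => k l kl _; rewrite /Pf /=; vlia.
rewrite (emul_prodl (T_nice Ty)); last first.
  by apply: In_map => k; rewrite dpow_ff; exact: nice_step_elt.
have Pz (k u : int) : i <= k -> k <= j -> u <= i -> Pf j (i + 1) k u = false by rewrite /Pf; lia.
have := @act_down (fun k => T (mv (ent A j i) i k (St (Pf j (i + 1)))))
  (fun k => dpow r (ff r k) (A (j, i))) i (j - 1) y.
rewrite subrK; apply; [lia| |by rewrite mv0].
move=> k z ik kj Tz; rewrite dpow_ff; apply: (@mv_step false k i) => //.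
- move=> u /= ui n0; rewrite ent_St Pz ?mul0n //; last by lia.
  by rewrite ifF //; rewrite /losing in n0 *; lia.
- move=> u /= ui; rewrite ent_St /gaining Pz ?mul0n //; try lia.
  by rewrite ifF //; lia.
Qed.

Lemma e_path (i j : int) y : i < j -> T (St (Pe j i)) y ->
  T (St (Pe j (i + 1))) (emul (prodl r [seq dpow r (ee r k) (A (i, j)) | k <- intrange i (j - 1)]) y).
Proof.
move=> ij Ty; have [le e] := mv_St (P := Pe j i) (x := i) (J := j) ltac:(lia) ltac:(rewrite /Pe; lia).
have -> : St (Pe j (i + 1)) = mv (ent A i j) j i (St (Pe j i)).
  by rewrite e; apply: eq_St => k l kl _; rewrite /Pe /=; vlia.
rewrite (emul_prodl (T_nice Ty)); last first.
  by apply: In_map => k; rewrite dpow_ee; exact: nice_step_elt.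
have Pz (k u : int) : i <= k -> k <= j -> j <= u -> Pe j i k u = false by rewrite /Pe; lia.
have := @act_up (fun k => T (mv (ent A i j) j k (St (Pe j i))))
  (fun k => dpow r (ee r k) (A (i, j))) i (j - 1) y.
rewrite subrK; apply; [lia| |by rewrite mv0].
move=> k z ik kj Tz; rewrite dpow_ee; apply: (@mv_step true k j) => //.
- by rewrite /=; lia.
- move=> u /= ui n0; rewrite ent_St /losing Pz ?mul0n //; try lia.
  by rewrite ifF //; rewrite /losing in n0; lia.
- move=> u /= ui; rewrite ent_St /gaining Pz ?mul0n //; try lia.
  by rewrite ifF //; lia.
Qed.

Lemma St_fMinus y : T (St (fun _ _ => false)) y -> T (St (fun k l => l < k)) (emul (fMinus r A) y).
Proof.
move=> Ty; have [l0 h0] := lo_hi A.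
have -> : St (fun k l => l < k) = St (Pf (lo A) (lo A)).
  by apply: eq_St => k l kl /lo_hi_ent[? ? ? ?]; rewrite /Pf; lia.
rewrite (emul_prodl (T_nice Ty)); last by apply: In_map => i; exact: nice_Mj'.
have := @act_up (fun j => T (St (Pf (j - 1) (j - 1)))) (fun j => Mj' r A (lo A) j) (lo A + 1) (hi A) y.
rewrite !addrK; apply; [lia| |]; last first.
  rewrite (_ : St _ = St (fun _ _ => false)) //.
  by apply: eq_St => k l kl /lo_hi_ent[? ? ? ?]; rewrite /Pf; lia.
move=> j z lj jh; rewrite addrK => Tz; rewrite (emul_prodl (T_nice Tz)); last first.
  by apply: In_map => i; exact: nice_fgroup.
(* Row j complete is the same state as row j - 1 not begun: columns from j - 1 on are not below the
   diagonal in row j - 1. *)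
have -> : St (Pf (j - 1) (j - 1)) = St (Pf j (lo A)).
  by apply: eq_St => k l kl /lo_hi_ent[? ? ? ?]; rewrite /Pf; vlia.
have := @act_up (fun i => T (St (Pf j i)))
  (fun i => prodl r [seq dpow r (ff r k) (A (j, i)) | k <- rev (intrange i (j - 1))]) (lo A) (j - 1) z.
rewrite subrK; apply; [lia| |exact: Tz].
by move=> i z' li ij Tz'; apply: f_path Tz'; lia.
Qed.

Lemma St_ePlus y : T (St (fun k l => l < k)) y -> T A (emul (ePlus r A) y).
Proof.
move=> Ty; have [l0 h0] := lo_hi A.
have StA (P : int -> int -> bool) : (forall i j : int, i != j -> ent A i j != 0%N -> P i j) -> St P = A.
  move=> PA; apply: entP => i j; rewrite ent_St; case: (eqVneq i j) => [<-|ij]; last first.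
    by have [->|nz] := eqVneq (ent A i j) 0%N; rewrite ?muln0 // PA // mul1n.
  rewrite /ent -(msum_xpred1 A (i, i)) !msum_cond; apply: eq_big_seq => -[k l]; rewrite mem_finsupp => kA /=.
  rewrite xpair_eqE; case: (eqVneq k l) => [->|kl] /=; first by rewrite andbb andbT.
  by rewrite PA // andbF; case: (k =P i) => [<-|//]; case: eqP => // e; rewrite e eqxx in kl.
rewrite -[Q in T Q](StA (Pe (hi A + 1) (lo A))); last first.
  by move=> k l kl /lo_hi_ent[? ? ? ?]; rewrite /Pe; vlia.
rewrite (emul_prodl (T_nice Ty)); last by apply: In_map => i; exact: nice_Mj.
apply: (@act_down (fun j => T (St (Pe j (lo A)))) (fun j => Mj r A (lo A) j) (lo A + 1) (hi A) y); first by lia.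
  move=> j z lj jh Tz; rewrite (emul_prodl (T_nice Tz)); last first.
    by apply: In_map => i; exact: nice_egroup.
  have -> : St (Pe (j + 1) (lo A)) = St (Pe j j).
    by apply: eq_St => k l kl /lo_hi_ent[? ? ? ?]; rewrite /Pe; vlia.
  have := @act_down (fun i => T (St (Pe j i)))
    (fun i => prodl r [seq dpow r (ee r k) (A (i, j)) | k <- intrange i (j - 1)]) (lo A) (j - 1) z.
  rewrite subrK; apply; [lia| |exact: Tz].
  by move=> i z' li ij Tz'; apply: e_path Tz'; lia.
rewrite (_ : St _ = St (fun k l => l < k)) //.
by apply: eq_St => k l kl /lo_hi_ent[? ? ? ?]; rewrite /Pe; vlia.
Qed.
End Words.

(** * Diagonal elements *)

(* The diagonal element sum_l f(l) [diag l], over the l of total r. *)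
Definition dg (r : nat) (f : (int -> nat) -> Qv) : elt := fun C =>
  if `[< exists l, C = diagm l >] && (sig C == r) then f (ro C) else 0.

Lemma sig_diagm l : sig (diagm l) = sigl l.
Proof. by rewrite sigE msum_diagm. Qed.

Lemma dg_in r f l : dg r f (diagm l) = if sigl l == r then f l else 0.
Proof.
rewrite /dg sig_diagm; have -> /= : `[< exists l', diagm l = diagm l' >] = true.
  by apply/asboolP; exists l.
by congr (if _ then f _ else _); apply: funext => i; rewrite ro_diagm.
Qed.

Lemma dg_neq0 r f C : dg r f C != 0 -> exists l, C = diagm l /\ sigl l = r.
Proof.
rewrite /dg; case: asboolP => [[l eC]|_] /=; last by rewrite eqxx.
rewrite {1}eC sig_diagm; case: (sigl l =P r) => [e _|_]; last by rewrite eqxx.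
by exists l.
Qed.

Lemma dg_diag r f C : dg r f C != 0 -> exists l, C = diagm l.
Proof. by case/dg_neq0 => l [->]; exists l. Qed.

Lemma eq_dg r (x : elt) f : (forall C, x C != 0 -> exists l, C = diagm l) ->
  (forall l, x (diagm l) = if sigl l == r then f (fun_of_fsfun l : int -> nat) else 0) -> x = dg r f.
Proof.
move=> xd xE; apply: funext => C.
have [[l ->]|no] := pselect (exists l, C = diagm l); first by rewrite xE dg_in.
by transitivity (0 : Qv); [|symmetry]; apply/eqP/negPn/negP => /[dup] nz; [move/xd | move/dg_diag].
Qed.

Lemma nice_dg r f : nice r (dg r f).
Proof.
split; last by move=> A /dg_neq0[l [-> <-]]; exact: sig_diagm.
exists 0%N => N _ B /dg_diag[l ->] cN; apply/inNP => -[i j] nz.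
have := cN _ nz; split=> //=; move: nz; rewrite -/(ent _ i j) ent_diagm.
by case: (i =P j) => [->|].
Qed.

Lemma eone_dg r : eone r = dg r (fun _ => 1).
Proof.
apply: eq_dg; first exact: eone_diag.
by move=> l; rewrite eoneE; case: eqP.
Qed.

Lemma kk_dg r i : kk r i = dg r (fun m => v ^ (m i)%:Z).
Proof.
have dv l : dotv l (epsv i) = (l i)%:Z.
  rewrite /dotv -(nsum1 l i) /nsum [in RHS]big_mkcond /= -natz natr_sum; apply: eq_bigr => j _.
  by rewrite /epsv fsfunE inE; case: (j =P i) => [->|_]; rewrite ?mulr1 ?mulr0 // natz.
have m0 l : madd mat0 (diagm l) = diagm l by rewrite (mat0_emat true 0) -/(smat true 0 0 l) smat0.
apply: eq_dg => [C /Aj_neq0[l [-> _]]|l]; first by exists l.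
by rewrite /kk -{1}m0 Aj_in m0 sig_diagm dv.
Qed.

Lemma emul_dg r f y C : emul (dg r f) y C = if sig C == r then f (ro C) * y C else 0.
Proof.
have [l e] := nvec_ro C; rewrite (emul_diag _ (@dg_diag r f) e) dg_in.
have -> : sigl l = sig C.
  by rewrite -sig_diagm; apply: eq_ro_sig => i; rewrite ro_diagm e.
by rewrite (funext e); case: eqP => _ //; rewrite mul0r.
Qed.

Lemma emul_dg_dg r f g : emul (dg r f) (dg r g) = dg r (fun m => f m * g m).
Proof.
apply: funext => C; rewrite emul_dg /dg.
by case: (sig C == r); rewrite ?andbF ?andbT //; case: ifP; rewrite ?mulr0.
Qed.

Lemma eadd_dg r f g : eadd (dg r f) (dg r g) = dg r (fun m => f m + g m).
Proof. by apply: funext => C; rewrite /eadd /dg; case: ifP; rewrite ?addr0. Qed.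

Lemma escal_dg r c f : escal c (dg r f) = dg r (fun m => c * f m).
Proof. by apply: funext => C; rewrite /escal /dg; case: ifP; rewrite ?mulr0. Qed.

Lemma prodl_dg (I : Type) r (f : I -> (int -> nat) -> Qv) (s : seq I) :
  prodl r [seq dg r (f i) | i <- s] = dg r (fun m => \prod_(i <- s) f i m).
Proof.
elim: s => [|i s IH] /=.
  by rewrite eone_dg; congr dg; apply: funext => m; rewrite big_nil.
by rewrite IH emul_dg_dg; congr dg; apply: funext => m; rewrite big_cons.
Qed.

Lemma inHatK_dg r f : inHatK r (dg r f).
Proof.
split; first by case: (nice_dg r f).
have fin (P : mat -> Prop) : (forall A B, P A -> P B -> A = B) -> finite_set (fun A => P A).
  move=> uP; have [[A PA]|no] := pselect (exists A, P A).
    by apply: (@sub_finite_set _ _ [set A]%classic) => [B PB|]; [exact: uP | exact: finite_set1].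
  by rewrite (_ : (fun A => P A) = classical_sets.set0) //; apply/seteqP; split=> A PA //; case: no; exists A.
move=> lam; split; apply: fin => A B [/dg_diag[l ->] e1] [/dg_diag[l' ->] e2];
  congr diagm; apply/fsfunP => i.
  by rewrite -[LHS]ro_diagm -[RHS]ro_diagm e1 e2.
by rewrite -[LHS]co_diagm -[RHS]co_diagm e1 e2.
Qed.

(** [invK] is chosen, so its value rests on uniqueness: left multiplication by [dg r f] scales each
    coefficient by a nonzero number. *)
Lemma invK_dg r f : (forall m, f m != 0) -> invK r (dg r f) = dg r (fun m => (f m)^-1).
Proof.
move=> f0; pose P y := inHatK r y /\ emul (dg r f) y = eone r /\ emul y (dg r f) = eone r.
have h : P (dg r (fun m => (f m)^-1)).
  rewrite /P !emul_dg_dg eone_dg; split; [exact: inHatK_dg|split; congr dg; apply: funext => m].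
    by rewrite mulfV.
  by rewrite mulVf.
have [[sy _] [e _]] := ClassicalEpsilon.epsilon_spec (inhabits (fun _ => 0)) P (ex_intro _ _ h).
rewrite -/(invK r (dg r f)) in e sy; move: (invK _ _) e sy => y e sy.
have [_ [e' _]] := h; apply: funext => C.
have := congr1 (fun x : elt => x C) e; have := congr1 (fun x : elt => x C) e'.
rewrite !emul_dg; case: (sig C =P r) => [_ <-|sC _ _]; first by move/(mulfI (f0 _)).
transitivity (0 : Qv); last by rewrite /dg (introF eqP sC) andbF.
by apply/eqP/negPn/negP => /sy.
Qed.

(** The value of [K; 0 over t] at K = v^a, that is, the symmetric Gaussian binomial of a and t. *)
Definition gb (a t : nat) : Qv := \prod_(s <- iota 1 t)
  ((v ^+ s - v ^- s)^-1 * (v ^ (1 - s%:Z) * v ^ a%:Z + - v ^ (s%:Z - 1) * (v ^ a%:Z)^-1)).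

Lemma gauss_kk r i t : gauss r (kk r i) t = dg r (fun m => gb (m i) t).
Proof.
rewrite /gauss kk_dg invK_dg; last by move=> m; exact: vz_neq0.
rewrite -(prodl_dg r (fun s m => (v ^+ s - v ^- s)^-1 * (v ^ (1 - s%:Z) * v ^ (m i)%:Z + - v ^ (s%:Z - 1) * (v ^ (m i)%:Z)^-1))).
by congr prodl; apply: eq_map => s; rewrite !escal_dg eadd_dg escal_dg.
Qed.

Lemma ksig_dg r A : ksig r A = dg r (fun m => \prod_(i <- intrange (lo A) (hi A)) gb (m i) (sigi A i)).
Proof.
rewrite /ksig -(prodl_dg r (fun i m => gb (m i) (sigi A i))).
by congr prodl; apply: eq_map => i; rewrite gauss_kk.
Qed.

Lemma gb_factor a s : v ^ (1 - s%:Z) * v ^ a%:Z + - v ^ (s%:Z - 1) * (v ^ a%:Z)^-1 =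
  v ^ (a%:Z - s%:Z + 1) - v ^ (- (a%:Z - s%:Z + 1)).
Proof.
rewrite mulNr invr_expz -!vzD; congr (v ^ _ - v ^ _); lia.
Qed.

(** The factor s = a + 1 is v^0 - v^0. *)
Lemma gb_lt a t : (a < t)%N -> gb a t = 0.
Proof.
move=> lt; rewrite /gb (bigD1_seq a.+1) ?iota_uniq //=; last by rewrite mem_iota; lia.
rewrite gb_factor (_ : a%:Z - a.+1%:Z + 1 = 0) ?oppr0 ?subrr ?mulr0 ?mul0r //; lia.
Qed.

Lemma gb_diag t : gb t t = 1.
Proof.
rewrite /gb; under eq_bigr do rewrite gb_factor.
rewrite big_split /= prodfV mulrC.
have -> : \prod_(s <- iota 1 t) (v ^ (t%:Z - s%:Z + 1) - v ^ (- (t%:Z - s%:Z + 1))) =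
  \prod_(s <- iota 1 t) (v ^+ s - v ^- s).
  have e : iota 1 t = index_iota 1 t.+1 by rewrite /index_iota subSS subn0.
  rewrite e big_nat_rev /= big_nat [RHS]big_nat; apply: eq_bigr => s /andP[s1 s2].
  have -> : t%:Z - (1 + t.+1 - s.+1)%N%:Z + 1 = s%:Z by lia.
  by rewrite -exprnN.
rewrite mulfV // prodf_seq_neq0; apply/allP => s; rewrite mem_iota => /andP[s1 _] /=.
exact: vsub_neq0.
Qed.

Lemma leq_nvec_eq (l m : nvec) : (forall i, l i <= m i)%N -> sigl l = sigl m -> l = m.
Proof.
move=> le e; pose d : nvec := [fsfun i in finsupp m => (m i - l i)%N | 0%N].
have dE i : d i = (m i - l i)%N.
  by rewrite fsfunE; case: finsuppP => //; rewrite ?sub0n.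
have em : madd (diagm l) (diagm d) = diagm m.
  by apply: entP => i j; rewrite ent_madd !ent_diagm dE; case: eqP => // _; rewrite subnKC.
have d0 : nsum d xpredT = 0%N.
  apply/eqP; rewrite -(eqn_add2l (sigl l)) addn0 {2}e -(sig_diagm m) -em sig_madd_diagm sig_diagm.
  by rewrite eqn_add2l.
apply/fsfunP => i; apply/eqP; rewrite eqn_leq le -subn_eq0 -dE.
by rewrite (nsum_eq0 d0).
Qed.

Lemma leq_ro_eq (B C : mat) : (forall i, ro B i <= ro C i)%N -> sig B = sig C -> ro B =1 ro C.
Proof.
have [l el] := nvec_ro B; have [m em] := nvec_ro C => le e.
suff lm : l = m by move=> i; rewrite -el -em lm.
have s B' (x : nvec) : x =1 ro B' -> sigl x = sig B'.
  by move=> ex; rewrite -sig_diagm; apply: eq_ro_sig => i; rewrite ro_diagm ex.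
by apply: leq_nvec_eq; [move=> i; rewrite el em | rewrite (s _ _ el) (s _ _ em)].
Qed.

Section Weights.
Variable A : mat.

Lemma msum_St_off P (Q : pred (int * int)) : (forall i, Q (i, i) = false) ->
  msum (St A P) Q = msum A (fun p => Q p && P p.1 p.2).
Proof.
move=> Qd; pose s := enum_fset (finsupp (St A P) `|` finsupp A)%fset.
have us : uniq s by exact: fset_uniq.
rewrite (@msum_sub _ s) //; last by move=> p; rewrite /s inE => ->.
rewrite (@msum_sub A s) //; last by move=> p; rewrite /s inE orbC => ->.
rewrite big_mkcond [RHS]big_mkcond; apply: eq_bigr => -[i j] _ /=.
rewrite -!/(ent _ i j) ent_St; case: (eqVneq i j) => [->|_]; first by rewrite Qd.
by case: (Q _); case: (P i j); rewrite ?mul1n.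
Qed.

Lemma co_St P : co (St A P) =1 co A.
Proof.
move=> j; rewrite !coE (msumID _ (fun p => p == (j, j))) [RHS](msumID _ (fun p => (p.1 == p.2) || ~~ P p.1 p.2)).
congr (_ + _)%N.
  transitivity (ent (St A P) j j); last by rewrite ent_St eqxx.
  rewrite /ent -(msum_xpred1 (St A P) (j, j)); apply: eq_msum => -[k l] _ /=.
  by rewrite xpair_eqE; case: (l =P j); rewrite ?andbF ?andbT.
rewrite msum_St_off; last by move=> i /=; rewrite xpair_eqE; case: (i == j).
apply: eq_msum => -[k l] _ /=; rewrite xpair_eqE negb_or negbK negb_and.
by case: (l =P j) => //= ->; rewrite orbF.
Qed.

Lemma sig_St P : sig (St A P) = sig A.
Proof. exact/eq_co_sig/co_St. Qed.

(** The origin of sigma(A): once the lower part is in place, the entries of column i above the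
    diagonal still sit at (i, i), beside the true diagonal entry, and the rest of row i consists of
    its entries left of the diagonal. *)
Lemma ro_St_lower : ro (St A (fun k l => l < k)) =1 sigi A.
Proof.
move=> i; rewrite roE (msumID _ (fun p => p == (i, i))).
have -> : sigi A i = (msum A (fun p => p == (i, i)) + msum A (fun p => (p.1 == i) && (p.2 < i)%R) +
    msum A (fun p => (p.2 == i) && (p.1 < i)%R))%N by rewrite msum_xpred1.
rewrite addnAC; congr (_ + _)%N; last first.
  rewrite msum_St_off; last by move=> k /=; rewrite xpair_eqE; case: (k == i).
  by apply: eq_msum => -[k l] _ /=; rewrite xpair_eqE; vlia.
transitivity (ent (St A (fun k l => l < k)) i i).
  rewrite /ent -(msum_xpred1 _ (i, i)); apply: eq_msum => -[k l] _ /=.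
  by rewrite xpair_eqE; case: (k =P i).
rewrite ent_St eqxx (msumID _ (fun p => p == (i, i))).
by congr (_ + _)%N; apply: eq_msum => -[k l] _ /=; rewrite xpair_eqE; vlia.
Qed.

(** If no factor vanishes, sigma_i(A) is at most the i-th row sum of C for every i, since sigma_i(A)
    = 0 outside [lo A, hi A]; equal totals turn these inequalities into equalities. *)
Lemma ksig_coef (C : mat) : sig C = sig A ->
  \prod_(i <- intrange (lo A) (hi A)) gb (ro C i) (sigi A i) = (`[< ro C =1 sigi A >])%:R.
Proof.
move=> sC; case: asboolP => [e|ne].
  by rewrite big1_seq // => i _; rewrite e gb_diag.
apply/eqP/negPn/negP; rewrite prodf_seq_neq0 => /allP nz; apply: ne.
have le i : (sigi A i <= ro C i)%N.
  have [ir|/negP ir] := boolP ((lo A <= i) && (i <= hi A)).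
    rewrite leqNgt; apply/negP => lt.
    have : i \in intrange (lo A) (hi A).
      rewrite /intrange ifT; last by lia.
      by apply/mapP; exists (absz (i - lo A)%R); [rewrite mem_iota|]; lia.
    by move/nz; rewrite gb_lt // eqxx.
  rewrite -ro_St_lower roE msum_eq0_ent // => k l /= /eqP ->; rewrite ent_St.
  case: eqP => [il|_].
    apply: msum_eq0_ent => u w /= /andP[/eqP -> _]; apply/eqP/negPn/negP => /lo_hi_ent[_ ? _ ?].
    by apply: ir; lia.
  have [->|/lo_hi_ent[? _ ? _]] := eqVneq (ent A i l) 0%N; first by rewrite muln0.
  by case: ir; lia.
move=> i; rewrite -ro_St_lower; apply/esym/leq_ro_eq; last by rewrite sig_St.
by move=> k; rewrite ro_St_lower.
Qed.
End Weights.

(** When all of x has the row sums of A, the leading term of [tri] dominates the whole of x. *)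
Definition top (r : nat) (A : mat) (x : elt) : Prop :=
  tri r A x /\ forall B, x B != 0 -> ro B =1 ro A.

Lemma top_mm r A : sig A = r -> top r A (mm r A).
Proof.
move=> sA; pose low := fun k l : int => l < k.
(* The identity is the sum of all diagonal matrices, of which just one has the given row sums,
   namely the column sums of A. *)
have T0 : tri r (St A (fun _ _ => false)) (eone r).
  have [l el] := nvec_co (St A (fun _ _ => false)).
  have eB : St A (fun _ _ => false) = diagm l.
    apply: entP => i j; rewrite ent_diagm el co_St ent_St; case: (eqVneq i j) => // -> .
    by rewrite coE; apply: eq_msum => -[u w] _ /=; rewrite orbT andbT.
  have sl : sigl l = r by rewrite -sig_diagm -eB sig_St.
  rewrite eB; split.
  - exact: nice_eone.
  - by rewrite sig_diagm.
  - by rewrite eoneE sl eqxx.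
  - move=> B' e /eone_diag[l' eB'].
    have -> : B' = diagm l by rewrite eB'; congr diagm; apply/fsfunP => i; rewrite -ro_diagm -eB' e ro_diagm.
    by split=> // i j ij.
  by move=> B' _; rewrite (eone_step_elt true 0); exact: laurent_step_elt.
have T1 : tri r (St A low) (fMinus r A).
  have := @St_fMinus r A (tri r) (fun B y => fun h : tri r B y => let: And5 a _ _ _ _ := h in a)
    (@tri_step r) _ T0.
  rewrite (emul_prodl (nice_eone r)) //.
  by apply: In_map => i; exact: nice_Mj'.
have nk : nice r (ksig r A) by rewrite ksig_dg; exact: nice_dg.
pose z := emul (ksig r A) (fMinus r A).
(* Only row sums sigma(A) survive, and they are those of the leading matrix by [ro_St_lower]; this
   upgrades [tri] to [top]. *)
have zE C : z C = if `[< ro C =1 sigi A >] then fMinus r A C else 0.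
  rewrite /z ksig_dg emul_dg; case: eqP => [sC|sC].
    by rewrite ksig_coef ?sA //; case: ifP; rewrite ?mul1r ?mul0r.
  have -> : fMinus r A C = 0 by apply/eqP/negPn/negP => /(nice_fMinus r A).2.
  by rewrite if_same.
have [_ sB fB supp lau] := T1.
have Tz : top r (St A low) z.
  have zr B' : z B' != 0 -> ro B' =1 ro (St A low).
    by rewrite zE; case: asboolP => [e _ i|_]; rewrite ?eqxx // e ro_St_lower.
  split; [split | exact: zr].
  - exact: nice_emul nk (nice_fMinus r A).
  - exact: sB.
  - by rewrite zE; case: asboolP => // ne; case: ne; exact: ro_St_lower.
  - by move=> B' e; rewrite zE; case: ifP; [move=> _; exact: supp | rewrite eqxx].
  by move=> B' e; rewrite zE; case: ifP => _; [exact: lau | exact: laurent0].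
have nt B y : top r B y -> nice r y by case=> -[].
rewrite /mm (emulA (nice_ePlus r A).1 nk.1 (nice_fMinus r A).1) -/z.
apply: (St_ePlus nt) Tz => b h J a B C y [t hm] ld; split; first exact: tri_step t ld.
by have [ny sB' _ _ _] := t; exact: homo_step ny sB' hm ld.
Qed.

(** * The basis *)

Lemma inVP r x : inV r x <-> exists s : seq (mat * zvec * Qv), (forall t, t \in s -> isPM t.1.1) /\
  forall C, x C = \sum_(t <- s) t.2 * Aj t.1.1 t.1.2 r C.
Proof.
have e (s : seq (mat * zvec * Qv)) C : foldr (fun t acc => eadd (escal t.2 (Aj t.1.1 t.1.2 r)) acc) (fun _ => 0) s C =
    \sum_(t <- s) t.2 * Aj t.1.1 t.1.2 r C.
  by elim: s => [|t s IH] /=; rewrite ?big_nil // big_cons -IH.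
by split=> -[s [h xE]]; exists s; split=> // C; rewrite xE e.
Qed.

Lemma inV_sum r (I : Type) (s : seq I) (c : I -> Qv) (x : I -> elt) (y : elt) :
  (forall i, List.In i s -> inV r (x i)) -> (forall C, y C = \sum_(i <- s) c i * x i C) -> inV r y.
Proof.
move=> h yE; apply/inVP.
have [t [ht tE]] : exists t : seq (mat * zvec * Qv), (forall u, u \in t -> isPM u.1.1) /\
    forall C, \sum_(i <- s) c i * x i C = \sum_(u <- t) u.2 * Aj u.1.1 u.1.2 r C.
  elim: s h {yE} => [|i s IH] h; first by exists [::]; split=> // C; rewrite !big_nil.
  have [t [ht tE]] := IH (fun j js => h j (or_intror js)).
  have /inVP[t' [ht' tE']] := h i (or_introl erefl).
  exists ([seq (u.1, c i * u.2) | u <- t'] ++ t); split.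
    by move=> u; rewrite mem_cat => /orP[/mapP[u' /ht' hu' ->]|/ht].
  move=> C; rewrite big_cons big_cat big_map tE' tE mulr_sumr; congr (_ + _).
  by apply: eq_bigr => u _; rewrite mulrA.
by exists t; split=> // C; rewrite yE tE.
Qed.

(** * Characters of the diagonal *)

Definition charsum (F : nvec -> Qv) : Prop := exists s : seq (zvec * Qv),
  forall m, F m = \sum_(t <- s) t.2 * v ^ dotv m t.1.

Lemma charsum1 : charsum (fun _ => 1).
Proof. by exists [:: (zvec0, 1)] => m; rewrite big_seq1 dotv0 mulr1. Qed.

Lemma charsumD F G : charsum F -> charsum G -> charsum (fun m => F m + G m).
Proof. by move=> [s sF] [t tG]; exists (s ++ t) => m; rewrite big_cat sF tG. Qed.

Lemma charsumZ c F : charsum F -> charsum (fun m => c * F m).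
Proof.
move=> [s sF]; exists [seq (t.1, c * t.2) | t <- s] => m; rewrite big_map sF mulr_sumr.
by apply: eq_bigr => t _; rewrite mulrA.
Qed.

Lemma dotv_shift (j : zvec) (i e : int) : exists j' : zvec, forall m : nvec, dotv m j' = dotv m j + (m i)%:Z * e.
Proof.
exists [fsfun k in (i |` finsupp j)%fset => j k + (if k == i then e else 0) | 0] => m.
have -> : (m i)%:Z * e = \sum_(k <- finsupp m) (m k)%:Z * (if k == i then e else 0).
  rewrite -(nsum1 m i) /nsum -natz natr_sum mulr_suml big_mkcond; apply: eq_bigr => k _.
  by case: ifP; rewrite ?mulr0 // natz.
rewrite /dotv -big_split; apply: eq_bigr => k _ /=; rewrite -mulrDr; congr (_ * _).
rewrite fsfunE !inE; case: (eqVneq k i) => //= _; rewrite addr0.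
by case: finsuppP.
Qed.

Lemma charsumX (i e : int) F : charsum F -> charsum (fun m => v ^ ((m i)%:Z * e) * F m).
Proof.
move=> [s sF]; have [g gE] : exists g : zvec -> zvec, forall j m, dotv m (g j) = dotv m j + (m i)%:Z * e.
  by have [g gE] := choice (fun j => dotv_shift j i e); exists g.
exists [seq (g t.1, t.2) | t <- s] => m; rewrite big_map sF mulr_sumr.
by apply: eq_bigr => t _ /=; rewrite gE vzD mulrCA [v ^ dotv _ _ * _]mulrC.
Qed.

(** Each factor of [gb (m i) t] is a combination of the characters v^(m_i) and v^(-m_i). *)
Lemma charsum_gb (i : int) t F : charsum F -> charsum (fun m => gb (m i) t * F m).
Proof.
rewrite /gb => hF; elim: (iota 1 t) => [|s l IH].
  by have := hF; congr charsum; apply: funext => m; rewrite big_nil mul1r.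
have gen (K : comNzRingType) (a b c d e f g : K) :
  c * (d * (e * (a * b)) + - f * (g * (a * b))) = c * (d * e + - f * g) * a * b by ring.
have h := charsumZ (v ^+ s - v ^- s)^-1 (charsumD (charsumZ (v ^ (1 - s%:Z)) (charsumX i 1 IH))
  (charsumZ (- v ^ (s%:Z - 1)) (charsumX i (- 1) IH))).
have := h; congr charsum; apply: funext => m.
rewrite big_cons mulr1 mulrN1 -invr_expz.
exact: gen.
Qed.

(** F is the product of the [gb (m i) (l i)]: if m differs from l and has the same total, some m_i
    is smaller than l_i. *)
Lemma charsum_delta (l : nvec) : exists F, charsum F /\
  forall m, sigl m = sigl l -> F m = (m == l)%:R.
Proof.
exists (fun m => \prod_(i <- finsupp l) gb (m i) (l i)); split.
  elim: (enum_fset (finsupp l)) => [|i s IH].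
    by have := charsum1; congr charsum; apply: funext => m; rewrite big_nil.
  have := charsum_gb i (l i) IH; congr charsum; apply: funext => m; by rewrite big_cons.
move=> m sm; case: eqVneq => [->|ml]; first by rewrite big1 // => i _; exact: gb_diag.
apply/eqP/negPn/negP; rewrite prodf_seq_neq0 => /allP nz; case/eqP: ml; apply/esym.
apply: leq_nvec_eq => // i; case: (finsuppP l i) => // il.
by rewrite leqNgt; apply/negP => lt; have := nz _ il; rewrite gb_lt ?eqxx.
Qed.

(** A0 is the off-diagonal part of A. A combination of the A0(j, r) has at A0 + diag(m) a character
    sum in m as coefficient, and [charsum_delta] makes this the indicator of the diagonal of A. *)
Lemma basisv_inV r A : sig A = r -> inV r (basisv A).
Proof.
move=> sA.
pose A0 : mat := [fsfun p in finsupp A => if p.1 == p.2 then 0%N else A p | 0%N].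
have A0E i j : ent A0 i j = if i == j then 0%N else ent A i j.
  by rewrite /ent fsfunE /=; case: finsuppP => //; rewrite if_same.
pose l : nvec := [fsfun i in [fset p.1 | p in finsupp A]%fset => A (i, i) | 0%N].
have lE i : l i = ent A i i.
  rewrite fsfunE; case: imfsetP => // no; apply/esym/eqP; rewrite -[_ == _]negbK -mem_finsupp.
  by apply/negP => pA; apply: no; exists (i, i).
have eA : A = madd A0 (diagm l).
  apply: entP => i j; rewrite ent_madd A0E ent_diagm lE.
  by case: eqP => [<-|]; rewrite ?addn0.
have [F [[s sF] FE]] := charsum_delta l.
apply/inVP; exists [seq (A0, t.1, t.2) | t <- s]; split.
  by move=> t /mapP[u _ -> i] /=; have := A0E i i; rewrite eqxx.
move=> C; rewrite big_map /=.
have [[m eC]|no] := pselect (exists m, C = madd A0 (diagm m)); last first.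
  rewrite /basisv; case: eqP => [CA|_]; first by case: no; exists l; rewrite CA.
  rewrite big1 // => t _; have [->|/Aj_neq0[m [e _]]] := eqVneq (Aj A0 t.1 r C) 0; first by rewrite mulr0.
  by case: no; exists m.
have [sC|sC] := eqVneq (sig C) r; last first.
  rewrite /basisv; case: eqP => [CA|_]; first by rewrite CA sA eqxx in sC.
  by rewrite big1 // => t _; rewrite eC Aj_in -eC (negPf sC) mulr0.
under eq_bigr do rewrite eC Aj_in -eC sC eqxx.
rewrite -sF FE; last first.
  by apply/eqP; rewrite -(eqn_add2l (sig A0)) -!sig_madd_diagm -eA -eC sA sC.
rewrite /basisv eC eA; congr (_%:R); congr nat_of_bool.
by apply/eqP/eqP => [/madd_diagm_inj|->].
Qed.

(** * Triangularity and the integral basis *)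

Lemma finite_supp (phi : elt) : finite_set (fun A => phi A != 0) ->
  exists s : seq mat, [/\ uniq s, (forall A, (A \in s) = (phi A != 0)) &
    forall C, phi C = \sum_(A <- s) phi A * basisv A C].
Proof.
move=> /finite_seqP[s e].
have sE A : (A \in undup s) = (phi A != 0).
  rewrite mem_undup; have eA : (phi A != 0 : Prop) = (A \in s) by have := congr1 (fun P : set mat => P A) e.
  by apply/idP/idP; rewrite eA.
exists (undup s); split=> //; first exact: undup_uniq.
move=> C; have [Cs|Cs] := boolP (C \in undup s).
  rewrite (bigD1_seq C) ?undup_uniq //= /basisv eqxx mulr1 big1 ?addr0 // => A AC.
  by rewrite eq_sym (negPf AC) mulr0.
have -> : phi C = 0 by apply/eqP; move: Cs; rewrite sE negbK.
rewrite big1_seq // => A /andP[_ As]; rewrite /basisv; case: eqP => [e'|_]; last by rewrite mulr0.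
by rewrite e' As in Cs.
Qed.

Lemma KQ_inV r phi : KQ r phi -> inV r phi.
Proof.
move=> [fin sphi]; have [s [_ sE pE]] := finite_supp fin.
apply: (inV_sum _ pE) => A As; apply/basisv_inV/sphi; rewrite -sE.
by elim: s As {sE pE} => //= B s IH [->|/IH]; rewrite inE ?eqxx // => ->; rewrite orbT.
Qed.

Lemma top_eadd r A x : top r A x -> exists f : mat -> Qv,
  [/\ finite_set (fun B => f B != 0), (forall B, f B != 0 -> [/\ ro B =1 ro A, co B =1 co A, sig B = r & prec B A]),
      (forall B, laurent (f B)) & x =1 eadd (basisv A) f].
Proof.
move=> [[_ sA xA supp lau] hom]; exists (fun B => if B == A then 0 else x B).
have fB B : (if B == A then 0 else x B) != 0 -> [/\ ro B =1 ro A, co B =1 co A, sig B = r & prec B A].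
  case: (eqVneq B A) => [_|BA] xB; first by rewrite eqxx in xB.
  have e := hom _ xB; have [ec le] := supp _ e xB.
  by split=> //; [rewrite (eq_ro_sig e) | exact: prec_leq_sig].
split=> //.
(* Finiteness of the sum: sharing the row and column sums of A confines B to the window of A. *)
- have [N AN] := inN_exists A; apply: (@sub_finite_set _ _ [set` Om N r]); last exact: finite_seq.
  move=> B /fB[er ec sB _]; rewrite /= mem_Om sB eqxx andbT.
  exact: (inN_rows_cols er ec AN AN).
- move=> B; case: eqVneq => [_|BA]; first exact: laurent0.
  have [->|xB] := eqVneq (x B) 0; [exact: laurent0 | exact/lau/hom].
move=> B; rewrite /eadd /basisv; case: eqVneq => [->|_]; first by rewrite xA addr0.
by rewrite add0r.
Qed.

Lemma KZ_mm r A : sig A = r -> KZ r (mm r A).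
Proof.
move=> sA; have tA := top_mm sA; have [f [fin fB lf xE]] := top_eadd tA.
have [[_ _ _ _ lau] hom] := tA; split; last split.
- apply: (@sub_finite_set _ _ ([set A] `|` (fun B => f B != 0))%classic); last first.
    by rewrite finite_setU; split=> //; exact: finite_set1.
  move=> B; rewrite xE /eadd /basisv /=; case: (eqVneq B A) => [->|_]; first by left.
  by rewrite add0r; right.
- by move=> B /hom e; rewrite (eq_ro_sig e).
by move=> B; have [->|/hom] := eqVneq (mm r A B) 0; [exact: laurent0 | exact: lau].
Qed.

Lemma comb_seq r c (s : seq mat) C : uniq s -> (forall A, c A != 0 -> A \in s) ->
  comb r c C = \sum_(A <- s) c A * mm r A C.
Proof.
move=> us cs; rewrite /comb (@fsum_seq _ _ _ _ s) // => A _ As.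
by have [->|/cs] := eqVneq (c A) 0; [rewrite mul0r | move=> /(elimT negP (As))].
Qed.

Lemma KZ_seq r phi : KZ r phi <-> exists s : seq mat, [/\ uniq s, (forall A, phi A != 0 -> A \in s),
  (forall A, A \in s -> sig A = r) & forall A, laurent (phi A)].
Proof.
split=> [[fin [sp lp]]|[s [_ ps ss lp]]].
  have [s [us sE _]] := finite_supp fin; exists s; split=> // A; first by rewrite sE.
  by rewrite sE; exact: sp.
split; last by split=> // A /ps /ss.
by apply: (@sub_finite_set _ _ [set` s]); [move=> A /ps | exact: finite_seq].
Qed.

Lemma add_mul_neq0 (K : pzRingType) (x a y : K) : x + a * y != 0 -> x != 0 \/ y != 0.
Proof.
case: (eqVneq x 0) => [->|_ _]; last by left.
by rewrite add0r => nz; right; apply: contraNneq nz => ->; rewrite mulr0.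
Qed.

Lemma KZ0 r : KZ r (fun _ => 0).
Proof. by apply/KZ_seq; exists [::]; split=> // A; rewrite ?eqxx //; exact: laurent0. Qed.

Lemma KZD r c c' a : KZ r c -> KZ r c' -> laurent a -> KZ r (fun A => c A + a * c' A).
Proof.
move=> /KZ_seq[s [us cs ss lc]] /KZ_seq[s' [us' cs' ss' lc']] la; apply/KZ_seq.
exists (undup (s ++ s')); split; first exact: undup_uniq.
- by move=> A; rewrite mem_undup mem_cat => /add_mul_neq0[/cs ->|/cs' ->] //; rewrite orbT.
- by move=> A; rewrite mem_undup mem_cat => /orP[/ss|/ss'].
by move=> A; apply: laurentD => //; exact: laurentM.
Qed.

Lemma combD r c c' a C : KZ r c -> KZ r c' ->
  comb r (fun A => c A + a * c' A) C = comb r c C + a * comb r c' C.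
Proof.
move=> /KZ_seq[s [us cs ss lc]] /KZ_seq[s' [us' cs' ss' lc']].
pose t := undup (s ++ s'); have ut : uniq t by exact: undup_uniq.
have ct A : c A != 0 -> A \in t by rewrite mem_undup mem_cat => /cs ->.
have ct' A : c' A != 0 -> A \in t by rewrite mem_undup mem_cat orbC => /cs' ->.
rewrite (comb_seq _ _ ut ct) (comb_seq _ _ ut ct') (comb_seq _ _ ut); last first.
  by move=> A /add_mul_neq0[/ct|/ct'].
rewrite mulr_sumr -big_split; apply: eq_bigr => A _ /=.
by rewrite mulrDl mulrA.
Qed.

Definition spanned r (phi : elt) : Prop := exists c, KZ r c /\ phi =1 comb r c.

Lemma spanned_sum r (s : seq mat) (a : mat -> Qv) (x : mat -> elt) (y0 y : elt) : spanned r y0 ->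
  (forall A, A \in s -> spanned r (x A)) -> (forall A, laurent (a A)) ->
  (forall C, y C = y0 C + \sum_(A <- s) a A * x A C) -> spanned r y.
Proof.
move=> s0 hx la; elim: s hx y => [|A s IH] hx y yE.
  by have [c [kc e]] := s0; exists c; split=> // C; rewrite yE big_nil addr0.
have [c [kc e]] := IH (fun B Bs => hx B (mem_behead (s := A :: s) Bs)) _ (fun C => erefl).
have [c' [kc' e']] := hx A (mem_head A s).
exists (fun B => c B + a A * c' B); split; first exact: KZD.
by move=> C; rewrite combD // -e -e' yE big_cons addrCA addrC.
Qed.

Lemma spanned_mm r A : sig A = r -> spanned r (mm r A).
Proof.
move=> sA; exists (basisv A); split.
  apply/KZ_seq; exists [:: A]; split=> // [B|B|B]; rewrite ?inE /basisv.
  - by case: (B =P A) => // _; rewrite eqxx.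
  - by move/eqP ->.
  by case: eqP => _; [exact: laurent1 | exact: laurent0].
move=> C; rewrite (@comb_seq _ _ [:: A]) //; last by move=> B; rewrite inE /basisv; case: (B =P A) => // _; rewrite eqxx.
by rewrite big_seq1 /basisv eqxx mul1r.
Qed.

(** [A] is m^(A) minus lower terms with Laurent coefficients, and these have smaller [wt] in a
    window common to all of them. *)
Lemma spanned_basisv r A : sig A = r -> spanned r (basisv A).
Proof.
have [N AN] := inN_exists A; have [n] := ubnP (wt N A).
elim: n => // n IH in A AN * => wA sA.
have [f [fin fB lf xE]] := top_eadd (top_mm sA); have [s [us sE fE]] := finite_supp fin.
apply: (@spanned_sum r s (fun B => - f B) basisv _ _ (spanned_mm sA)).
- move=> B; rewrite sE => /fB[er ec sB pB]; apply: IH => //; first exact: (inN_rows_cols er ec AN AN).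
  by have := wt_prec pB AN; lia.
- by move=> B; exact: laurentN.
by move=> C; rewrite xE /eadd {1}fE -addrA -big_split big1 ?addr0 // => B _; rewrite /= mulNr subrr.
Qed.

Lemma KZ_spanned r phi : KZ r phi -> spanned r phi.
Proof.
move=> [fin [sp lp]]; have [s [us sE pE]] := finite_supp fin.
apply: (@spanned_sum r s phi basisv (fun _ => 0)) => //.
- exists (fun _ => 0); split; first exact: KZ0.
  have z A : (fun _ : mat => 0 : Qv) A != 0 -> A \in [::] by rewrite eqxx.
  by move=> C; rewrite (@comb_seq r _ [::] C isT z) big_nil.
- by move=> A; rewrite sE => /sp; exact: spanned_basisv.
by move=> C; rewrite add0r.
Qed.

(** In a nontrivial relation take B of largest [wt] among the matrices that occur. It is not a lower
    term of any other of them, so the coefficient of [B] in the relation is that of m^(B), which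
    cannot be 0. *)
Lemma comb_inj r c1 c2 : KZ r c1 -> KZ r c2 -> comb r c1 =1 comb r c2 -> c1 =1 c2.
Proof.
move=> k1 k2 e; pose d A := c1 A + - 1 * c2 A.
have kd : KZ r d by apply: KZD => //; exact/laurentN/laurent1.
have d0 C : comb r d C = 0 by rewrite /d combD // e mulN1r subrr.
suff dz A : d A = 0 by move=> A; apply/eqP; rewrite -subr_eq0 -(dz A) /d mulN1r.
apply/eqP/negPn/negP => dA; have /KZ_seq[s [us ds ss _]] := kd.
have [N sN] : exists N, forall B, B \in s -> inN N B.
  elim: s {us ds ss} => [|B s [N IH]]; first by exists 0%N.
  have [M BM] := inN_exists B; exists (M + N)%N => C; rewrite inE => /orP[/eqP ->|/IH].
    by apply: inN_leq BM; lia.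
  by apply: inN_leq; lia.
pose s' := [seq B <- s | d B != 0].
have As : A \in s' by rewrite mem_filter dA ds.
have [B] := seq_argmax (wt N) As; rewrite mem_filter => /andP[dB Bs] mx.
have := d0 B; rewrite (comb_seq _ _ us ds) (bigD1_seq B) //=.
have [[_ _ -> _ _] _] := top_mm (ss _ Bs).
rewrite mulr1 big1_seq ?addr0 => [z|C /andP[CB Cs]]; first by rewrite z eqxx in dB.
have [->|dC] := eqVneq (d C) 0; first by rewrite mul0r.
have [f [_ fB _ xE]] := top_eadd (top_mm (ss _ Cs)).
rewrite xE /eadd /basisv eq_sym (negPf CB) add0r.
have [->|/fB[_ _ _ pB]] := eqVneq (f B) 0; first by rewrite mulr0.
have := mx C; rewrite mem_filter dC Cs => /(_ isT).
by have := wt_prec pB (sN _ Cs); lia.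
Qed.

Theorem theorem5p5 (r : nat) :
  (* m^{(A)} = [A] + sum_{B prec A} f_{B,A} [B], finite sum, f_{B,A} in Z[v,v^-1],
     an identity in \hat K(infty,r), with m^{(A)} in V(infty,r) *)
  (forall A : mat, sig A = r ->
     inV r (mm r A) /\
     exists f : mat -> Qv,
       finite_set (fun B => f B != 0) /\
       (forall B, f B != 0 -> sig B = r /\ prec B A) /\
       (forall B, laurent (f B)) /\
       mm r A =1 eadd (basisv A) f)
  (* the m^{(A)}, A in Xi(infty,r), form a Z[v,v^-1]-basis of K(infty,r) *)
  /\ (forall A : mat, sig A = r -> KZ r (mm r A))
  /\ (forall phi, KZ r phi -> exists c, KZ r c /\ phi =1 comb r c)
  /\ (forall c1 c2, KZ r c1 -> KZ r c2 -> comb r c1 =1 comb r c2 -> c1 =1 c2)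
  (* boldK(infty,r) is contained in V(infty,r) *)
  /\ (forall phi, KQ r phi -> inV r phi).
Proof.
split; [|split; [|split; [|split]]].
- move=> A sA; split.
    by have [fin [sp _]] := KZ_mm sA; apply: KQ_inV.
  have [f [fin fB lf xE]] := top_eadd (top_mm sA); exists f; split=> //; split=> // B /fB[].
  by [].
- exact: KZ_mm.
- exact: KZ_spanned.
- exact: comb_inj.
exact: KQ_inV.
Qed.
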